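(* One has $$\sum_{k\ge0}\lambda^{2k}G_k(z)=\log\Big(\frac1{\sqrt{2\pi\lambda^2}}\int G(x+z+1)\,\exp\big(\widetilde S(x,z)\big)\,dx\Big),$$ where $G(\cdot)$ without subscript is the Barnes $G$-function and $$\begin{aligned}\widetilde S(x,z)=&-\frac{\lambda^{-2}}2x^2-\Big(\zeta'(-1)+\frac z2\log(2\pi)+\Big(\frac{z^2}2-\frac1{12}\Big)\log z-\frac{3z^2}4\Big)\\&+x\Big(-\frac12\log(2\pi)-z\log z+z\Big)-\frac{x^2}2\log z.\end{aligned}$$ The integral is a formal Gaussian integral in $x$ and the identity is one of formal power series in $\lambda^2$ whose coefficients are asymptotic expansions as $z\to+\infty$.
   Context: Stable graphs: a stable graph is a finite graph (loops and multiple edges allowed) with internal edges, each joining two (possibly equal) vertices, and unlabelled external edges, each attached to one vertex. Each vertex $v$ carries a genus $g_v\in\mathbb Z_{\ge0}$; its valence $\mathrm{val}_v$ is the number of half-edges at $v$ (an external edge counts once, a loop twice); stability means $2g_v-2+\mathrm{val}_v>0$ for every $v$. The genus of a connected stable graph $\Gamma$ is $h^1(\Gamma)+\sum_v g_v$. $\mathcal G^c_{g,0}$ is the (finite) set of isomorphism classes of connected stable graphs of genus $g$ with no external edges, $V(\Gamma)$, $E(\Gamma)$ are the sets of vertices and internal edges, and $\mathrm{Aut}(\Gamma)$ is the automorphism group (acting on vertices and half-edges). For $2g-2+n>0$, $\chi(\mathcal M_{g,n})=(-1)^n\frac{(2g-1)B_{2g}}{(2g)!}(2g+n-3)!$ is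 the orbifold Euler characteristic of $\mathcal M_{g,n}$ (Harer–Zagier formula). For $g\ge2$ and $k\ge0$ let $a_{g,0}^k$ be the coefficient of $\kappa^k$ in $\widetilde\chi_{g,0}(\kappa)=\sum_{\Gamma\in\mathcal G^c_{g,0}}\frac{\kappa^{|E(\Gamma)|}}{|\mathrm{Aut}(\Gamma)|}\prod_{v}\chi(\mathcal M_{g_v,\mathrm{val}_v})$, and let $G_k(z):=\sum_{g\ge2}a_{g,0}^k\,z^{2-2g}$, a formal power series in $z^{-1}$. The Barnes $G$-function is $G(z+1)=(2\pi)^{z/2}e^{-z(z+1)/2-\gamma z^2/2}\prod_{n\ge1}\big\{(1+\frac zn)^ne^{-z+z^2/(2n)}\big\}$, with $\gamma$ the Euler–Mascheroni constant; $\zeta$ is the Riemann zeta function. Formal Gaussian integral: one expands $\log G(x+z+1)=\sum_{n\ge0}\frac{x^n}{n!}\frac{d^n}{dz^n}\log G(z+1)$ as a Taylor series in $x$, each coefficient being replaced by its asymptotic expansion as $z\to+\infty$; the whole exponent other than $-\frac{x^2}{2\lambda^2}$ is exponentiated as a power series in $x$ and integrated term by term by the rule $\frac1{\sqrt{2\pi\lambda^2}}\int e^{-x^2/(2\lambda^2)}x^{m}dx=(m-1)!!\,\lambda^{m}$ for $m$ even (with $(-1)!!=1$) and $0$ for $m$ odd. *)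

(* Defs.v *)
From HB Require Import structures.
From mathcomp Require Import all_boot all_order all_algebra perm.

Set Implicit Arguments.
Unset Strict Implicit.
Unset Printing Implicit Defensive.

Import Order.TTheory GRing.Theory Num.Theory.

Section StableGraphs.
Variables (V H : finType) (N : nat).

(* [H] is the set of half-edges, [root] sends a half-edge to its vertex, and
   [flip] pairs the two halves of an internal edge; an external edge is a fixed
   point of [flip].  Vertex genera are < N so that the type is finite. *)
Record hgraph := HGraph {
  root : {ffun H -> V};
  flip : {ffun H -> H};
  gen : {ffun V -> 'I_N} }.

Definition hgraph_to (G : hgraph) := (root G, flip G, gen G).
Definition hgraph_of (t : {ffun H -> V} * {ffun H -> H} * {ffun V -> 'I_N}) :=
  HGraph t.1.1 t.1.2 t.2.
Lemma hgraph_toK : cancel hgraph_to hgraph_of. Proof. by case. Qed.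
HB.instance Definition _ := Finite.copy hgraph (can_type hgraph_toK).

Variable G : hgraph.

Definition valence (v : V) : nat := #|[set h | root G h == v]|.

Definition edges : {set {set H}} :=
  [set [set h; flip G h] | h : H & flip G h != h].

Definition well_formed : bool := [forall h, flip G (flip G h) == h].

Definition no_external : bool := [forall h, flip G h != h].

Definition stable : bool := [forall v, 2 < 2 * gen G v + valence v].

Definition adj : rel V :=
  [rel u v | [exists h, (root G h == u) && (root G (flip G h) == v)]].

Definition connected : bool :=
  (0 < #|V|) && [forall u, forall v, connect adj u v].

(* For a connected graph h^1 = |E| - |V| + 1. *)
Definition genus : int :=
  (#|edges|%:Z - #|V|%:Z + 1 + (\sum_v gen G v)%N%:Z)%R.

End StableGraphs.

Definition is_giso (V H : finType) (N : nat) (G G' : hgraph V H N)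
    (p : {perm V}) (q : {perm H}) : bool :=
  [&& [forall h, root G' (q h) == p (root G h)],
      [forall h, flip G' (q h) == q (flip G h)]
    & [forall v, gen G' (p v) == gen G v]].

Definition giso (V H : finType) (N : nat) : rel (hgraph V H N) :=
  fun G G' => [exists p : {perm V}, exists q : {perm H}, is_giso G G' p q].

Definition aut (V H : finType) (N : nat) (G : hgraph V H N) :
    {set {perm V} * {perm H}} :=
  [set pq | is_giso G G pq.1 pq.2].

(* Connected stable graphs of genus g without external edges, with v vertices
   and h half-edges.  A vertex of such a graph has genus at most g. *)
Definition stable_graphs (g v h : nat) : {set hgraph 'I_v 'I_h g.+1} :=
  [set G | [&& well_formed G, no_external G, stable G, connected G
             & genus G == Posz g]].

Definition graph_reps (g v h : nat) : {set hgraph 'I_v 'I_h g.+1} :=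
  transversal
    (equivalence_partition (@giso 'I_v 'I_h g.+1) (stable_graphs g v h))
    (stable_graphs g v h).

Local Open Scope ring_scope.

(* B_0 = 1 and \sum_(k <= n) 'C(n + 1, k) B_k = 0 for n > 0. *)
Fixpoint bernoulli_seq (F : fieldType) (n : nat) : seq F :=
  if n is m.+1 then
    let s := bernoulli_seq F m in
    rcons s (if m is 0 then 1
             else - (m.+1%:R)^-1 * \sum_(k < m) 'C(m.+1, k)%:R * s`_k)
  else [::].

Definition bernoulli (F : fieldType) (n : nat) : F := (bernoulli_seq F n.+1)`_n.

(* Harer-Zagier; used only for 2g - 2 + n > 0, where the truncated subtraction
   2g + n - 3 is exact. *)
Definition chiM (F : fieldType) (g n : nat) : F :=
  (-1) ^+ n * (((2 * g)%:R - 1) * bernoulli F (2 * g)) / ((2 * g)`!)%:R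
  * ((2 * g + n - 3)`!)%:R.

(* Summing 2 g_v - 2 + val_v >= 1 over the vertices shows that a graph in the
   sum has at most 2g - 2 vertices, hence at most 3g - 3 edges, i.e. 6g - 6
   half-edges: the sum runs over all isomorphism classes. *)
Definition chi_tilde (F : fieldType) (g : nat) : {poly F} :=
  \sum_(v < (2 * g - 2).+1) \sum_(h < (6 * g - 6).+1)
    \sum_(G in graph_reps g v h)
      ((\prod_x chiM F (gen G x) (valence G x)) / #|aut G|%:R) *: 'X^#|edges G|.

Definition a_coef (F : fieldType) (g k : nat) : F := (chi_tilde F g)`_k.

(* [G_series F k m] is the coefficient of z^-m in G_k(z). *)
Definition G_series (F : fieldType) (k m : nat) : F :=
  if ~~ odd m && (2 <= m)%N then a_coef F m./2.+1 k else 0.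

(* Formal power series in two variables: [f i j] is the coefficient of the i-th
   power of the first variable times the j-th power of the second one. *)
Section FormalPowerSeries.
Variable F : fieldType.

Definition fps2 := nat -> nat -> F.

Definition fps2_one : fps2 := fun i j => ((i == 0%N) && (j == 0%N))%:R.

Definition fps2_sub (f g : fps2) : fps2 := fun i j => f i j - g i j.

Definition fps2_mul (f g : fps2) : fps2 := fun i j =>
  \sum_(a < i.+1) \sum_(b < j.+1) f a b * g (i - a)%N (j - b)%N.

Definition fps2_pow (f : fps2) (m : nat) : fps2 := iter m (fps2_mul f) fps2_one.

(* Exponential of a series with constant term 0: since f^m has no term of total
   degree < m, the truncated sum is the full exponential series. *)
Definition fps2_exp (f : fps2) : fps2 := fun i j =>
  \sum_(m < (i + j).+1) fps2_pow f m i j / (m`!)%:R.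

(* Logarithm of a series with constant term 1, truncated in the same way. *)
Definition fps2_log (f : fps2) : fps2 := fun i j =>
  \sum_(m < i + j)
    (-1) ^+ m / m.+1%:R * fps2_pow (fps2_sub f fps2_one) m.+1 i j.

(* From a series in (x, z^-1) to a series in (lambda^2, z^-1): x^(2j) becomes
   (2j - 1)!! lambda^(2j), and odd powers of x integrate to 0. *)
Definition gauss_integral (f : fps2) : fps2 := fun j k =>
  (\prod_(i < j) (2 * i + 1))%N%:R * f (2 * j)%N k.

End FormalPowerSeries.

From mathcomp Require Import all_classical all_reals all_analysis.
Import numFieldNormedType.Exports.

Local Open Scope classical_set_scope.
Local Open Scope ring_scope.

Section Analysis.
Variable R : realType.

(* The restriction of the Riemann zeta function to the real line without 1:
   the Dirichlet series for s > 1, continued through the entire function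
   (s - 1) zeta(s), i.e. through the Laurent expansion of zeta at its only pole,
   which converges everywhere.  This determines zeta s for all s != 1. *)
Definition is_riemann_zeta (zeta : R -> R) : Prop :=
  (forall s, 1 < s ->
     series (fun n => n.+1%:R `^ (- s)) n @[n --> \oo] --> zeta s) /\
  (exists c : nat -> R, forall s, s != 1 ->
     series (fun n => c n * (s - 1) ^+ n) n @[n --> \oo]
       --> (s - 1) * zeta s).

Definition euler_mascheroni : R :=
  lim ((\sum_(1 <= k < n.+1) (k%:R)^-1 - ln n%:R) @[n --> \oo]).

(* The Barnes G-function at w = z + 1, for real w. *)
Definition barnesG (w : R) : R :=
  let z := w - 1 in
  (2 * pi) `^ (z / 2)
  * expR (- (z * (z + 1)) / 2 - euler_mascheroni * z ^+ 2 / 2)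
  * lim ((\prod_(1 <= n < m.+1)
            ((1 + z / n%:R) ^+ n * expR (- z + z ^+ 2 / (2 * n%:R))))
         @[m --> \oo]).

(* f(z) ~ \sum_k a_k z^(-k) as z --> +oo. *)
Definition asymptotic_expansion (f : R -> R) (a : nat -> R) : Prop :=
  forall n : nat,
    z ^+ n * (f z - \sum_(k < n.+1) a k * z ^- k) @[z --> +oo] --> (0 : R).

(* S~(x, z) + x^2 / (2 lambda^2), as a polynomial in x. *)
Definition S_tilde (zeta : R -> R) (z : R) : {poly R} :=
  - (derive1 zeta (- 1) + z / 2 * ln (2 * pi)
     + (z ^+ 2 / 2 - 1 / 12) * ln z - 3 * z ^+ 2 / 4)%:P
  + (- (1 / 2) * ln (2 * pi) - z * ln z + z) *: 'X
  - (ln z / 2) *: 'X^2.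

(* Coefficient of x^n in log G(x + z + 1) + S~(x, z) + x^2 / (2 lambda^2). *)
Definition exponent_coef (zeta : R -> R) (n : nat) (z : R) : R :=
  derive1n n (fun t => ln (barnesG (t + 1))) z / (n`!)%:R + (S_tilde zeta z)`_n.

End Analysis.

(* Main.v *)
Require Import Defs.
From HB Require Import structures.
From mathcomp Require Import all_boot all_order all_algebra fingroup perm.
From mathcomp Require Import ring lra zify.

(** Both sides are computed through one fact: the coefficient of x^n z^-j in the
    asymptotic expansion of the exponent is chi(M_(g,n)) / n! with 2g - 2 + n = j,
    and 0 if there is no such g ([exponent]). The integral is then a Gaussian
    integral whose Feynman graphs are the stable graphs, with their weights.

    The graph expansion ([graph_sum_log]). By orbit-stabilizer, a sum over
    isomorphism classes weighted by 1/|Aut| is a sum over graphs with labelled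
    vertices and half-edges divided by factorials ([sum_transversal_aut]). A
    labelled graph is an independent choice of the vertex of each half-edge, of a
    matching of the half-edges and of the genera. Connected graphs are isolated by
    colours: the vertex colourings with t colours that are constant along edges
    number t^c, for c the number of components ([card_colouring]), so that the sum
    of t^c over all graphs is a polynomial in t whose linear coefficient is the sum
    over connected graphs. When the colouring is chosen first, the colours do not
    interact, and the sum is the coefficient of Z^t for Z the Gaussian integral
    ([wick_colours], [sum_colourings], [horner_graph_poly]). On the other hand Z^t
    is the sum of binom(t,u) (Z-1)^u, which is polynomial in t with linear
    coefficient log Z ([log_graph_poly]).

    The expansion of the exponent ([asymptotic_exponent]). The logarithm of the
    product for G(z+1) has the summands m ln(z+m) - m ln m - z + z^2/(2m), and the
    Euler-Maclaurin formula expands their sum ([bsum_em]). Its constant term is the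
    limit of the sum of m ln m after removal of the diverging terms, which is
    1/12 - zeta'(-1) ([lim_deriv_zeta]); this rests on the Taylor coefficients at
    s = 1 of (s-1) zeta(s), which are the only data on zeta to the left of 1 and
    are obtained as limits of those of truncations of the Dirichlet series. All
    terms that are not negative powers of z cancel against S~, and the rest is the
    sum of B_(2g) / (2g (2g-2)) z^(2-2g), that is of chi(M_(g,0)) z^(2-2g). The
    higher coefficients in x follow by differentiation in z, since the expansions
    can be differentiated ([expansion_derive]) and since
    chi(M_(g,n+1)) = -(2g-2+n) chi(M_(g,n)) ([chi_degS]); the terms in ln z and z ln z
    of S~ produce the two exceptional values chi(M_(1,1)) and chi(M_(0,3)). *)

Set Implicit Arguments.
Unset Strict Implicit.
Unset Printing Implicit Defensive.
Import Order.TTheory GRing.Theory Num.Theory.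

(** * Graphs up to isomorphism *)

Section Orbits.
Variables (V H : finType) (N : nat).
Implicit Types (G : hgraph V H N) (p : {perm V}) (q : {perm H}).

Lemma hgraphP G G' : Defs.root G =1 Defs.root G' -> flip G =1 flip G' -> gen G =1 gen G' -> G = G'.
Proof.
by case: G G' => [r f g] [r' f' g'] /= /ffunP-> /ffunP-> /ffunP->.
Qed.

Lemma is_gisoP G G' p q :
  reflect [/\ forall h, Defs.root G' (q h) = p (Defs.root G h),
              forall h, flip G' (q h) = q (flip G h)
            & forall v, gen G' (p v) = gen G v]
          (is_giso G G' p q).
Proof.
apply: (iffP and3P) => -[hr hf hg]; split.
- by move=> h; apply/eqP/(forallP hr).
- by move=> h; apply/eqP/(forallP hf).
- by move=> v; apply/eqP/(forallP hg).
- by apply/forallP => h; rewrite hr.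
- by apply/forallP => h; rewrite hf.
- by apply/forallP => v; rewrite hg.
Qed.

Lemma is_giso1 G : is_giso G G 1%g 1%g.
Proof. by apply/is_gisoP; split=> x; rewrite !perm1. Qed.

Lemma is_gisoV G G' p q : is_giso G G' p q -> is_giso G' G p^-1%g q^-1%g.
Proof.
move=> /is_gisoP[hr hf hg]; apply/is_gisoP; split=> x.
- by rewrite -{2}(permKV q x) hr permK.
- by rewrite -{2}(permKV q x) hf permK.
- by rewrite -{2}(permKV p x) hg.
Qed.

Lemma is_gisoM G G' G'' p q p' q' :
  is_giso G G' p q -> is_giso G' G'' p' q' -> is_giso G G'' (p * p')%g (q * q')%g.
Proof.
move=> /is_gisoP[hr hf hg] /is_gisoP[hr' hf' hg'].
by apply/is_gisoP; split=> x; rewrite !permM ?hr' ?hr ?hf' ?hf ?hg' ?hg.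
Qed.

Lemma gisoP G G' : reflect (exists pq, is_giso G G' pq.1 pq.2) (giso G G').
Proof.
apply: (iffP existsP) => [[p /existsP[q hpq]]|[[p q] hpq]]; first by exists (p, q).
by exists p; apply/existsP; exists q.
Qed.

Lemma giso_equiv : equivalence_rel (@giso V H N).
Proof.
have sgiso G G' : giso G G' -> giso G' G.
  by case/gisoP=> -[p q] /is_gisoV hpq; apply/gisoP; exists (p^-1%g, q^-1%g).
have tgiso G G' G'' : giso G G' -> giso G' G'' -> giso G G''.
  case/gisoP=> -[p q] hpq /gisoP[[p' q'] hpq'].
  by apply/gisoP; exists (p * p', q * q')%g; apply: is_gisoM hpq hpq'.
move=> x y z; split; first by apply/gisoP; exists (1, 1)%g; apply: is_giso1.
by move=> xy; apply/idP/idP; [apply: tgiso; apply: sgiso | apply: tgiso].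
Qed.

Definition transport G p q :=
  HGraph [ffun h => p (Defs.root G (q^-1%g h))] [ffun h => q (flip G (q^-1%g h))]
         [ffun v => gen G (p^-1%g v)].

Lemma is_gisoE G G' p q : is_giso G G' p q = (G' == transport G p q).
Proof.
apply/is_gisoP/eqP => [[hr hf hg]|->].
  by apply: hgraphP => x; rewrite !ffunE -?hr -?hf -?hg ?permKV.
by split=> x; rewrite !ffunE !permK.
Qed.

Lemma card_is_giso G G' :
  #|[set pq : {perm V} * {perm H} | is_giso G G' pq.1 pq.2]|
  = (giso G G' * #|aut G|)%N.
Proof.
have [/gisoP[[p q] hpq]|nG] := boolP (giso G G'); last first.
  rewrite mul0n; apply/eqP; rewrite cards_eq0; apply/eqP/setP => pq.
  rewrite !inE; apply/negP => hpq; case/negP: nG.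
  by apply/gisoP; exists pq.
rewrite mul1n -[RHS](card_imset _ (f := fun ab : {perm V} * {perm H} => (ab.1 * p, ab.2 * q)%g)).
  apply: eq_card => -[a b]; apply/idP/imsetP; rewrite ?inE /=.
    move=> hab; exists (a * p^-1, b * q^-1)%g; last by rewrite /= !mulgKV.
    by rewrite inE /=; apply: is_gisoM hab (is_gisoV hpq).
  by case=> -[c d]; rewrite inE /= => hcd [-> ->]; apply: is_gisoM hcd hpq.
by move=> [a b] [c d] /= [/mulIg-> /mulIg->].
Qed.

(** Orbit-stabilizer: the pairs of permutations act on the labelled graphs, with
    orbits the isomorphism classes and stabilizers the automorphism groups. *)
Lemma card_orbit_aut G :
  (#|[set G' | giso G G']| * #|aut G|)%N = (#|V|`! * #|H|`!)%N.
Proof.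
have <- : #|[set: {perm V} * {perm H}]| = (#|V|`! * #|H|`!)%N.
  rewrite cardsT card_prod; congr (_ * _)%N.
    have := card_perm [set: V]; rewrite cardsT => <-.
    by rewrite -cardsT; apply: eq_card => s; rewrite !inE /perm_on; apply/esym/subsetP=> ?;
        rewrite inE.
  have := card_perm [set: H]; rewrite cardsT => <-.
  by rewrite -cardsT; apply: eq_card => s; rewrite !inE /perm_on; apply/esym/subsetP=> ?;
      rewrite inE.
rewrite -[RHS]sum1_card (partition_big (fun pq => transport G pq.1 pq.2) predT) //=.
rewrite -sum_nat_const.
rewrite big_mkcond /=; apply: eq_bigr => G' _.
rewrite inE -[LHS]/(if giso G G' then #|aut G| else 0%N) sum1dep_card.
transitivity #|[set pq : {perm V} * {perm H} | is_giso G G' pq.1 pq.2]|.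
  by rewrite card_is_giso; case: giso; rewrite ?mul1n ?mul0n.
by apply: eq_card => pq; rewrite !inE is_gisoE eq_sym.
Qed.

(** Hence dividing by automorphisms amounts to labelling everything, and no
    class of graphs has to be listed. *)
Lemma sum_transversal_aut (F : numFieldType) (S : {set hgraph V H N})
    (w : hgraph V H N -> F) :
    (forall G G', giso G G' -> (G' \in S) = (G \in S)) ->
    (forall G G', giso G G' -> w G' = w G) ->
  (\sum_(G in transversal (equivalence_partition (@giso V H N) S) S)
     w G / #|aut G|%:R
   = (#|V|`!%:R * #|H|`!%:R)^-1 * \sum_(G in S) w G)%R.
Proof.
move=> hS hw; set P := equivalence_partition _ _.
have eqS : {in S & &, equivalence_rel (@giso V H N)} by move=> ? ? ? *; apply: giso_equiv.
have partP : partition P S by apply: equivalence_partitionP.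
have trX := transversalP partP; set X := transversal P S in trX *.
have [/eqP coverP trivP _] := and3P partP.
have XS : X \subset S := transversal_sub trX.
have -> : (\sum_(G in S) w G = \sum_(B in P) \sum_(G in B) w G)%R.
  by rewrite -big_trivIset // coverP.
rewrite -[P in RHS](pblock_transversal trX) [X in _ = (_ * X)%R]big_imset /=;
    last exact: (pblock_inj trX).
rewrite mulr_sumr; apply: eq_bigr => G XG; have SG := subsetP XS _ XG.
have pbE : pblock P G = [set G' | giso G G'].
  apply/setP => G'; rewrite inE; apply/idP/idP => h.
    have SG' : G' \in S.
      by rewrite -coverP; apply/bigcupP; exists (pblock P G) => //; apply: pblock_mem;
          rewrite coverP.
    by rewrite -(pblock_equivalence_partition eqS SG SG').
  by rewrite (pblock_equivalence_partition eqS SG) ?(hS G).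
rewrite pbE (eq_bigr (fun=> w G)) => [|G']; last by rewrite inE => /hw.
rewrite sumr_const -natrM -(card_orbit_aut G) natrM invfM -[(w G *+ _)%R]mulr_natl.
rewrite mulrACA mulVf ?mul1r 1?mulrC // pnatr_eq0 -lt0n card_gt0.
by apply/set0Pn; exists G; rewrite inE; case: (giso_equiv G G G) => ->.
Qed.
End Orbits.

(** * Connected components and matchings *)

Section Colourings.
Variables (V H : finType) (N : nat) (G : hgraph V H N).

Definition colouring t (c : {ffun V -> 'I_t}) : bool :=
  [forall h, c (Defs.root G (flip G h)) == c (Defs.root G h)].

Hypothesis wfG : well_formed G.

Lemma adj_connect_sym : connect_sym (adj G).
Proof.
apply: sym_connect_sym => u v; apply/existsP/existsP => -[h /andP[hu hv]];
exists (flip G h); by rewrite hv (eqP (forallP wfG h)) hu.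
Qed.

(** Such colourings are constant on components. They turn the number of
    components into the exponent of t, and thereby connectedness into the
    extraction of the coefficient of t. *)
Lemma card_colouring t :
  #|[set c : {ffun V -> 'I_t} | colouring c]| = t ^ n_comp (adj G) V.
Proof.
pose r := fingraph.root (adj G); pose A := {x | roots (adj G) x}.
have rP x : roots (adj G) (r x) by apply: roots_root adj_connect_sym _.
pose ext (f : {ffun A -> 'I_t}) : {ffun V -> 'I_t} := [ffun x => f (Sub (r x) (rP x))].
have -> : [set c : {ffun V -> 'I_t} | colouring c] = ext @: [set: {ffun A -> 'I_t}].
  apply/setP => c; rewrite inE; apply/forallP/imsetP => [hc|[f _ ->] h].
    exists [ffun a => c (val a)]; rewrite ?inE //; apply/ffunP => x; rewrite !ffunE /=.
    have: connect (adj G) x (r x) by apply: connect_root.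
    move: (r x) => z; case/connectP => p; elim: p x => [|y p IH] x /=; first by move=> _ ->.
    case/andP => /existsP[h /andP[/eqP<- /eqP hy]] yp zp.
    by rewrite -(IH _ yp zp) -hy (eqP (hc h)).
  rewrite !ffunE; apply/eqP; congr (f _); apply: val_inj => /=.
  apply/(fingraph.rootP adj_connect_sym); rewrite adj_connect_sym; apply: connect1.
  by apply/existsP; exists h; rewrite !eqxx.
rewrite card_imset ?cardsT ?card_ffun ?card_ord ?card_sig; last first.
  move=> f g /ffunP fg; apply/ffunP => -[x rx]; have := fg x; rewrite !ffunE.
  have -> : Sub (r x) (rP x) = exist _ x rx :> A by apply: val_inj; apply/eqP.
  by [].
by congr (_ ^ _); apply: eq_card => x; rewrite !inE andbT.
Qed.

Lemma connected_n_comp : connected G = (n_comp (adj G) V == 1%N).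
Proof.
rewrite /connected; apply/andP/eqP => [[/card_gt0P[x _] /forallP cG]|n1].
  rewrite -(n_comp_connect adj_connect_sym x); apply: eq_n_comp_r => y.
  by rewrite !inE; apply/esym/(forallP (cG x)).
split.
  rewrite lt0n; apply: contra_eqN n1 => /eqP V0.
  by rewrite /n_comp_mem (eqP (_ : #|_| == 0%N)) // -leqn0 -V0 max_card.
move/eqP/card1P: n1 => [x hx].
have rx y : fingraph.root (adj G) y = x.
  by apply/eqP; have := hx (fingraph.root (adj G) y); rewrite !inE roots_root ?andbT //;
      apply: adj_connect_sym.
apply/forallP=> u; apply/forallP=> v.
by apply/(fingraph.rootP adj_connect_sym); rewrite !rx.
Qed.
End Colourings.

(** The number of perfect matchings of n points. *)
Definition dfact (n : nat) : nat :=
  if odd n then 0 else \prod_(j < n./2) (2 * j + 1).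

Lemma dfactSS n : dfact n.+2 = (n.+1 * dfact n)%N.
Proof.
rewrite /dfact /= negbK; case: ifPn => [|on]; first by rewrite muln0.
by rewrite big_ord_recr /= mulnC; congr (_ * _)%N; rewrite mul2n -{2}(odd_double_half n)
    (negbTE on) addn1.
Qed.

Section Matchings.
Variables (H I : finType) (c : H -> I).

(** Matchings of D are encoded as involutions of the whole type that move
    exactly D, so that D can shrink in an induction while the type stays. *)
Definition matchings (D : {set H}) : {set {ffun H -> H}} :=
  [set f : {ffun H -> H} | [&& [forall h, f (f h) == h],
     [forall h, (f h != h) == (h \in D)] & [forall h, c (f h) == c h]]].

Lemma matchingsP (D : {set H}) (f : {ffun H -> H}) :
  reflect [/\ involutive f, forall h, (f h != h) = (h \in D)
            & forall h, c (f h) = c h] (f \in matchings D).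
Proof.
rewrite inE; apply: (iffP and3P) => -[h1 h2 h3]; split.
- by move=> h; rewrite (eqP (forallP h1 h)).
- by move=> h; rewrite (eqP (forallP h2 h)).
- by move=> h; rewrite (eqP (forallP h3 h)).
- by apply/forallP=> h; rewrite h1.
- by apply/forallP=> h; rewrite h2.
- by apply/forallP=> h; rewrite h3.
Qed.

(** The bijection deletes the edge joining a and b. *)
Lemma card_matchings_pair (D : {set H}) a b : a \in D -> b \in D -> b != a -> c b = c a ->
  #|[set f in matchings D | f a == b]| = #|matchings (D :\ a :\ b)|.
Proof.
move=> aD bD ba cba.
pose phi (f : {ffun H -> H}) := [ffun x => if (x == a) || (x == b) then x else f x].
pose psi (f : {ffun H -> H}) := [ffun x => if x == a then b else if x == b then a else f x].
rewrite -!sum1_card (reindex_onto psi phi); last first.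
  move=> f; rewrite inE => /andP[/matchingsP[f1 f2 f3] /eqP fab].
  apply/ffunP=> x; rewrite !ffunE; case: eqP => [->|_]//.
  by case: eqP => [->|//]; rewrite -fab f1.
apply: eq_bigl => f; apply/idP/idP.
  rewrite inE => /andP[/andP[/matchingsP[f1 f2 f3] _] /eqP/ffunP fK].
  have fE x : x != a -> x != b -> psi f x = f x.
    by move=> xa xb; rewrite !ffunE (negbTE xa) (negbTE xb).
  have fa : f a = a by rewrite -fK !ffunE eqxx.
  have fb : f b = b by rewrite -fK !ffunE eqxx orbT.
  have pa : psi f a = b by rewrite ffunE eqxx.
  have pb : psi f b = a by rewrite ffunE eqxx (negbTE ba).
  have [xa xb] : (forall x, x != a -> x != b -> f x != a) /\ (forall x,
      x != a -> x != b -> f x != b).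
    split=> x xa xb; rewrite -(fE x xa xb).
      by apply: contra_neq xb => e; rewrite -(f1 x) e.
    by apply: contra_neq xa => e; rewrite -(f1 x) e.
  apply/matchingsP; split=> x; 
    (have [e|na] := eqVneq x a;
      [rewrite e ?fa // | have [e|nb] := eqVneq x b; [rewrite e ?fb // |]]).
  - by have := f1 x; rewrite (fE x) // fE ?xa ?xb.
  - by rewrite !inE !eqxx ?andbF.
  - by rewrite !inE !eqxx ?andbF.
  - by rewrite !inE na nb /= -f2 fE.
  - by rewrite -(fE x) ?f3.
move=> /matchingsP[f1 f2 f3].
have fa : f a = a by apply/eqP; rewrite -[_ == _]negbK f2 !inE eqxx andbF.
have fb : f b = b by apply/eqP; rewrite -[_ == _]negbK f2 !inE eqxx.
have pa : psi f a = b by rewrite ffunE eqxx.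
have pb : psi f b = a by rewrite ffunE eqxx (negbTE ba).
have pE x : x != a -> x != b -> psi f x = f x.
  by move=> xa xb; rewrite !ffunE (negbTE xa) (negbTE xb).
rewrite inE pa eqxx andbT; apply/andP; split; last first.
  apply/eqP/ffunP => x; rewrite !ffunE.
  by case: eqP => [->|_] //=; case: eqP => [->|_].
apply/matchingsP; split=> x; 
    (have [e|na] := eqVneq x a; [rewrite e ?pa ?pb ?ba ?aD //
      | have [e|nb] := eqVneq x b; [rewrite e ?pb ?pa // 1?eq_sym ?ba ?bD // |]]).
- have fxa : f x != a by apply: contra_neq na => e; rewrite -(f1 x) e.
  have fxb : f x != b by apply: contra_neq nb => e; rewrite -(f1 x) e.
  by rewrite (pE x) // pE // f1.
- by rewrite pE // f2 !inE na nb.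
- by rewrite pE ?f3.
Qed.

(** Matchings that respect a colouring split into matchings of the colour
    classes. By induction: pair a given point with each point of its colour. *)
Lemma card_matchings (D : {set H}) :
  #|matchings D| = \prod_i dfact #|[set h in D | c h == i]|.
Proof.
elim: {D}#|D|.+1 {-2}D (ltnSn #|D|) => // n IH D leDn.
have [->|/set0Pn[a aD]] := eqVneq D set0.
  rewrite big1 => [|i _]; last first.
    have -> : [set h in set0 | c h == i] = set0 by apply/setP => h; rewrite !inE.
    by rewrite cards0 /dfact big_ord0.
  rewrite -(cards1 [ffun x : H => x]); apply: eq_card => f; rewrite [RHS]inE.
  apply/matchingsP/eqP => [[_ f2 _]|->].
    by apply/ffunP => x; rewrite ffunE; apply/eqP; rewrite -[_ == _]negbK f2 inE.
  by split=> x; rewrite ?ffunE ?eqxx ?inE.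
pose B := [set b in D | (b != a) && (c b == c a)].
have -> : #|matchings D| = (\sum_(b in B) #|[set f in matchings D | f a == b]|)%N.
  rewrite -sum1_card (partition_big (fun f : {ffun H -> H} => f a) (mem B)) /=.
    by apply: eq_bigr => b _; rewrite sum1dep_card; apply: eq_card => f; rewrite !inE.
  move=> f /matchingsP[f1 f2 f3]; rewrite !inE f3 eqxx andbT f2 aD andbT.
  by rewrite -f2 f1 eq_sym f2.
pose rest := (\prod_(i | i != c a) dfact #|[set h in D | c h == i]|)%N.
pose Da := [set h in D | c h == c a].
have cardB : #|Da| = #|B|.+1.
  rewrite (cardsD1 a) !inE aD eqxx /= add1n; congr _.+1; apply: eq_card => b.
  by rewrite !inE; case: (b != a); rewrite /= ?andbF.
rewrite (eq_bigr (fun=> dfact (#|B|.-1) * rest)%N); last first.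
  move=> b; rewrite !inE => /and3P[bD ba /eqP cba].
  rewrite card_matchings_pair // IH; last first.
    rewrite -ltnS (leq_trans _ leDn) // ltnS; apply: proper_card.
    apply/properP; split; last by exists a; rewrite // !inE eqxx andbF.
    by apply/subsetP => x; rewrite !inE => /and3P[].
  rewrite (bigD1 (c a)) //=; congr (dfact _ * _)%N.
    rewrite -[LHS]/(_.+1.-1) (_ : _.+1 = #|B|) //.
    rewrite (cardsD1 b B) !inE bD ba cba eqxx /= add1n; congr _.+1.
    by apply: eq_card => x; rewrite !inE; case: (x == b); case: (x == a); rewrite ?andbF.
  apply: eq_bigr => i ia; congr dfact; apply: eq_card => x; rewrite !inE.
  have [->|_] := eqVneq x b; first by rewrite /= cba eq_sym (negbTE ia) andbF.
  by have [->|//] := eqVneq x a; rewrite /= eq_sym (negbTE ia) andbF.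
rewrite sum_nat_const [RHS](bigD1 (c a)) //= -/rest -/Da cardB.
by case: #|B| => [|m] /=; rewrite ?mul0n // dfactSS mulnA.
Qed.
End Matchings.

(** * Functions with prescribed fibres *)

Section Multinomial.
Variables (I J : finType).

Definition fibre (f : {ffun I -> J}) (j : J) : nat := #|[set x | f x == j]|.

Lemma sum_fibre (f : {ffun I -> J}) : \sum_j fibre f j = #|I|.
Proof.
rewrite -sum1_card (partition_big f predT) //=; apply: eq_bigr => j _.
by rewrite sum1dep_card; apply: eq_card => x; rewrite !inE.
Qed.

Section Sets.
Variable j0 : J.

(** Functions on D are extended by j0, for the same reason as matchings. *)
Definition fibred (D : {set I}) (n : J -> nat) : {set {ffun I -> J}} :=
  [set f : {ffun I -> J} | [forall x, (x \in D) || (f x == j0)]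
    && [forall j, #|[set x in D | f x == j]| == n j]].

Lemma fibredP (D : {set I}) n (f : {ffun I -> J}) :
  reflect ((forall x, x \notin D -> f x = j0) /\
           (forall j, #|[set x in D | f x == j]| = n j)) (f \in fibred D n).
Proof.
rewrite inE; apply: (iffP andP) => -[h1 h2]; split.
- by move=> x xD; have := forallP h1 x; rewrite (negbTE xD) => /eqP.
- by move=> j; apply/eqP/(forallP h2).
- by apply/forallP => x; have [//|/h1->] := boolP (x \in D); rewrite eqxx.
- by apply/forallP => j; rewrite h2.
Qed.

Lemma card_fibred_point (D : {set I}) n a j : a \in D -> 0 < n j ->
  #|[set f in fibred D n | f a == j]|
  = #|fibred (D :\ a) (fun i => n i - (i == j))|.
Proof.
move=> aD nj.
pose phi (f : {ffun I -> J}) := [ffun x => if x == a then j0 else f x].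
pose psi (f : {ffun I -> J}) := [ffun x => if x == a then j else f x].
have eqset f i : [set x in D | psi f x == i] =
     (if i == j then [set a] else set0) :|: [set x in D :\ a | f x == i].
  apply/setP => x; rewrite !inE !ffunE.
  have [->|na] := eqVneq x a; last by case: (i == j); rewrite ?inE ?(negbTE na).
  by rewrite aD eq_sym; case: (i == j); rewrite !inE ?eqxx.
have cardset f i : #|[set x in D | psi f x == i]| =
     (i == j) + #|[set x in D :\ a | f x == i]|.
  rewrite eqset; case: (i == j); rewrite ?set0U // cardsU1 !inE eqxx //.
rewrite -!sum1_card (reindex_onto psi phi) /=; last first.
  move=> f; rewrite inE => /andP[_ /eqP fa].
  by apply/ffunP=> x; rewrite !ffunE; case: eqP => [->|_].
apply: eq_bigl => f; apply/idP/idP.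
  rewrite inE => /andP[/andP[/fibredP[f1 f2] _] /eqP/ffunP fK].
  apply/fibredP; split=> [x|i]; last by rewrite -f2 cardset addKn.
  rewrite !inE negb_and negbK -fK !ffunE; have [//|na /=] := eqVneq x a.
  by move=> /f1; rewrite ffunE (negbTE na).
move=> /fibredP[f1 f2]; rewrite inE ffunE !eqxx andbT; apply/andP; split.
  apply/fibredP; split=> [x xD|i]; last first.
    by rewrite cardset f2; have [->|_] := eqVneq i j; rewrite ?subn0 // subnKC.
  rewrite ffunE; case: eqP => [e|_]; first by rewrite e aD in xD.
  by apply: f1; rewrite !inE (negbTE xD) andbF.
apply/eqP/ffunP => x; rewrite !ffunE; case: eqP => // ->.
by rewrite f1 // !inE eqxx.
Qed.

(** The multinomial coefficient, by induction on the value at one point. *)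
Lemma card_fibred (D : {set I}) n : \sum_j n j = #|D| ->
  (#|fibred D n| * \prod_j (n j)`!)%N = (#|D|)`!.
Proof.
elim: {D}#|D|.+1 {-2}D n (ltnSn #|D|) => // m IH D n leDm sn.
have [D0|/set0Pn[a aD]] := eqVneq D set0.
  have n0 j : n j = 0.
    by apply/eqP; move/eqP: sn; rewrite D0 cards0 sum_nat_eq0 => /forallP/(_ j).
  rewrite big1 => [|j _]; last by rewrite n0.
  rewrite muln1 D0 cards0 fact0 -(cards1 ([ffun=> j0] : {ffun I -> J})); apply: eq_card => f.
  rewrite [RHS]inE; apply/fibredP/eqP => [[f1 _]|->].
    by apply/ffunP => x; rewrite ffunE f1 ?inE.
  split=> [x|j]; first by rewrite ffunE.
  by rewrite n0; apply/eqP; rewrite cards_eq0; apply/eqP/setP=> x; rewrite !inE.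
have -> : #|fibred D n| = (\sum_(j | 0 < n j) #|[set f in fibred D n | f a == j]|)%N.
  rewrite -sum1_card (partition_big (fun f : {ffun I -> J} => f a) (fun j => 0 < n j)) /=.
    by apply: eq_bigr => b _; rewrite sum1dep_card; apply: eq_card => f; rewrite !inE.
  move=> f /fibredP[_ f2]; rewrite -f2; apply/card_gt0P; exists a.
  by rewrite !inE aD eqxx.
have cD : #|D| = #|D :\ a|.+1 by rewrite (cardsD1 a) aD.
rewrite big_distrl /= (eq_bigr (fun j => n j * #|D :\ a|`!)%N).
  rewrite -big_distrl /= cD factS -cD -sn; congr (_ * _)%N.
  by rewrite [RHS](bigID (fun j => 0 < n j)) /= [X in _ = _ + X]big1 ?addn0 // => j;
      rewrite -eqn0Ngt => /eqP.
move=> j nj; rewrite card_fibred_point //.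
have snj : \sum_i (n i - (i == j)) = #|D :\ a|.
  apply/eqP; rewrite -eqSS -cD -sn (bigD1 j) //= [X in _ == X](bigD1 j) //= eqxx.
  rewrite -addSn subn1 prednK //; apply/eqP; congr (_ + _).
  by apply: eq_bigr => i /negbTE->; rewrite subn0.
rewrite -(IH (D :\ a) (fun i => n i - (i == j))) //; last by rewrite -ltnS -cD.
rewrite mulnCA; congr (_ * _)%N.
rewrite (bigD1 j) //= [in RHS](bigD1 j) //= eqxx mulnA subn1.
rewrite -{1}(prednK nj) factS prednK //; congr (_ * _)%N.
by apply: eq_bigr => i /negbTE->; rewrite subn0.
Qed.
End Sets.

Lemma card_fibre (n : J -> nat) : \sum_j n j = #|I| ->
  (#|[set f : {ffun I -> J} | [forall j, fibre f j == n j]]| * \prod_j (n j)`!)%N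
  = (#|I|)`!.
Proof.
have [/card0_eq J0|/card_gt0P[j0 _]] := posnP #|J|.
  rewrite !big_pred0 => [I0||]; try by move=> j; have := J0 j; rewrite inE.
  rewrite -I0 muln1; apply/eqP/cards1P.
  have nI x : x \in I -> False by move: (card0_eq (esym I0) x); rewrite inE => ->.
  exists (finfun (fun x => match nI x isT with end)); apply/setP => f.
  rewrite !inE; transitivity true; first by apply/forallP => j; have := J0 j; rewrite inE.
  by apply/esym/eqP/ffunP => x; case: (nI x isT).
move=> sn; have := @card_fibred j0 [set: I] n; rewrite cardsT => /(_ sn) <-.
congr (_ * _)%N; apply: eq_card => f; apply/idP/fibredP.
  rewrite inE => /forallP fn; split=> [x|j]; first by rewrite inE.
  by rewrite -(eqP (fn j)); apply: eq_card => x; rewrite !inE.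
case=> _ f2; rewrite inE; apply/forallP => j; rewrite -f2; apply/eqP.
by apply: eq_card => x; rewrite !inE.
Qed.

Local Open Scope ring_scope.

(** Grouping functions by their fibre sizes, as in the multinomial theorem. The
    values are in a module because they are numbers for half-edges attached to
    vertices, and polynomials for vertices carrying colours. *)
Lemma sum_fibres (A : comUnitRingType) (W : lmodType A) (M : nat)
    (Psi : (J -> nat) -> W) :
    (forall n, n.+1%:R \is a @GRing.unit A) ->
    (forall m n, m =1 n -> Psi m = Psi n) -> (#|I| < M)%N ->
  \sum_(f : {ffun I -> J}) Psi (fibre f)
  = \sum_(n : {ffun J -> 'I_M} | (\sum_j n j)%N == #|I|)
      (#|I|`!%:R / \prod_j (n j)`!%:R) *: Psi (fun j => n j).
Proof.
move=> uA ePsi ltIM; have ltM (f : {ffun I -> J}) j : (fibre f j < M)%N.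
  by apply: leq_ltn_trans ltIM; rewrite max_card.
have funit k : k`!%:R \is a @GRing.unit A by rewrite -(prednK (fact_gt0 k)).
rewrite (partition_big (fun f : {ffun I -> J} => [ffun j => Ordinal (ltM f j)])
   (fun n : {ffun J -> 'I_M} => (\sum_j n j)%N == #|I|)) /=; last first.
  move=> f _; apply/eqP; rewrite -(sum_fibre f).
  by apply: eq_bigr => j _; rewrite ffunE.
apply: eq_bigr => n /eqP sn; rewrite -(card_fibre sn) natrM natr_prod.
rewrite -natr_prod mulrK; last first.
  by rewrite natr_prod; apply: (big_ind (fun x => x \is a GRing.unit));
      rewrite ?unitr1 // => ? ? ? ?; rewrite unitrMl.
transitivity (\sum_(f in [set f : {ffun I -> J} | [forall j,
    fibre f j == n j]]) Psi (fun j => n j)).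
  apply: eq_big => f; last first.
    by move=> /eqP/ffunP e; apply: ePsi => j; rewrite -e ffunE.
  rewrite inE; apply/eqP/forallP => [<- j|e]; first by rewrite ffunE.
  by apply/ffunP => j; apply: val_inj; rewrite ffunE /= (eqP (e j)).
by rewrite sumr_const scaler_nat.
Qed.
End Multinomial.

Local Open Scope ring_scope.

(** * Gaussian integrals of polynomials *)

Section GaussPoly.
Variable A : comUnitRingType.
Hypothesis uA : forall n, n.+1%:R \is a @GRing.unit A.

(** The Gaussian moment of x^n: the variable stands for lambda^2, so that its
    exponent counts edges. *)
Definition moment (n : nat) : {poly A} :=
  if odd n then 0 else (dfact n)%:R *: 'X^(n./2).

Definition gauss (p : {poly A}) : {poly A} := \sum_(n < size p) p`_n *: moment n.

Lemma gaussE K (p : {poly A}) : (size p <= K)%N -> gauss p = \sum_(n < K) p`_n *: moment n.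
Proof.
move=> sp; rewrite /gauss (big_ord_widen _ (fun n => p`_n *: moment n) sp).
rewrite [RHS](bigID (fun i : 'I_K => (i < size p)%N)) /= [X in _ = _ + X]big1 ?addr0 //.
by move=> i; rewrite -leqNgt => /(nth_default 0)->; rewrite scale0r.
Qed.

Lemma gauss_is_linear : linear gauss.
Proof.
move=> a p q; pose K := maxn (size (a *: p + q)) (maxn (size p) (size q)).
rewrite (@gaussE K) ?leq_maxl // (@gaussE K p) ?(@gaussE K q).
- rewrite scaler_sumr -big_split /=; apply: eq_bigr => i _.
  by rewrite coefD coefZ scalerDl scalerA.
- by rewrite /K maxnA leq_maxr.
- by rewrite /K maxnCA leq_maxl.
Qed.
HB.instance Definition _ :=
  GRing.isLinear.Build A {poly A} {poly A} _ gauss gauss_is_linear.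

Lemma gaussXn n : gauss 'X^n = moment n.
Proof.
rewrite (@gaussE n.+1) ?size_polyXn // big_ord_recr /= coefXn eqxx scale1r.
by rewrite big1 ?add0r // => i _; rewrite coefXn ltn_eqF ?scale0r.
Qed.

Lemma coef_gauss (p : {poly A}) k : (gauss p)`_k = (dfact (2 * k))%:R * p`_(2 * k).
Proof.
rewrite (@gaussE (maxn (size p) (2 * k).+1)) ?leq_maxl // coef_sum.
have lt : (2 * k < maxn (size p) (2 * k).+1)%N by rewrite leq_maxr.
rewrite (bigD1 (Ordinal lt)) //= big1 ?addr0 => [|i /eqP nik]; rewrite /moment coefZ.
  by rewrite mul2n odd_double coefZ doubleK coefXn eqxx mulr1 mulrC.
case: ifP => oi; rewrite ?coef0 ?mulr0 // coefZ coefXn.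
case: eqP => [e|]; rewrite ?mulr0 //; case: nik; apply: val_inj => /=.
by move: (odd_double_half i); rewrite oi -e add0n -mul2n => h; apply: esym h.
Qed.

Lemma prod_moment (I : finType) (n : I -> nat) :
  \prod_i moment (n i)
  = (\prod_i dfact (n i))%:R *: 'X^(\sum_i (n i)./2)%N.
Proof.
have [/existsP[i oi]|/existsPn ev] := boolP [exists i, odd (n i)].
  rewrite (bigD1 i) //= {1}/moment oi mul0r [X in X%:R](bigD1 i) //=.
  by rewrite {1}/dfact oi mul0n scale0r.
rewrite (eq_bigr (fun i => (dfact (n i))%:R *: 'X^((n i)./2))); last first.
  by move=> i _; rewrite /moment (negbTE (ev i)).
by rewrite scaler_prod natr_prod -(big_morph _ (exprD 'X) (expr0 'X)).
Qed.

(** A coefficient of a product of moments only sees the total number of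
    half-edges. *)
Lemma coef_prod_moment (I : finType) (n : I -> nat) k :
  (\prod_i moment (n i))`_k
  = (((\sum_i n i)%N == (2 * k)%N) * \prod_i dfact (n i))%:R.
Proof.
rewrite prod_moment coefZ coefXn -natrM; congr _%:R.
have [/existsP[i oi]|/existsPn ev] := boolP [exists i, odd (n i)].
  have -> : (\prod_i dfact (n i) = 0)%N by rewrite (bigD1 i) //= {1}/dfact oi mul0n.
  by rewrite mul0n muln0.
rewrite mulnC; congr (nat_of_bool _ * _)%N.
have -> : (\sum_i n i = 2 * \sum_i (n i)./2)%N.
  rewrite big_distrr /=; apply: eq_bigr => i _.
  by rewrite -[LHS]odd_double_half (negbTE (ev i)) mul2n.
by rewrite eqn_mul2l eq_sym.
Qed.

(** Multilinear expansion of a product of Gaussian integrals, one for each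
    colour, with a factor of the integrand for each vertex of the colour. *)
Lemma prod_gauss_colours (V I : finType) (col : V -> I) M (c : nat -> A) :
  \prod_i gauss ((\sum_(n < M.+1) c n *: 'X^n) ^+ #|[set x | col x == i]|)
  = \sum_(n : {ffun V -> 'I_M.+1}) (\prod_x c (n x)) *:
       \prod_i moment (\sum_(x | col x == i) n x)%N.
Proof.
pose j0 : 'I_M.+1 := ord0.
pose Q i := pfamily j0 (fun x => col x == i) (fun=> predT : pred 'I_M.+1).
transitivity (\prod_i \sum_(f : {ffun V -> 'I_M.+1} | f \in Q i)
   (\prod_(x | col x == i) c (f x)) *: moment (\sum_(x | col x == i) f x)%N).
  apply: eq_bigr => i _.
  rewrite cardsE -prodr_const (big_distr_big_dep j0) /= linear_sum /=.
  apply: eq_bigr => f _; rewrite scaler_prod linearZ /=; congr (_ *: _).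
  by rewrite -gaussXn; congr gauss; rewrite -(big_morph _ (exprD 'X) (expr0 'X)).
rewrite bigA_distr_big_dep /=.
pose phi (g : {ffun I -> {ffun V -> 'I_M.+1}}) := [ffun x => g (col x) x].
pose psi (f : {ffun V -> 'I_M.+1}) := [ffun i => [ffun x => if col x == i then f x else j0]].
rewrite (reindex_onto psi phi) /=; last first.
  move=> g /familyP gQ; apply/ffunP => i; rewrite ffunE.
  have /pfamilyP[/supportP gs _] := gQ i.
  by apply/ffunP => x; rewrite !ffunE; case: eqP => [->|/eqP nx] //; rewrite gs.
apply: eq_big => [f|f _].
  rewrite [RHS]/= andbC; apply/andP; split.
    by apply/eqP/ffunP => x; rewrite !ffunE eqxx.
  apply/familyP => i; apply/pfamilyP; split=> //; apply/supportP => x nx.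
  by rewrite !ffunE ifN.
rewrite (eq_bigr (fun i => (\prod_(x | col x == i) c (f x)) *:
     moment (\sum_(x | col x == i) f x)%N)).
  by rewrite scaler_prod [in RHS](partition_big col predT).
move=> i _; congr (_ *: moment _); apply: eq_bigr => x /eqP xi; by rewrite !ffunE xi eqxx.
Qed.

Lemma natr_fact_unit n : n`!%:R \is a @GRing.unit A.
Proof. by rewrite -(prednK (fact_gt0 n)). Qed.

(** Wick's theorem with colours. Matchings that respect colours factor over the
    colours, so the sum only depends on the fibre sizes of r; grouping by these
    produces the factorials in the exponential generating series, and each
    colour contributes its own Gaussian integral. *)
Lemma wick_colours (V I : finType) k (col : {ffun V -> I}) (phi : nat -> A) M :
  (2 * k <= M)%N ->
  \sum_(r : {ffun 'I_(2 * k) -> V})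
     (\prod_x phi (fibre r x)) *+ #|matchings (col \o r) setT|
  = (2 * k)`!%:R *
    (\prod_i gauss ((\sum_(n < M.+1) (phi n / n`!%:R) *: 'X^n) ^+ fibre col i))`_k.
Proof.
move=> leM; pose Psi (n : V -> nat) : A^o :=
  (\prod_x phi (n x)) *+ \prod_i dfact (\sum_(x | col x == i) n x)%N.
transitivity (\sum_(r : {ffun 'I_(2 * k) -> V}) Psi (fibre r)).
  apply: eq_bigr => r _; rewrite /Psi card_matchings; congr (_ *+ _).
  apply: eq_bigr => i _; congr dfact.
  rewrite -sum1_card (partition_big r (fun x => col x == i)) /=; last by move=> h; rewrite !inE.
  apply: eq_bigr => x /eqP xi; rewrite sum1dep_card; apply: eq_card => h; rewrite !inE /=.
  by case: (r h =P x) => [->|]; rewrite ?andbT ?andbF ?xi ?eqxx.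
rewrite (sum_fibres (M := M.+1) uA); last by rewrite card_ord ltnS.
  have e := prod_gauss_colours col M (fun n => phi n / n`!%:R).
  rewrite /fibre {}e.
  rewrite coef_sum mulr_sumr card_ord [LHS]big_mkcond /=.
  apply: eq_bigr => n _; rewrite coefZ coef_prod_moment.
  have -> : (\sum_i \sum_(x | col x == i) n x = \sum_x n x)%N.
    by rewrite [RHS](partition_big col predT).
  case: ifP => _; last by rewrite mul0n !mulr0.
  rewrite mul1n /Psi /GRing.scale /= big_split /= prodrV; last first.
    by move=> *; apply: natr_fact_unit.
  rewrite -[X in _ * X = _]mulr_natr !mulrA; congr (_ * _).
  by rewrite -!mulrA; congr (_ * _); rewrite mulrC.
move=> m n e; rewrite /Psi; congr (_ *+ _); first by apply: eq_bigr => x _; rewrite e.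
by apply: eq_bigr => i _; congr dfact; apply: eq_bigr => x _; rewrite e.
Qed.

(** Only the number of vertices of each colour matters, which produces the
    coefficients of the t-th power of an exponential. *)
Lemma sum_colourings v t (p : {poly A}) M : (v < M)%N ->
  \sum_(col : {ffun 'I_v -> 'I_t}) \prod_i gauss (p ^+ fibre col i)
  = v`!%:R *: \sum_(n : {ffun 'I_t -> 'I_M} | (\sum_i n i)%N == v)
                \prod_i ((n i)`!%:R^-1 *: gauss (p ^+ n i)).
Proof.
move=> ltvM; pose Psi (n : 'I_t -> nat) : {poly A} := \prod_i gauss (p ^+ n i).
rewrite (@sum_fibres _ _ _ _ M Psi uA) ?card_ord //; last first.
  by move=> m n e; apply: eq_bigr => i _; rewrite e.
rewrite scaler_sumr; apply: eq_bigr => n _; rewrite scaler_prod scalerA.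
by rewrite prodrV // => *; apply: natr_fact_unit.
Qed.
End GaussPoly.

(** * Truncated power series and sums over graphs *)

Section Series.
Variable F : fieldType.
Implicit Types (f g : fps2 F).

(** Equality modulo x^(I+1) and y^(J+1), enough to replace series by polynomials. *)
Definition eq_upto (I J : nat) f g := forall i j, (i <= I)%N -> (j <= J)%N -> f i j = g i j.

(** Divisibility by y^d. Here y = z^-1: all vertices have 2g - 2 + n >= 1, so
    one power of y per vertex makes every sum below finite. *)
Definition val_ge (d : nat) f := forall i j, (j < d)%N -> f i j = 0.

Lemma eq_upto_mul I J f f' g g' : eq_upto I J f f' -> eq_upto I J g g' ->
  eq_upto I J (fps2_mul f g) (fps2_mul f' g').
Proof.
move=> ef eg i j iI jJ; apply: eq_bigr => a _; apply: eq_bigr => b _.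
rewrite ef ?eg //; try by rewrite (leq_trans (leq_subr _ _)).
- by rewrite (leq_trans _ iI) // -ltnS.
- by rewrite (leq_trans _ jJ) // -ltnS.
Qed.

Lemma eq_upto_pow I J f g u : eq_upto I J f g -> eq_upto I J (fps2_pow f u) (fps2_pow g u).
Proof. by move=> fg; elim: u => [|u IH] //=; apply: eq_upto_mul. Qed.

Lemma val_ge_mul d d' f g : val_ge d f -> val_ge d' g -> val_ge (d + d') (fps2_mul f g).
Proof.
move=> vf vg i j ltj; rewrite /fps2_mul big1 // => a _; rewrite big1 // => b _.
have [/vf->|db] := ltnP b d; first by rewrite mul0r.
rewrite vg ?mulr0 //; have := ltn_ord b; lia.
Qed.

Lemma val_ge_pow f u : val_ge 1 f -> val_ge u (fps2_pow f u).
Proof. by move=> vf; elim: u => [|u IH] //=; rewrite -add1n; apply: val_ge_mul. Qed.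

Definition ser (P : {poly {poly F}}) : fps2 F := fun i j => P`_i`_j.

Lemma ser_exp (P : {poly {poly F}}) u i j : ser (P ^+ u) i j = fps2_pow (ser P) u i j.
Proof.
elim: u i j => [|u IH] i j.
  by rewrite expr0 /ser /= /fps2_one coef1; case: eqP; rewrite ?coef1 ?coef0.
rewrite exprS /ser /= coefM coef_sum; apply: eq_bigr => a _.
by rewrite coefM; apply: eq_bigr => b _; congr (_ * _); apply: IH.
Qed.

Lemma fps2_log_trunc (f : fps2 F) k m : val_ge 1 (fps2_sub f (fps2_one F)) ->
  fps2_log f k m =
  \sum_(u < m) (-1) ^+ u / u.+1%:R * fps2_pow (fps2_sub f (fps2_one F)) u.+1 k m.
Proof.
move=> vf; rewrite /fps2_log addnC.
rewrite [RHS](big_ord_widen (m + k) (fun u => (-1) ^+ u / u.+1%:R *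
   fps2_pow (fps2_sub f (fps2_one F)) u.+1 k m) (leq_addr k m)).
rewrite [RHS]big_mkcond; apply: eq_bigr => u _; case: ltnP => // mu.
by rewrite (val_ge_pow vf) ?mulr0.
Qed.

Lemma fps2_exp_trunc (f : fps2 F) M i j : val_ge 1 f -> (j <= M)%N ->
  fps2_exp f i j = \sum_(u < M.+1) fps2_pow f u i j / (u`!)%:R.
Proof.
move=> vf jM.
have trunc K : (j <= K)%N -> \sum_(u < K.+1) fps2_pow f u i j / (u`!)%:R
    = \sum_(u < j.+1) fps2_pow f u i j / (u`!)%:R.
  move=> jK; rewrite [RHS](big_ord_widen K.+1 (fun u => fps2_pow f u i j / (u`!)%:R)) //.
  rewrite [RHS]big_mkcond; apply: eq_bigr => u _; case: ltnP => // ju.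
  by rewrite (val_ge_pow vf) ?mul0r.
by rewrite /fps2_exp !trunc // leq_addl.
Qed.
End Series.

Section BinomialPoly.
Variable F : numFieldType.

(** The binomial coefficient t choose u as a polynomial in t. *)
Definition binpoly (u : nat) : {poly F} :=
  u`!%:R^-1 *: \prod_(i < u) ('X - i%:R%:P).

Lemma horner_binpoly u t : (binpoly u).[t%:R] = 'C(t, u)%:R.
Proof.
have fu : u`!%:R != 0 :> F by rewrite pnatr_eq0 -lt0n fact_gt0.
rewrite hornerZ horner_prod; apply: (mulfI fu); rewrite mulVKf // -natrM mulnC.
rewrite bin_ffact ffact_prod natr_prod.
have [ut|tu] := leqP u t.
  apply: eq_bigr => i _; rewrite !hornerE natrB //.
  by rewrite (leq_trans _ ut) // ltnW.
rewrite (bigD1 (Ordinal tu)) //= !hornerE subrr mul0r.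
by rewrite (bigD1 (Ordinal tu)) //= subnn mul0r.
Qed.

(** The linear coefficients are those of log(1 + x), as is seen from
    (1 + x)^t = exp (t log(1 + x)). *)
Lemma coef1_binpoly u : (binpoly u)`_1 = if u is n.+1 then (-1) ^+ n / n.+1%:R else 0.
Proof.
rewrite coefZ; case: u => [|n]; first by rewrite big_ord0 coef1 mulr0.
rewrite big_ord_recl subr0 coefXM /= -horner_coef0 horner_prod.
rewrite (eq_bigr (fun i : 'I_n => (-1) * i.+1%:R)); last first.
  by move=> i _; rewrite !hornerE /= mulN1r.
rewrite big_split /= prodr_const card_ord -natr_prod mulrC -mulrA; congr (_ * _).
have -> : (\prod_(i < n) i.+1 = n`!)%N by rewrite fact_prod big_add1 big_mkord.
by rewrite factS natrM invfM mulrC mulfVK // pnatr_eq0 -lt0n fact_gt0.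
Qed.

Lemma poly_nat_inj (p q : {poly F}) : (forall t : nat, p.[t%:R] = q.[t%:R]) -> p = q.
Proof.
move=> h; apply/eqP; rewrite -subr_eq0; apply/eqP.
apply: (@roots_geq_poly_eq0 _ _ [seq i%:R | i <- iota 0 (size (p - q))]).
- by apply/allP => _ /mapP[i _ ->]; rewrite rootE !hornerE h subrr.
- rewrite map_inj_uniq ?iota_uniq //; exact: mulrIn (oner_neq0 _).
- by rewrite size_map size_iota.
Qed.
End BinomialPoly.

Section GraphSums.
Variable F : numFieldType.

Definition weight (V H : finType) N (G : hgraph V H N) : F :=
  \prod_x chiM F (gen G x) (valence G x).

(** A vertex of genus g and valence n carries y^(2g-2+n); over a graph without
    external edges the exponents add up to 2(genus - 1). *)
Definition vertex (g n : nat) : {poly F} :=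
  if (2 < 2 * g + n)%N then chiM F g n *: 'X^(2 * g + n - 2) else 0.

Definition vertices (N n : nat) : {poly F} := \sum_(g < N) vertex g n.

(** The last condition says that the exponents of y add up to m. For connected
    graphs it fixes the genus, while it also makes sense for all others. *)
Definition admissible (m : nat) (V H : finType) N (G : hgraph V H N) : bool :=
  [&& well_formed G, no_external G, stable G &
      (2 * (\sum_x gen G x) + #|H| == m + 2 * #|V|)%N].

Lemma valence_fibre (V H : finType) N (G : hgraph V H N) x :
  valence G x = fibre (Defs.root G) x.
Proof. by []. Qed.

Lemma coef_prod_vertex m (V H : finType) N (G : hgraph V H N) :
  (\prod_x vertex (gen G x) (valence G x))`_m
  = if stable G && (2 * (\sum_x gen G x) + #|H| == m + 2 * #|V|)%N then weight G else 0.
Proof.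
case: ifPn => [/andP[/forallP st e]|].
  rewrite (eq_bigr (fun x => chiM F (gen G x) (valence G x) *:
      'X^(2 * gen G x + valence G x - 2))); last by move=> x _; rewrite /vertex st.
  rewrite scaler_prod coefZ -(big_morph _ (exprD 'X) (expr0 'X)) coefXn.
  suff -> : m == (\sum_i (2 * gen G i + valence G i - 2))%N by rewrite mulr1.
  rewrite -(eqn_add2r (2 * #|V|)) -(eqP e) -(sum_fibre (Defs.root G)) big_distrr /=.
  have -> : (2 * #|V| = \sum_(x : V) 2)%N by rewrite sum_nat_const mulnC.
  rewrite -!big_split /=; apply/eqP/eq_bigr => x _; rewrite -valence_fibre.
  by have := st x; lia.
rewrite negb_and; case: (boolP (stable G)) => [st /= ne|/forallPn[x nst] _].
  rewrite (eq_bigr (fun x => chiM F (gen G x) (valence G x) *: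
      'X^(2 * gen G x + valence G x - 2))); last first.
    by move=> x _; rewrite /vertex (forallP st).
  rewrite scaler_prod coefZ -(big_morph _ (exprD 'X) (expr0 'X)) coefXn.
  case: eqP => [e|]; last by rewrite mulr0.
  case/negP: ne; rewrite e -(sum_fibre (Defs.root G)) big_distrr /=.
  have -> : (2 * #|V| = \sum_(x : V) 2)%N by rewrite sum_nat_const mulnC.
  rewrite -!big_split /=; apply/eqP/eq_bigr => x _; rewrite -valence_fibre.
  by have := forallP st x; lia.
by rewrite (bigD1 x) //= {1}/vertex (negbTE nst) mul0r coef0.
Qed.

(** A labelled graph is an independent choice of attaching map, matching and
    genera. Exchanging the sums, the colouring is chosen first and the matching
    has to respect it. *)
Lemma sum_coloured_graphs m t N (V H : finType) :
  \sum_(G : hgraph V H N | admissible m G)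
     weight G *+ #|[set c : {ffun V -> 'I_t} | colouring G c]|
  = (\sum_(c : {ffun V -> 'I_t}) \sum_(r : {ffun H -> V})
      (\prod_x vertices N (fibre r x)) *+ #|matchings (c \o r) setT|)`_m.
Proof.
rewrite (reindex (@hgraph_of V H N)) /=; last first.
  by exists (@hgraph_to V H N) => [[[r f] g] _ | [r f g] _].
under eq_bigr => x _ do rewrite -sumr_const.
rewrite (exchange_big_dep predT) //= coef_sum; apply: eq_bigr => c _.
rewrite coef_sum (eq_bigr (fun r : {ffun H -> V} => \sum_(f in matchings (c \o r) setT)
   \sum_(g : {ffun V -> 'I_N}) (\prod_x vertex (g x) (fibre r x))`_m)); last first.
  move=> r _; rewrite /vertices bigA_distr_bigA /= sumr_const coefMn; congr (_ *+ _).
  by rewrite coef_sum.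
rewrite pair_big_dep /= pair_big_dep /= [RHS]big_mkcond [LHS]big_mkcond /=.
apply: eq_bigr => -[[r f] g] _ /=.
have := coef_prod_vertex m (hgraph_of (r, f, g)); rewrite /= => ->.
have -> : (f \in matchings (c \o r) setT) = [&& well_formed (hgraph_of (r, f, g)),
     no_external (hgraph_of (r, f, g)) & c \in [set c | colouring (hgraph_of (r, f, g)) c]].
  rewrite !inE; congr [&& _, _ & _]; apply: eq_forallb => h //=.
  by rewrite inE eqb_id.
rewrite /admissible /hgraph_of /=.
by case: well_formed; case: no_external; case: stable; case: (_ == _); case: (c \in _).
Qed.
End GraphSums.

(** * The logarithm of the formal integral *)

Section Main.
Variable F : numFieldType.

(** The index j is 2g - 2 + n, the power of z^-1 carried by such a vertex. *)
Definition chi_deg (n j : nat) : F :=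
  if [&& 0 < j, n <= j + 2 & ~~ odd (j + n)]%N then chiM F (j + 2 - n)./2 n else 0.

(** The asymptotic coefficients of the exponent in closed form: the vertices of
    the Feynman graphs are the moduli spaces themselves. *)
Definition exponent : fps2 F := fun n j => chi_deg n j / n`!%:R.

Lemma natr_poly_unit n : n.+1%:R \is a @GRing.unit {poly F}.
Proof. by rewrite -polyC_natr poly_unitE size_polyC coefC pnatr_eq0 /= unitfE pnatr_eq0. Qed.

Lemma polyV_fact n : (n`!%:R^-1 : {poly F}) = (n`!%:R^-1)%:P.
Proof. by rewrite -polyCV polyC_natr. Qed.

(** With k and m fixed, vertices have at most 2k half-edges and genus at most
    m/2 + 1, so that polynomials replace the formal series. *)
Section Trunc.
Variables (k m : nat).
Let N := m./2.+2.

Definition exponent_poly : {poly {poly F}} :=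
  \sum_(n < (2 * k).+1) (vertices F N n / n`!%:R) *: 'X^n.

Definition partition_poly : {poly {poly F}} :=
  \sum_(u < m.+1) u`!%:R^-1 *: gauss (exponent_poly ^+ u).

Lemma coef_vertices n j : (j <= m)%N ->
  (vertices F N n)`_j = chi_deg n j.
Proof.
move=> jm; rewrite /vertices coef_sum /chi_deg.
have coefv g : (vertex F g n)`_j
   = if (2 < 2 * g + n)%N && (j == 2 * g + n - 2)%N then chiM F g n else 0.
  rewrite /vertex; case: ifP => _; last by rewrite coef0.
  by rewrite coefZ coefXn; case: eqP; rewrite ?mulr1 ?mulr0.
case: ifPn => [/and3P[j0 nj ev]|nv].
  have gN : ((j + 2 - n)./2 < N)%N by rewrite /N; lia.
  rewrite (bigD1 (Ordinal gN)) //= coefv big1 ?addr0.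
    case: ifP => // /negbT; rewrite negb_and; lia.
  move=> g gn; rewrite coefv; case: ifP => // h; case/negP: gn; apply/eqP/val_inj => /=; lia.
by rewrite big1 // => g _; rewrite coefv; case: ifP => // h; case/negP: nv; lia.
Qed.

Lemma ser_exponent_poly : eq_upto (2 * k) m (ser exponent_poly) exponent.
Proof.
move=> n j nk jm; rewrite /ser /exponent_poly -(poly_def _ (fun n => vertices F N n / n`!%:R)).
rewrite coef_poly ltnS nk polyV_fact coefMC.
by rewrite coef_vertices.
Qed.

Lemma val_exponent : val_ge 1 exponent.
Proof. by move=> n [|j] // _; rewrite /exponent /chi_deg mul0r. Qed.

Lemma ser_partition_poly : eq_upto k m (ser partition_poly) (gauss_integral (fps2_exp exponent)).
Proof.
move=> i j ik jm; rewrite /ser /partition_poly /gauss_integral.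
have -> : (\prod_(a < i) (2 * a + 1))%N = dfact (2 * i).
  by rewrite /dfact mul2n odd_double doubleK.
rewrite (fps2_exp_trunc _ val_exponent jm) mulr_sumr !coef_sum.
apply: eq_bigr => u _; rewrite coefZ coef_gauss polyV_fact coefCM.
rewrite -polyC_natr coefCM mulrCA; congr (_ * _); rewrite mulrC; congr (_ / _).
rewrite -[LHS]/(ser _ _ _) ser_exp; apply: (eq_upto_pow _ ser_exponent_poly) => //.
by rewrite leq_mul2l ik.
Qed.

Lemma val_gauss_integral_sub1 : val_ge 1 (fps2_sub (gauss_integral (fps2_exp exponent))
    (fps2_one F)).
Proof.
move=> i [|//] _; rewrite /fps2_sub /gauss_integral.
rewrite (fps2_exp_trunc _ val_exponent (leqnn 0)) big_ord_recr big_ord0 /= add0r.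
rewrite /fps2_one eqxx andbT divr1; case: i => [|i]; last by rewrite mulr0 subrr.
by rewrite big_ord0 mulr1 subrr.
Qed.

Lemma coef_partition_poly_pow t : ((partition_poly ^+ t)`_k)`_m =
  (\sum_(u < m.+1) ((fps2_pow (fps2_sub (gauss_integral (fps2_exp exponent))
      (fps2_one F)) u k m) *: binpoly F u)).[t%:R].
Proof.
set Z := gauss_integral _; set Z1 := fps2_sub _ _.
have sZ1 : eq_upto k m (ser (partition_poly - 1)) Z1.
  move=> i j ik jm; rewrite /ser coefB coefB -[partition_poly`_i`_j]/(ser partition_poly i j)
      ser_partition_poly //.
  by rewrite coef1 /Z1 /fps2_sub /fps2_one; case: eqP; rewrite ?coef1 ?coef0.
have coefZ1 u : ((partition_poly - 1) ^+ u)`_k`_m = fps2_pow Z1 u k m.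
  by rewrite -[LHS]/(ser _ _ _) ser_exp (eq_upto_pow u sZ1).
pose G u : F := fps2_pow Z1 u k m * 'C(t, u)%:R.
have trunc K : (m <= K)%N -> (t <= K)%N ->
   (\sum_(u < K.+1) G u = \sum_(u < m.+1) G u) * (\sum_(u < K.+1) G u = \sum_(u < t.+1) G u).
  move=> mK tK; split; rewrite [RHS](big_ord_widen K.+1 G) // [RHS]big_mkcond;
    apply: eq_bigr => u _; case: ltnP => // lt.
  - by rewrite /G (val_ge_pow val_gauss_integral_sub1) ?mul0r.
  - by rewrite /G bin_small ?mulr0.
rewrite horner_sum (eq_bigr (fun u : 'I_m.+1 => G u)); last first.
  by move=> u _; rewrite hornerZ horner_binpoly.
have [<- ->] := trunc (maxn m t) (leq_maxl _ _) (leq_maxr _ _).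
rewrite -[partition_poly](subrK 1) addrC exprDn !coef_sum; apply: eq_bigr => u _.
by rewrite expr1n mul1r coefMn coefMn coefZ1 /G mulr_natr.
Qed.

(** Summing over the number of vertices gives the power of the exponential, as
    terms with more than m vertices do not contribute to y^m. *)
Lemma sum_exponent_poly_pow t :
  \sum_(v < m.+1) (\sum_(n : {ffun 'I_t -> 'I_m.+1} | (\sum_i n i)%N == v)
                \prod_i ((n i)`!%:R^-1 *: gauss (exponent_poly ^+ n i)))`_k`_m
  = (partition_poly ^+ t)`_k`_m.
Proof.
have -> : partition_poly ^+ t = \sum_(n : {ffun 'I_t -> 'I_m.+1})
                \prod_i ((n i)`!%:R^-1 *: gauss (exponent_poly ^+ n i)).
  by rewrite -(card_ord t) -prodr_const bigA_distr_bigA card_ord.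
under eq_bigr => v _ do rewrite !coef_sum.
rewrite (exchange_big_dep predT) //= !coef_sum; apply: eq_bigr => n _.
have [le|gt] := leqP (\sum_i n i)%N m.
  rewrite (big_pred1 (Ordinal (le : (\sum_i n i < m.+1)%N))) //.
rewrite big1 => [|v /eqP e]; last by have := ltn_ord v; rewrite -e ltnS leqNgt gt.
have vp u (a : {poly F}) : forall i j, (i <= k)%N -> (j <= m)%N -> (j < u)%N -> (a *: gauss
    (exponent_poly ^+ u))`_i`_j = 0.
  move=> i j ik jm ju; rewrite coefZ coef_gauss coefM big1 // => b _.
  rewrite -polyC_natr coefCM -[(exponent_poly ^+ u)`_ _`_ _]/(ser _ _ _) ser_exp.
  rewrite (eq_upto_pow u ser_exponent_poly) ?leq_mul2l ?ik ?orbT //;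
      last by rewrite (leq_trans (leq_subr _ _)).
  by rewrite (val_ge_pow val_exponent) ?mulr0 // (leq_ltn_trans (leq_subr _ _)).
have : forall r i j, (i <= k)%N -> (j <= m)%N -> (j < \sum_(a <- r) n a)%N ->
   (\prod_(a <- r) ((n a)`!%:R^-1 *: gauss (exponent_poly ^+ n a)))`_i`_j = 0.
  elim=> [|a r IH] i j ik jm; rewrite ?big_nil // !big_cons => ltj.
  rewrite coefM coef_sum big1 // => b _; rewrite coefM big1 // => c _.
  have [h|h] := ltnP c (n a).
    by rewrite vp ?mul0r //; [have := ltn_ord b | have := ltn_ord c]; lia.
  by rewrite IH ?mulr0 //; have := ltn_ord c; lia.
by move=> /(_ (index_enum _) k m (leqnn k) (leqnn m) gt) ->.
Qed.

(** The sum over all labelled graphs with k edges, with t marking connected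
    components. *)
Definition graph_poly : {poly F} :=
  \sum_(v < m.+1) ((2 * k)`!%:R * v`!%:R)^-1 *:
    \sum_(G : hgraph 'I_v 'I_(2 * k) N | admissible m G)
      weight F G *: 'X^(n_comp (adj G) 'I_v).

(** At a natural number t, the power of t counts colourings; each colour then
    contributes a copy of the Gaussian integral, independent of the others. *)
Lemma horner_graph_poly t : graph_poly.[t%:R] = (partition_poly ^+ t)`_k`_m.
Proof.
rewrite -sum_exponent_poly_pow horner_sum; apply: eq_bigr => v _.
rewrite hornerZ horner_sum.
rewrite (eq_bigr (fun G => weight F G *+ #|[set c : {ffun 'I_v -> 'I_t} | colouring G c]|)).
  rewrite sum_coloured_graphs.
  under eq_bigr => c _ do rewrite (wick_colours natr_poly_unit c (vertices F N) (leqnn _)).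
  rewrite -mulr_sumr -coef_sum (@sum_colourings _ natr_poly_unit _ _ _ m.+1) //.
  rewrite coefZ -!polyC_natr !coefCM [X in _ * X]mulrA mulKf //.
  by rewrite -natrM pnatr_eq0 muln_eq0 negb_or -!lt0n !fact_gt0.
move=> G /and4P[wf _ _ _]; rewrite card_colouring //.
by rewrite hornerZ hornerXn -natrX mulr_natr.
Qed.

(** Both sides are polynomials in t that agree at all natural numbers, hence
    equal; the linear coefficient of Z^t is log Z. *)
Lemma log_graph_poly :
  fps2_log (gauss_integral (fps2_exp exponent)) k m = graph_poly`_1.
Proof.
have -> : graph_poly = \sum_(u < m.+1) ((fps2_pow (fps2_sub (gauss_integral (fps2_exp exponent))
      (fps2_one F)) u k m) *: binpoly F u).
  by apply: poly_nat_inj => t; rewrite horner_graph_poly coef_partition_poly_pow.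
rewrite (fps2_log_trunc _ _ val_gauss_integral_sub1) coef_sum big_ord_recl coefZ coef1_binpoly
    mulr0 add0r.
by apply: eq_bigr => u _; rewrite coefZ coef1_binpoly mulrC.
Qed.

Lemma coef1_graph_poly : graph_poly`_1 =
  \sum_(v < m.+1) ((2 * k)`!%:R * v`!%:R)^-1 *
    \sum_(G : hgraph 'I_v 'I_(2 * k) N | admissible m G && connected G) weight F G.
Proof.
rewrite coef_sum; apply: eq_bigr => v _; rewrite coefZ coef_sum; congr (_ * _).
rewrite [RHS]big_mkcondr; apply: eq_bigr => G /and4P[wf _ _ _].
rewrite connected_n_comp // coefZ coefXn eq_sym.
by case: eqP; rewrite ?mulr1 ?mulr0.
Qed.
End Trunc.

(** The edges are the classes of the relation of lying on the same edge, and
    each has two elements. *)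
Lemma card_edges (V H : finType) N (G : hgraph V H N) :
  well_formed G -> no_external G -> #|H| = (2 * #|edges G|)%N.
Proof.
move=> /forallP wf /forallP ne.
have pt : partition (edges G) [set: H].
  have -> : edges G = preim_partition (fun h => [set h; flip G h]) [set: H].
    apply/setP => B; apply/imsetP/imsetP => -[h _ ->]; exists h; rewrite ?inE ?ne //.
      apply/setP => x; rewrite !inE; apply/idP/eqP.
        by case/orP=> /eqP -> //; rewrite (eqP (wf h)) setUC.
      by move=> /setP/(_ x); rewrite !inE eqxx.
    apply/setP => x; rewrite !inE; apply/eqP/idP.
      by move=> /setP/(_ x); rewrite !inE eqxx.
    by case/orP=> /eqP -> //; rewrite (eqP (wf h)) setUC.
  exact: preim_partitionP.
rewrite -cardsT mulnC; apply: card_uniform_partition pt => B /imsetP[h _ ->].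
by rewrite cards2 eq_sym ne.
Qed.

(** Stability 2g + n >= 3 at each vertex, summed with the right weights, bounds
    the number of half-edges as the range of summation of [chi_tilde] requires. *)
Lemma admissible_bound m (V H : finType) N (G : hgraph V H N) :
  admissible m G -> (#|H| <= 3 * m)%N.
Proof.
case/and4P=> _ _ /forallP st /eqP e; have {}e : (2 * (\sum_x gen G x) + #|H| = m + 2 * #|V|)%N := e.
have := sum_fibre (Defs.root G) => eH.
suff : (\sum_x (fibre (Defs.root G) x + 6) <= \sum_x (6 * gen G x + 3 * fibre (Defs.root G) x))%N.
  have s6 a : (\sum_(x : V) a = #|V| * a)%N by rewrite sum_nat_const.
  rewrite !big_split /= eH !s6; move: e; clear.
  move: (\sum_x gen G x)%N #|V| #|H| => a b c; lia.
by apply: leq_sum => x _; rewrite -valence_fibre; have := st x; lia.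
Qed.

Lemma giso_valence (V H : finType) N (G G' : hgraph V H N) p q x :
  is_giso G G' p q -> valence G' (p x) = valence G x.
Proof.
case/is_gisoP => hr _ _; rewrite /valence -[RHS](card_imset _ (@perm_inj _ q)).
apply: eq_card => h; rewrite [LHS]inE; apply/eqP/imsetP => [hx|[h' ]].
  exists (q^-1%g h); rewrite ?permKV // inE; apply/eqP/(@perm_inj _ p).
  by rewrite -hr permKV.
by rewrite inE => /eqP <- ->; rewrite hr.
Qed.

Lemma giso_stable g v h (G G' : hgraph 'I_v 'I_h g.+1) :
  giso G G' -> (G' \in stable_graphs g v h) = (G \in stable_graphs g v h).
Proof.
suff imp (G1 G2 : hgraph 'I_v 'I_h g.+1) : giso G1 G2 ->
    G1 \in stable_graphs g v h -> G2 \in stable_graphs g v h.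
  move=> GG; apply/idP/idP; apply: imp => //.
  by case: (giso_equiv G G' G) => r /(_ GG) <-.
case/gisoP => -[p q] pq; have /is_gisoP[/= hr hf hg] := pq.
rewrite !inE => /and5P[/forallP wf /forallP ne /forallP st /andP[v0 /forallP cn] gn].
have ne2 : no_external G2.
  by apply/forallP => x; rewrite -(permKV q x) hf (inj_eq perm_inj).
have wf2 : well_formed G2.
  by apply/forallP => x; rewrite -(permKV q x) !hf (inj_eq perm_inj).
apply/and5P; split=> //.
- by apply/forallP => x; rewrite -(permKV p x) hg (giso_valence _ pq).
- rewrite /connected v0 /=; apply/forallP => x; apply/forallP => y.
  have lift r : forall a, path (adj G1) a r -> connect (adj G2) (p a) (p (last a r)).
    elim: r => [|b r IH] a /=; first by rewrite connect0.
    case/andP => /existsP[k /andP[/eqP ka /eqP kb]] /IH; apply: connect_trans.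
    by apply: connect1; apply/existsP; exists (q k); rewrite hf !hr ka kb !eqxx.
  have /connectP[r pr e] := forallP (cn (p^-1 x)%g) (p^-1 y)%g.
  by rewrite -(permKV p x) -(permKV p y) e lift.
have [/forallP wf1 ne1] := (wf, ne).
have eE : #|edges G2| = #|edges G1|.
  apply/eqP; rewrite -(eqn_pmul2l (isT : 0 < 2)%N).
  by rewrite -!card_edges //; apply/forallP.
have eS : (\sum_x gen G2 x = \sum_x gen G1 x)%N.
  by rewrite (reindex_inj (@perm_inj _ p)) /=; apply: eq_bigr => x _; rewrite hg.
by move: gn; rewrite /genus eE eS.
Qed.

Lemma giso_weight (V H : finType) N (G G' : hgraph V H N) :
  giso G G' -> weight F G' = weight F G.
Proof.
case/gisoP => -[p q] pq; have /is_gisoP[_ _ hg] := pq.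
rewrite /weight (reindex_inj (@perm_inj _ p)) /=; apply: eq_bigr => x _.
by rewrite hg (giso_valence _ pq).
Qed.

(** Labelling ([sum_transversal_aut]) turns the left side into the linear
    coefficient of [graph_poly], which is [log_graph_poly]. *)
Lemma graph_sum_log (k m : nat) :
  G_series F k m = fps2_log (gauss_integral (fps2_exp exponent)) k m.
Proof.
rewrite log_graph_poly coef1_graph_poly /G_series.
case: ifPn => [/andP[em m2]|nm]; last first.
  rewrite big1 // => v _; rewrite big_pred0 ?mulr0 // => G; apply/negbTE/negP.
  case/andP => /and4P[_ _ /forallP st /eqP]; rewrite !card_ord => e.
  have {}e : (2 * (\sum_x gen G x) + 2 * k = m + 2 * v)%N := e.
  case/andP => V0 _; rewrite card_ord in V0; have := ltn_ord v.
  case/nandP: nm => [|m1]; first lia.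
  have : m = 0%N \/ m = 1%N by lia.
  by case=> m0; lia.
rewrite /a_coef /chi_tilde; set g := m./2.+1.
have [-> ->] : (2 * g - 2 = m)%N /\ (6 * g - 6 = 3 * m)%N by rewrite /g; lia.
rewrite coef_sum; apply: eq_bigr => v _; rewrite coef_sum.
have Egen (h : nat) : (\sum_(G in graph_reps g v h)
      (\prod_x chiM F (gen G x) (valence G x) / #|aut G|%:R) *: 'X^#|edges G|)`_k
   = if h == (2 * k)%N then \sum_(G in graph_reps g v h) (weight F G / #|aut G|%:R) else 0.
  have inS G : G \in graph_reps g v h -> h = (2 * #|edges G|)%N.
    have eqS : {in stable_graphs g v h & &, equivalence_rel (@giso 'I_v 'I_h g.+1)}.
      by move=> *; apply: giso_equiv.
    move/(subsetP (transversal_sub (transversalP (equivalence_partitionP eqS)))).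
    by rewrite inE => /and5P[wf ne _ _ _]; rewrite -{1}(card_ord h) (card_edges wf ne).
  rewrite coef_sum; case: ifP => [/eqP hk|hk].
    apply: eq_bigr => G /inS eG; rewrite coefZ coefXn.
    by rewrite (_ : k == #|edges G|) ?mulr1 //; apply/eqP; lia.
  rewrite big1 // => G /inS eG; rewrite coefZ coefXn.
  by case: eqP => [e|]; rewrite ?mulr0 //; rewrite eG e eqxx in hk.
under eq_bigr => h _ do rewrite Egen.
rewrite -big_mkcond /=.
have [lt|ge] := ltnP (2 * k) (3 * m).+1; last first.
  rewrite big_pred0 => [|h]; last by apply/negbTE; have := ltn_ord h; apply: contraL => /eqP ->;
      rewrite -leqNgt.
  rewrite big_pred0 ?mulr0 // => G; apply/negbTE/negP => /andP[/admissible_bound].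
  by rewrite card_ord; lia.
rewrite (big_pred1 (Ordinal lt)) //= sum_transversal_aut.
- have ca n : #|('I_n : finType)| = n by apply: card_ord.
  rewrite (ca v) (ca (2 * k)%N) [v`!%:R * _]mulrC; congr (_ * _); apply: eq_bigl => G.
  rewrite inE /admissible !card_ord andbA; case wf: well_formed; case ne: no_external => //=.
  have := card_edges wf ne; rewrite (ca (2 * k)%N) => ek;
  case: (stable G); case: (connected G); rewrite ?andbT ?andbF //= /genus (ca v) /g.
  by move: ek em; move: (\sum_x gen G x)%N #|edges G| => a b; clear; lia.
- exact: giso_stable.
- exact: giso_weight.
Qed.
End Main.

(** * Bernoulli numbers and polynomials *)

Section Bernoulli.
Variable F : numFieldType.
Local Notation B := (bernoulli F).

Lemma size_bernoulli_seq n : size (bernoulli_seq F n) = n.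
Proof. by elim: n => //= n IH; rewrite size_rcons IH. Qed.

Lemma nth_bernoulli_seq n k : (k < n)%N -> (bernoulli_seq F n)`_k = B k.
Proof.
elim: n => // n IH kn; have [e|ne] := eqVneq k n; first by rewrite e.
have {}kn : (k < n)%N by lia.
by rewrite [LHS]/= nth_rcons size_bernoulli_seq kn IH.
Qed.

Lemma bernoulli0 : B 0 = 1. Proof. by []. Qed.

Lemma bernoulliS n :
  B n.+1 = - n.+2%:R^-1 * \sum_(k < n.+1) 'C(n.+2, k)%:R * B k.
Proof.
rewrite /bernoulli -[bernoulli_seq F n.+2]/(rcons (bernoulli_seq F n.+1)
  (- n.+2%:R^-1 * \sum_(k < n.+1) 'C(n.+2, k)%:R * (bernoulli_seq F n.+1)`_k)).
rewrite nth_rcons size_bernoulli_seq ltnn eqxx; congr (_ * _).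
by apply: eq_bigr => k _; rewrite nth_bernoulli_seq.
Qed.

Lemma bernoulli_rec n :
  \sum_(k < n.+2) 'C(n.+2, k)%:R * B k = 0.
Proof.
rewrite big_ord_recr /= bernoulliS (_ : 'C(n.+2, n.+1) = n.+2) ?binSn // mulrA mulrN mulfV
    ?mulN1r ?subrr //.
by rewrite pnatr_eq0.
Qed.

Lemma bernoulli1 : B 1 = - (1 / 2).
Proof.
have := bernoulli_rec 0; rewrite !big_ord_recr big_ord0 /= bernoulli0 bin0 bin1 add0r mulr1.
move=> h; have two : 2 != 0 :> F by rewrite pnatr_eq0.
by apply: (mulfI two); rewrite mulrN mul1r mulfV //; apply/eqP; rewrite -addr_eq0 addrC; apply/eqP.
Qed.

Lemma bernoulli2 : B 2 = 1 / 6.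
Proof.
have := bernoulli_rec 1; rewrite !big_ord_recr big_ord0 /= bernoulli0 bernoulli1 add0r.
have -> : 'C(3, 0) = 1%N by []. have -> : 'C(3, 1) = 3%N by []. have -> : 'C(3, 2) = 3%N by [].
move=> h; apply: (mulfI (_ : 3 != 0 :> F)); first by rewrite pnatr_eq0.
have -> : 3 * B 2 = - (1 * 1 + 3 * - (1 / 2)) by apply/eqP; rewrite -addr_eq0 addrC h.
by field.
Qed.

Definition bernpoly (n : nat) : {poly F} :=
  \sum_(i < n.+1) ('C(n, i)%:R * B i) *: 'X^(n - i).

Lemma horner_bernpoly0 n : (bernpoly n).[0] = B n.
Proof.
rewrite horner_sum big_ord_recr /= subnn expr0 !hornerE binn mul1r big1 ?add0r //.
by move=> i _; rewrite !hornerE expr0n subn_eq0 leqNgt ltn_ord mulr0.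
Qed.

Lemma horner_bernpoly1 n : (bernpoly n).[1] = B n + (n == 1%N)%:R.
Proof.
rewrite horner_sum (eq_bigr (fun i : 'I_n.+1 => 'C(n, i)%:R * B i)); last first.
  by move=> i _; rewrite !hornerE expr1n mulr1.
rewrite big_ord_recr /= binn mul1r addrC; congr (_ + _).
case: n => [|[|n]]; rewrite ?big_ord0 // ?big_ord1 ?bin0 ?mul1r //.
exact: bernoulli_rec.
Qed.

Lemma deriv_bernpoly n : (bernpoly n.+1)^`() = n.+1%:R *: bernpoly n.
Proof.
rewrite /bernpoly raddf_sum big_ord_recr /= subnn expr0 derivZ -polyC1 derivC scaler0 addr0.
rewrite scaler_sumr; apply: eq_bigr => i _.
have -> : (n.+1 - i = (n - i).+1)%N by rewrite subSn // -ltnS.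
rewrite derivZ derivXn -pred_Sn.
rewrite -scaler_nat !scalerA; congr (_ *: _).
rewrite mulrAC mulrA -!natrM; congr (_%:R * _).
by rewrite mulnC -subSn ?(mul_bin_down n.+1 i) // -ltnS.
Qed.

(** The difference d_n of both sides satisfies d_n' = n d_(n-1), so if d_(n-1)
    vanishes then d_n is constant; the constant is the increment on [0, 1] of
    d_(n+1), up to a factor, and that increment vanishes by symmetry. *)
Lemma bernpoly_refl n : (bernpoly n) \Po (1 - 'X) = (-1) ^+ n *: bernpoly n.
Proof.
pose d n := bernpoly n - (-1) ^+ n *: (bernpoly n \Po (1 - 'X)).
have dd m : (d m.+1)^`() = m.+1%:R *: d m.
  rewrite /d derivB derivZ deriv_comp !deriv_bernpoly derivB derivX -polyC1 derivC sub0r.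
  rewrite comp_polyZ mulrN1 scalerN -scaleNr exprS mulN1r opprK scalerBr; congr (_ - _).
  by rewrite !scalerA mulrC.
have sgn m : (-1) ^+ m * (-1) ^+ m = 1 :> F by rewrite -exprD addnn -mul2n exprM sqrrN !expr1n.
have dv m x : (d m).[x] = (bernpoly m).[x] - (-1) ^+ m * (bernpoly m).[1 - x].
  by rewrite /d !hornerE horner_comp !hornerE.
suff d0 m : d m = 0.
  have /eqP := d0 n; rewrite /d subr_eq0 => /eqP {2}->.
  by rewrite scalerA sgn scale1r.
have cst p : p^`() = 0 :> {poly F} -> p = (p.[0])%:P.
  move=> h; apply/polyP => i; rewrite coefC horner_coef0; case: eqP => [->//|/eqP i0].
  have := coef_deriv p i.-1; rewrite h coef0 prednK ?lt0n // => /esym/eqP.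
  by rewrite -mulr_natr mulf_eq0 pnatr_eq0 (negbTE i0) orbF => /eqP.
elim: m => [|m IH].
  by rewrite /d /bernpoly big_ord1 subn0 !expr0 alg_polyC comp_polyC scale1r subrr.
have e1 : d m.+1 = ((d m.+1).[0])%:P by apply: cst; rewrite dd IH scaler0.
have e2 : (d m.+2).[1] - (d m.+2).[0] = m.+2%:R * (d m.+1).[0].
  have : (d m.+2 - (m.+2%:R * (d m.+1).[0]) *: 'X)^`() = 0.
    by rewrite derivB dd derivZ derivX {1}e1 -mul_polyC -mul_polyC polyCM mulr1 subrr.
  move/cst => h; have := congr1 (fun p : {poly F} => p.[1]) h.
  rewrite hornerC !hornerD !hornerN !hornerZ !hornerX mulr1 mulr0 subr0 => /eqP.
  by rewrite subr_eq => /eqP ->; rewrite addrAC subrr add0r.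
have e3 : (d m.+2).[1] = (d m.+2).[0].
  rewrite !dv subrr subr0 !horner_bernpoly0 !horner_bernpoly1 /= addr0.
  by [].
move: e2; rewrite e3 subrr => /esym/eqP; rewrite mulf_eq0 pnatr_eq0 /= => /eqP h.
by rewrite e1 h.
Qed.

Lemma bernoulli_odd n : odd n -> (1 < n)%N -> B n = 0.
Proof.
move=> on n1; have := congr1 (fun p => p.[0]) (bernpoly_refl n).
rewrite horner_comp !hornerE subr0 horner_bernpoly1 horner_bernpoly0 -signr_odd on.
rewrite expr1 mulN1r gtn_eqF // addr0 => /eqP.
by rewrite -addr_eq0 -mulr2n -mulr_natl mulf_eq0 pnatr_eq0 => /eqP.
Qed.
End Bernoulli.

From mathcomp Require Import all_classical all_reals all_analysis.
Import numFieldNormedType.Exports.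
Local Open Scope classical_set_scope.
Local Open Scope ring_scope.

(** * Derivatives *)

Section Derivatives.
Variable R : realType.
Implicit Types (f g : R -> R) (x a b : R).

(** The rules of differentiation are stated for functions written with a bound
    variable, so that a derivative is computed by composing them and compared
    with the expected value by [field]. *)
Lemma drvE f x a b : is_derive x 1 f a -> a = b -> is_derive x 1 f b.
Proof. by move=> h <-. Qed.

Lemma drv_eq f g x a : (forall y, f y = g y) -> is_derive x 1 f a -> is_derive x 1 g a.
Proof. by move=> fg; rewrite (_ : f = g) //; apply/funext. Qed.

Lemma drv_cst (c : R) x : is_derive x 1 (fun=> c) 0.
Proof. exact: is_derive_cst. Qed.

Lemma drv_id x : is_derive x 1 (fun y => y) 1.
Proof. exact: is_derive_id. Qed.

Lemma drvD f g x a b : is_derive x 1 f a -> is_derive x 1 g b ->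
  is_derive x 1 (fun y => f y + g y) (a + b).
Proof. by move=> ? ?; apply: is_deriveD. Qed.

Lemma drvN f x a : is_derive x 1 f a -> is_derive x 1 (fun y => - f y) (- a).
Proof. by move=> ?; apply: is_deriveN. Qed.

Lemma drvM f g x a b : is_derive x 1 f a -> is_derive x 1 g b ->
  is_derive x 1 (fun y => f y * g y) (a * g x + f x * b).
Proof.
move=> df dg; apply: (drvE (is_deriveM df dg)).
by rewrite addrC /GRing.scale /= [a * _]mulrC.
Qed.

Lemma drvV f x a : f x != 0 -> is_derive x 1 f a ->
  is_derive x 1 (fun y => (f y)^-1) (- a / f x ^+ 2).
Proof.
move=> fx df; apply: (drvE (is_deriveV fx df)).
by rewrite /GRing.scale /= mulrC mulNr mulrN.
Qed.

Lemma drvX n f x a : is_derive x 1 f a ->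
  is_derive x 1 (fun y => f y ^+ n) (n%:R * f x ^+ n.-1 * a).
Proof. by move=> df; have := is_deriveX n df; rewrite exprfctE. Qed.

Lemma drv_exp f x a : is_derive x 1 f a ->
  is_derive x 1 (fun y => expR (f y)) (a * expR (f x)).
Proof.
move=> df; apply: (drvE (@is_derive1_comp R expR f x _ _ (is_derive_expR _) df)).
by rewrite mulrC.
Qed.

Lemma drv_ln f x a : 0 < f x -> is_derive x 1 f a ->
  is_derive x 1 (fun y => ln (f y)) (a / f x).
Proof.
move=> f0 df; apply: (drvE (@is_derive1_comp R (@ln R) f x _ _ (is_derive1_ln f0) df)).
by rewrite mulrC.
Qed.

Lemma drv_comp f g x a b : is_derive (g x) 1 f a -> is_derive x 1 g b ->
  is_derive x 1 (fun y => f (g y)) (a * b).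
Proof. by move=> ? ?; apply: (@is_derive1_comp R f g). Qed.

Lemma drv_horner (p : {poly R}) f x a : is_derive x 1 f a ->
  is_derive x 1 (fun y => p.[f y]) (p^`().[f x] * a).
Proof. by move=> df; apply: (@drv_comp (horner p) f) => //; apply: is_derive_poly. Qed.

Lemma drv_sum (I : Type) (r : seq I) (P : pred I) (f : I -> R -> R) x (d : I -> R) :
  (forall i, P i -> is_derive x 1 (f i) (d i)) ->
  is_derive x 1 (fun y => \sum_(i <- r | P i) f i y) (\sum_(i <- r | P i) d i).
Proof.
move=> df; elim: r => [|i r IH].
  by rewrite big_nil; apply: (drv_eq _ (drv_cst 0 x)) => y; rewrite big_nil.
rewrite big_cons; case: ifP => Pi.
  by apply: (drv_eq _ (drvD (df i Pi) IH)) => y; rewrite big_cons Pi.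
by apply: (drv_eq _ IH) => y; rewrite big_cons Pi.
Qed.

Lemma mvt f (df : R -> R) a b : a < b ->
  (forall x, a <= x <= b -> is_derive x 1 f (df x)) ->
  exists2 c, a < c < b & f b - f a = df c * (b - a).
Proof.
move=> ab d.
have [||c] := @MVT R f df a b ab.
- by move=> x; rewrite in_itv /= => /andP[/ltW ax /ltW xb]; apply: d; rewrite ax.
- apply: derivable_within_continuous => x; rewrite in_itv /= => xab.
  by case: (d x xab).
- by rewrite in_itv /=; exists c.
Qed.

(** Used for limits of functions: such a bound survives the limit. *)
Lemma is_derive_bound f x a (M d : R) : 0 < d ->
  (forall h, `|h| < d -> `|f (h + x) - f x - h * a| <= M * h ^+ 2) ->
  is_derive x 1 f a.
Proof.
move=> d0 hM.
have M0 : 0 <= M.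
  have h : `|d / 2| < d by rewrite gtr0_norm; lra.
  have := le_trans (normr_ge0 _) (hM _ h); rewrite pmulr_lge0 //.
  by rewrite exprn_gt0 //; lra.
have key : (fun h => h^-1 *: ((f \o shift x) (h *: (1 : R)) - f x)) @ 0^' --> a.
  apply/cvgrPdist_le => e e0; near=> h.
  have h0 : h != 0 by near: h; exact: nbhs_dnbhs_neq.
  have hd : `|h| < d.
    near: h; apply: dnbhs0_lt => //.
  have he : `|h| <= e / (M + 1).
    near: h; apply: dnbhs0_le; rewrite divr_gt0 //; lra.
  rewrite /= /GRing.scale /= mulr1.
  have -> : a - h^-1 * (f (h + x) - f x) = - (h^-1 * (f (h + x) - f x - h * a)).
    by field.
  rewrite normrN normrM normfV.
  apply: (@le_trans _ _ (`|h|^-1 * (M * h ^+ 2))).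
    by rewrite ler_wpM2l // ?invr_ge0 // hM.
  have hn : 0 < `|h| by rewrite normr_gt0.
  rewrite (_ : h ^+ 2 = `|h| ^+ 2); last by rewrite -normrX ger0_norm ?sqr_ge0.
  have -> : `|h|^-1 * (M * `|h| ^+ 2) = M * `|h| by field; rewrite gt_eqF.
  apply: (@le_trans _ _ ((M + 1) * `|h|)); first by rewrite ler_wpM2r //; lra.
  by rewrite mulrC -ler_pdivlMr //; lra.
apply: DeriveDef; last exact: cvg_lim key.
by apply/cvg_ex; exists a.
Unshelve. all: by end_near. Qed.

(** A Taylor estimate of order two, from two uses of the mean value theorem. *)
Lemma mvt2 f (f1 f2 : R -> R) x h M :
  (forall y, `|y - x| <= `|h| -> is_derive y 1 f (f1 y)) ->
  (forall y, `|y - x| <= `|h| -> is_derive y 1 f1 (f2 y)) ->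
  (forall y, `|y - x| <= `|h| -> `|f2 y| <= M) ->
  `|f (h + x) - f x - h * f1 x| <= M * h ^+ 2.
Proof.
move=> d1 d2 b2.
have M0 : 0 <= M by apply: le_trans (b2 x _); rewrite ?subrr ?normr0.
pose g y := f y - (y - x) * f1 x.
have dg y : `|y - x| <= `|h| -> is_derive y 1 g (f1 y - f1 x).
  move=> hy; apply: drvE; first apply: drvD (d1 y hy) (drvN (drvM (drvD (drv_id y) (drvN
      (drv_cst x y))) (drv_cst (f1 x) y))).
  by rewrite /=; ring.
have f1b y : `|y - x| <= `|h| -> `|f1 y - f1 x| <= M * `|h|.
  move=> hy; case: (ltrgtP y x) => yx.
  - have [|c /andP[c1 c2] e] := @mvt f1 f2 y x yx.
      by move=> z /andP[z1 z2]; apply: d2; apply: le_trans hy; rewrite !ler0_norm; lra.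
    rewrite distrC e normrM; apply: ler_pM => //; last by rewrite distrC.
    by apply: b2; apply: le_trans hy; rewrite !ler0_norm; lra.
  - have [|c /andP[c1 c2] e] := @mvt f1 f2 x y yx.
      by move=> z /andP[z1 z2]; apply: d2; apply: le_trans hy; rewrite !ger0_norm; lra.
    rewrite e normrM; apply: ler_pM => //.
    by apply: b2; apply: le_trans hy; rewrite !ger0_norm; lra.
  - by rewrite yx subrr normr0 mulr_ge0.
have -> : f (h + x) - f x - h * f1 x = g (h + x) - g x by rewrite /g; ring.
have -> : M * h ^+ 2 = M * `|h| * `|h| by rewrite -mulrA -expr2 -normrX ger0_norm ?sqr_ge0.
case: (ltrgtP h 0) => h0.
- have [||c /andP[c1 c2] e] := @mvt g (fun y => f1 y - f1 x) (h + x) x; first lra.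
    by move=> z /andP[z1 z2]; apply: dg; rewrite !ler0_norm; lra.
  rewrite distrC e normrM (_ : `|x - (h + x)| = `|h|); last by rewrite opprD addrCA subrr addr0
      normrN.
  by rewrite ler_wpM2r // f1b // !ler0_norm; lra.
- have [||c /andP[c1 c2] e] := @mvt g (fun y => f1 y - f1 x) x (h + x); first lra.
    by move=> z /andP[z1 z2]; apply: dg; rewrite !ger0_norm; lra.
  rewrite e normrM addrK.
  by rewrite ler_wpM2r // f1b // !ger0_norm; lra.
- by rewrite h0 add0r subrr normr0 mulr0.
Qed.

(** Differentiation of a pointwise limit. A uniform bound on the second
    derivatives makes the error in the linear approximation uniform, hence it
    passes to the limit together with the values. *)
Lemma is_derive_lim (F F1 F2 : nat -> R -> R) (f f1 : R -> R) x M d : 0 < d ->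
  (forall y, `|y - x| < d -> F n y @[n --> \oo] --> f y) ->
  F1 n x @[n --> \oo] --> f1 x ->
  (forall n y, `|y - x| < d -> is_derive y 1 (F n) (F1 n y)) ->
  (forall n y, `|y - x| < d -> is_derive y 1 (F1 n) (F2 n y)) ->
  (forall n y, `|y - x| < d -> `|F2 n y| <= M) ->
  is_derive x 1 f (f1 x).
Proof.
move=> d0 cF cF1 d1 d2 b2; apply: (@is_derive_bound f x (f1 x) M d d0) => h hd.
have c : `|F n (h + x) - F n x - h * F1 n x| @[n --> \oo] --> `|f (h + x) - f x - h * f1 x|.
  apply: cvg_norm; apply: cvgB; last exact: cvgMr.
  by apply: cvgB; apply: cF; rewrite ?addrK // subrr normr0.
apply: (cvgr_to_le c).
near=> n; apply: (@mvt2 (F n) (F1 n) (F2 n) x h M) => y hy.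
- by apply: d1; apply: le_lt_trans hd.
- by apply: d2; apply: le_lt_trans hd.
- by apply: b2; apply: le_lt_trans hd.
Unshelve. all: by end_near. Qed.
End Derivatives.

(** * Euler-Maclaurin summation *)

Section Sums.
Variable R : realType.
Implicit Types (u v : nat -> R) (x z : R).

Lemma sum_inv_sqr z N : 1 <= z -> \sum_(n < N) (z + n%:R) ^- 2 <= 2 / z.
Proof.
move=> z1; suff h : \sum_(n < N) (z + n%:R) ^- 2 <= 2 / z - 2 / (z + N%:R).
  by apply: le_trans h _; rewrite gerBl divr_ge0 //; have := ler0n R N; lra.
elim: N => [|N IH]; first by rewrite big_ord0 addr0 subrr.
have -> : N.+1%:R = N%:R + 1 :> R by rewrite natr1.
rewrite big_ord_recr /= addrA; set t := z + N%:R in IH *.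
have t1 : 1 <= t by rewrite /t; have := ler0n R N; lra.
apply: le_trans (lerD IH (lexx _)) _.
have -> : t ^- 2 = 2 / t - 2 / (t + 1) - (t - 1) / (t ^+ 2 * (t + 1)).
  by field; apply/andP; split; apply/eqP; lra.
have : 0 <= (t - 1) / (t ^+ 2 * (t + 1)).
  by rewrite divr_ge0 ?mulr_ge0 ?exprn_ge0 //; lra.
by lra.
Qed.

Lemma sum_inv_pow z p N : 1 <= z -> \sum_(n < N) (z + n%:R) ^- p.+2 <= 2 * z ^- p.+1.
Proof.
move=> z1; have z0 : 0 < z by lra.
apply: (@le_trans _ _ (\sum_(n < N) z ^- p * (z + n%:R) ^- 2)).
  apply: ler_sum => n _; rewrite -addn2 exprD invfM ler_wpM2r //.
    by rewrite invr_ge0 exprn_ge0 // addr_ge0 // ltW.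
  rewrite lef_pV2 ?posrE ?exprn_gt0 //; last by rewrite ltr_wpDr.
  by apply: lerXn2r; rewrite ?nnegrE ?lerDl ?addr_ge0 // ltW.
rewrite -mulr_sumr (_ : 2 * z ^- p.+1 = z ^- p * (2 / z)); last first.
  by rewrite exprS invfM; ring.
by rewrite ler_wpM2l ?invr_ge0 ?exprn_ge0 ?sum_inv_sqr // ltW.
Qed.

Lemma sum_telescope u N : u N - u 0%N = \sum_(k < N) (u k.+1 - u k).
Proof.
elim: N => [|N IH]; first by rewrite big_ord0 subrr.
by rewrite big_ord_recr /= -IH addrC addrA subrK.
Qed.

Lemma abs_cvg_sum u (C : R) : (forall n, `|u n| <= C / n.+1%:R ^+ 2) ->
  cvgn (fun n => \sum_(k < n) u k).
Proof.
move=> hu; have C0 : 0 <= C.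
  by have := hu 0%N; rewrite expr1n divr1; apply: le_trans.
have -> : (fun n => \sum_(k < n) u k) = series u.
  by rewrite seriesEord.
apply: normed_cvg; apply: (@series_le_cvg _ _ (fun n => C / n.+1%:R ^+ 2)) => //.
  by move=> n /=.
  by move=> n; rewrite divr_ge0 // exprn_ge0.
apply: nondecreasing_is_cvgn.
  by apply: nondecreasing_series => n _ _; rewrite divr_ge0 // exprn_ge0.
exists (2 * C) => _ [n _ <-]; rewrite seriesEord /= -mulr_sumr mulrC ler_wpM2r //.
apply: le_trans (_ : 2 / 1 <= _); last by rewrite divr1.
apply: le_trans (@sum_inv_sqr 1 n (lexx _)).
by apply: ler_sum => k _; rewrite nat1r.
Qed.

Lemma cvg_of_diff u (C : R) : (forall n, `|u n.+1 - u n| <= C / n.+1%:R ^+ 2) -> cvgn u.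
Proof.
move=> hu; have /cvg_ex[l hl] := abs_cvg_sum hu.
apply/cvg_ex; exists (l + u 0%N).
have e : u = (fun n => \sum_(k < n) (u k.+1 - u k) + u 0%N).
  by apply/funext => n; rewrite -sum_telescope subrK.
rewrite [X in X @ _]e; apply: cvgD => //; exact: cvg_cst.
Qed.

Lemma bound_of_diff u (C : R) n : (forall n, `|u n.+1 - u n| <= C / n.+1%:R ^+ 2) ->
  `|u n| <= `|u 0%N| + 2 * C.
Proof.
move=> hu; have C0 : 0 <= C.
  by have := hu 0%N; rewrite expr1n divr1; apply: le_trans.
have -> : u n = u 0%N + \sum_(k < n) (u k.+1 - u k) by rewrite -sum_telescope addrC subrK.
apply: le_trans (ler_normD _ _) _; rewrite lerD2l.
apply: le_trans (ler_norm_sum _ _ _) _.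
apply: le_trans (_ : \sum_(k < n) C * (1 + k%:R) ^- 2 <= _).
  by apply: ler_sum => k _; rewrite nat1r.
rewrite -mulr_sumr mulrC ler_wpM2r //; have := @sum_inv_sqr 1 n (lexx _).
by rewrite divr1.
Qed.

Lemma sum_geo_le (C r : R) (N M : nat) : 0 <= C -> 0 <= r < 1 -> (N <= M)%N ->
  \sum_(N <= m < M) C * r ^+ m <= C * r ^+ N / (1 - r).
Proof.
move=> C0 /andP[r0 r1] NM.
suff h : \sum_(N <= m < M) C * r ^+ m = C * (r ^+ N - r ^+ M) / (1 - r).
  rewrite h ler_wpM2r ?invr_ge0 //; first by lra.
  by rewrite ler_wpM2l // gerBl exprn_ge0.
rewrite -mulr_sumr -mulrA; congr (_ * _).
elim: M NM => [|M IH]; first by rewrite leqn0 => /eqP ->; rewrite big_geq // subrr mul0r.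
rewrite leq_eqVlt => /orP[/eqP ->|NM]; first by rewrite big_geq // subrr mul0r.
by rewrite big_nat_recr //= IH // exprS; field; apply/eqP; lra.
Qed.

(** Dominated convergence for series with a geometric bound. *)
Lemma tannery (a : nat -> nat -> R) (b s : nat -> R) (C r : R) :
  0 <= r < 1 ->
  (forall m, a n m @[n --> \oo] --> b m) ->
  (forall n m, `|a n m| <= C * r ^+ m) ->
  (forall n, series (a n) N @[N --> \oo] --> s n) ->
  exists2 S : R, series b N @[N --> \oo] --> S & s n @[n --> \oo] --> S.
Proof.
move=> /andP[r0 r1] ab aC as_.
have C0 : 0 <= C by have := aC 0%N 0%N; rewrite expr0 mulr1; apply: le_trans.
have bC m : `|b m| <= C * r ^+ m.
  have c : `|a n m| @[n --> \oo] --> `|b m| by apply: cvg_norm; apply: ab.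
  by apply: (cvgr_to_le c); near=> n; apply: aC.
have tail (v : nat -> R) (N M : nat) : (forall m, `|v m| <= C * r ^+ m) -> (N <= M)%N ->
   `|series v M - series v N| <= C * r ^+ N / (1 - r).
  move=> vC NM; rewrite sub_series_geq //; apply: le_trans (ler_norm_sum _ _ _) _.
  by apply: le_trans (sum_geo_le C0 (introT andP (conj r0 r1)) NM); apply: ler_sum => m _.
have cb : cvgn (series b).
  apply: normed_cvg; apply: (@series_le_cvg _ _ (fun m => C * r ^+ m)) => //.
    by move=> m /=.
    by move=> m; rewrite mulr_ge0 // exprn_ge0.
  apply: nondecreasing_is_cvgn.
    by apply: nondecreasing_series => m _ _; rewrite mulr_ge0 // exprn_ge0.
  exists (C * r ^+ 0 / (1 - r)) => _ [n _ <-].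
  by rewrite /series /=; apply: sum_geo_le => //; rewrite r0.
have limtail (v : nat -> R) N (l : R) : (forall m, `|v m| <= C * r ^+ m) ->
   series v M @[M --> \oo] --> l -> `|l - series v N| <= C * r ^+ N / (1 - r).
  move=> vC vl.
  have c : `|series v M - series v N| @[M --> \oo] --> `|l - series v N|.
    by apply: cvg_norm; apply: cvgB => //; apply: cvg_cst.
  apply: (cvgr_to_le c); near=> M; apply: tail => //.
  by near: M; exact: nbhs_infty_ge.
exists (limn (series b)) => //.
apply/cvgrPdist_le => e e0.
have [N hN] : exists N, C * r ^+ N / (1 - r) <= e / 3.
  have rn1 : `|r| < 1 by rewrite ger0_norm.
  have c : C * r ^+ N / (1 - r) @[N --> \oo] --> 0.
    have -> : 0 = C * 0 * (1 - r)^-1 by rewrite mulr0 mul0r.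
    by apply: cvgM; [apply: cvgM; [apply: cvg_cst|apply: cvg_expr]|apply: cvg_cst].
  have e3 : 0 < e / 3 by lra.
  have /cvgrPdist_le/(_ _ e3) := c.
  case=> N _ /(_ N) /= hN; exists N; apply: le_trans (hN (leqnn N)).
  by rewrite sub0r normrN ler_norm.
have cN : series (a n) N @[n --> \oo] --> series b N.
  rewrite /series /=; elim: N {hN} => [|N IH].
    by under eq_cvg do rewrite big_geq //; rewrite big_geq //; apply: cvg_cst.
  under eq_cvg do rewrite big_nat_recr //=.
  by rewrite big_nat_recr //=; apply: cvgD => //; apply: ab.
have e3 : 0 < e / 3 by lra.
have /cvgrPdist_le/(_ _ e3) h3 := cN.
near=> n.
have h1 : `|limn (series b) - series b N| <= e / 3 by apply: le_trans (limtail _ _ _ bC cb) hN.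
have h2 : `|s n - series (a n) N| <= e / 3.
  by apply: le_trans (limtail _ _ _ _ (as_ n)) hN; apply: aC.
have h4 : `|series b N - series (a n) N| <= e / 3 by near: n; apply: h3.
have -> : limn (series b) - s n = (limn (series b) - series b N)
   + (series b N - series (a n) N) - (s n - series (a n) N) by ring.
apply: le_trans (ler_normB _ _) _.
apply: le_trans (lerD (ler_normD _ _) (lexx _)) _; lra.
Unshelve. all: by end_near. Qed.

End Sums.

Section EulerMaclaurin.
Variable R : realType.
Local Notation B := (bernoulli R).

(** A bound for the K-th Bernoulli polynomial over K! on [0, 1]. *)
Definition em_const (K : nat) : R := \sum_(i < K.+1) `|'C(K, i)%:R * B i| / K`!%:R.

Lemma bernpoly_bound K s : 0 <= s <= 1 ->
  `|(bernpoly R K).[s]| / K`!%:R <= em_const K.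
Proof.
move=> /andP[s0 s1]; rewrite /em_const -mulr_suml ler_wpM2r ?invr_ge0 //.
rewrite /bernpoly horner_sum; apply: le_trans (ler_norm_sum _ _ _) _.
apply: ler_sum => i _; rewrite !hornerE normrM normrX (ger0_norm s0).
by rewrite ler_piMr // exprn_ile1.
Qed.

(** The Euler-Maclaurin formula on [u, u + 1] for the antiderivative H 0 and the
    function H 1. With the Bernoulli polynomials P_j, the derivative in s of
    sum_j P_j(s) H_j(u + 1 - s) / j! telescopes to its last term, so that a
    single use of the mean value theorem on [0, 1] gives the remainder. *)
Lemma euler_maclaurin (H : nat -> R -> R) (K : nat) (u : R) :
  (forall j t, (j <= K.+1)%N -> u <= t <= u + 1 -> is_derive t 1 (H j) (H j.+1 t)) ->
  exists2 t, u <= t <= u + 1 &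
    `|\sum_(j < K.+2) B j / j`!%:R * (H j (u + 1) - H j u) - H 1%N u|
    <= em_const K.+1 * `|H K.+2 t|.
Proof.
move=> dH.
pose P j (s : R) := (bernpoly R j).[s] / j`!%:R.
pose W s := \sum_(j < K.+2) P j s * H j (u + 1 - s).
have dP j (s : R) : is_derive s 1 (P j.+1) (P j s).
  have h := (drvM (drv_horner (bernpoly R j.+1) (drv_id s)) (drv_cst (j.+1`!%:R^-1) s)).
  apply: (drvE h).
  rewrite deriv_bernpoly hornerZ mulr0 addr0 mulr1 /P factS natrM invfM.
  by rewrite mulrACA mulfV ?mul1r // pnatr_eq0.
have dP0 (s : R) : is_derive s 1 (P 0%N) 0.
  apply: (drv_eq _ (drv_cst 1 s)) => y; rewrite /P /bernpoly big_ord1 subn0 !expr0 !hornerE.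
  by rewrite fact0 invr1.
have dW (s : R) : 0 <= s <= 1 -> is_derive s 1 W (- (P K.+1 s * H K.+2 (u + 1 - s))).
  move=> s01; have hu : u <= u + 1 - s <= u + 1 by lra.
  have dj j : (j <= K.+1)%N ->
     is_derive s 1 (fun s => H j (u + 1 - s)) (- H j.+1 (u + 1 - s)).
    move=> jK.
    have h := @drv_comp R (H j) (fun y => u + 1 - y) s _ _ (dH j _ jK hu)
      (drvD (drv_cst (u + 1) s) (drvN (drv_id s))).
    by apply: (drvE h); rewrite add0r mulrN1.
  pose d (j : 'I_K.+2) := (if nat_of_ord j is i.+1 then P i s else 0) * H j (u + 1 - s)
        + P j s * - H j.+1 (u + 1 - s).
  have h (j : 'I_K.+2) : true -> is_derive s 1 (fun s => P j s * H j (u + 1 - s)) (d j).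
    move=> _; apply: (drvM _ (dj _ _)); last by rewrite -ltnS.
    by case: (nat_of_ord j) => [|i].
  apply: (drvE (drv_sum (index_enum _) h)).
  have tel n : \sum_(j < n.+1) ((if nat_of_ord j is i.+1 then P i s else 0) * H j (u + 1 - s)
        + P j s * - H j.+1 (u + 1 - s)) = - (P n s * H n.+1 (u + 1 - s)).
    elim: n => [|n IH]; first by rewrite big_ord1 mul0r add0r mulrN.
    by rewrite big_ord_recr /= IH mulrN addrA addNr add0r.
  by rewrite tel.
have [s s01] := @mvt R W _ 0 1 ltr01 dW.
have W1 : W 1 = \sum_(j < K.+2) B j / j`!%:R * H j u + H 1%N u.
  rewrite /W addrK /P; under eq_bigr => j _ do rewrite horner_bernpoly1.
  rewrite big_ord_recl big_ord_recl /= [in RHS]big_ord_recl [in RHS]big_ord_recl /=.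
  rewrite addr0 (_ : \sum_(i < K) _ = \sum_(i < K) B (bump 0 (bump 0 i)) / (bump 0
      (bump 0 i))`!%:R * H (bump 0 (bump 0 i)) u).
    by rewrite /bump /= !divr1 mulrDl mul1r; ring.
  by apply: eq_bigr => i _; rewrite /bump /= addr0.
have W0 : W 0 = \sum_(j < K.+2) B j / j`!%:R * H j (u + 1).
  by apply: eq_bigr => j _; rewrite subr0 /P horner_bernpoly0.
rewrite W1 W0 subr0 mulr1 => e; exists (u + 1 - s); first lra.
under eq_bigr => j _ do rewrite mulrBr.
rewrite sumrB.
have -> : \sum_(j < K.+2) B j / j`!%:R * H j (u + 1) -
  \sum_(j < K.+2) B j / j`!%:R * H j u - H 1%N u = P K.+1 s * H K.+2 (u + 1 - s).
  by rewrite -[RHS]opprK -e; ring.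
rewrite normrM ler_wpM2r // /P normrM normfV [X in _ / X]ger0_norm //.
by apply: bernpoly_bound; lra.
Qed.
End EulerMaclaurin.

(** * Power series on the real line *)

Section PowerSeries.
Variable R : realType.
Implicit Types (a b c : nat -> R) (x : R).

Lemma cvg_series_sum n (a : nat -> nat -> R) (l : nat -> R) :
  (forall i, series (a i) N @[N --> \oo] --> l i) ->
  series (fun m => \sum_(i < n) a i m) N @[N --> \oo] --> \sum_(i < n) l i.
Proof.
move=> al; elim: n => [|n IH].
  rewrite big_ord0 (_ : series _ = fun=> 0); first exact: cvg_cst.
  by apply/funext => N; rewrite /series /= big1 // => i _; rewrite big_ord0.
rewrite big_ord_recr (_ : series _ = (fun N => series (fun m => \sum_(i < n) a i m) N + series
    (a n) N)).
  by apply: cvgD.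
apply/funext => N; rewrite /series /= -big_split /=.
by apply: eq_bigr => m _; rewrite big_ord_recr.
Qed.

Lemma cvg_seriesM a (l k : R) : series a N @[N --> \oo] --> l ->
  series (fun m => k * a m) N @[N --> \oo] --> k * l.
Proof.
move=> al; rewrite (_ : series _ = (fun N => k * series a N)).
  by apply: cvgMr.
by apply/funext => N; rewrite /series /= mulr_sumr.
Qed.

Lemma cvg_series_shift a (l : R) : series a N @[N --> \oo] --> l ->
  series (fun m => if m is m'.+1 then a m' else 0) N @[N --> \oo] --> l.
Proof.
move=> al; rewrite -cvg_shiftS (_ : (fun n => _) = series a) //.
apply/funext => N; rewrite /series /= big_nat_recl //= add0r.
by [].
Qed.

Lemma cvg_series_geo a (C r : R) : 0 <= r < 1 -> (forall m, `|a m| <= C * r ^+ m) ->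
  cvgn (series a).
Proof.
move=> /andP[r0 r1] aC; have C0 : 0 <= C.
  by have := aC 0%N; rewrite expr0 mulr1; apply: le_trans.
apply: normed_cvg; apply: (@series_le_cvg _ _ (geometric C r)) => //.
- by move=> n /=.
- by move=> n; rewrite /= mulr_ge0 // exprn_ge0.
- by apply: is_cvg_geometric_series; rewrite ger0_norm.
Qed.

(** Coefficients with a geometric bound keep one after differentiation, at the
    price of a larger ratio. *)
Lemma diffs_bound (r r' : R) : 0 < r < r' -> exists2 K : R, 0 < K &
  forall a (C : R), (forall m, `|a m| <= C * r ^+ m) ->
  forall m, `|pseries_diffs a m| <= K * C * r' ^+ m.
Proof.
move=> /andP[r0 rr']; pose d := r' / r - 1.
have d0 : 0 < d by rewrite /d subr_gt0 ltr_pdivlMr // mul1r.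
exists ((1 + d^-1) * r); first by rewrite mulr_gt0 // addr_gt0 // invr_gt0.
move=> a C aC m; have C0 : 0 <= C.
  by have := aC 0%N; rewrite expr0 mulr1; apply: le_trans.
rewrite /pseries_diffs normrM ger0_norm //.
apply: le_trans (_ : m.+1%:R * (C * r ^+ m.+1) <= _); first by rewrite ler_wpM2l.
have bern : m.+1%:R <= (1 + d^-1) * (r' / r) ^+ m.
  have -> : r' / r = 1 + d by rewrite /d; ring.
  have h : 1 + m%:R * d <= (1 + d) ^+ m.
    elim: m => [|m IH]; first by rewrite expr0 mul0r addr0.
    rewrite exprS; apply: le_trans (_ : (1 + d) * (1 + m%:R * d) <= _); last first.
      by rewrite ler_wpM2l // addr_ge0 // ltW.
    rewrite -natr1; have : 0 <= m%:R * d ^+ 2 by rewrite mulr_ge0 // exprn_ge0 // ltW.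
    by rewrite expr2; lra.
  apply: le_trans (_ : (1 + d^-1) * (1 + m%:R * d) <= _); last first.
    by rewrite ler_wpM2l // addr_ge0 // invr_ge0 ltW.
  have -> : (1 + d^-1) * (1 + m%:R * d) = m.+1%:R + d^-1 + m%:R * d.
    by rewrite -natr1; field; apply/eqP; lra.
  by rewrite -addrA lerDl addr_ge0 ?mulr_ge0 ?invr_ge0 // ltW.
rewrite (_ : (1 + d^-1) * r * C * r' ^+ m = (1 + d^-1) * (r' / r) ^+ m * (C * r ^+ m.+1)).
  by rewrite ler_wpM2r // mulr_ge0 // exprn_ge0 // ltW.
by rewrite expr_div_n exprS; field; rewrite expf_neq0 ?gt_eqF.
Qed.

Lemma bound_pow a (C r x : R) : 0 <= r -> (forall m, `|a m| <= C * r ^+ m) ->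
  forall m, `|a m * x ^+ m| <= C * (r * `|x|) ^+ m.
Proof.
move=> r0 aC m; rewrite normrM normrX exprMn mulrA.
by rewrite ler_wpM2r // exprn_ge0.
Qed.

Lemma is_derive_pseries a (C r x : R) : 0 < r -> (forall m, `|a m| <= C * r ^+ m) ->
  r * `|x| < 1 ->
  is_derive x 1 (fun y => limn (pseries a y)) (limn (pseries (pseries_diffs a) x)).
Proof.
move=> r0 aC rx.
pose d := (1 - r * `|x|) / (4 * (r + `|x| + 1)).
have nx := normr_ge0 x.
have d0 : 0 < d by rewrite divr_gt0 //; nra.
pose y := `|x| + d.
have dd : d * (4 * (r + `|x| + 1)) = 1 - r * `|x|.
  by rewrite /d mulfVK //; apply/eqP; nra.
have d1 : d < 1 by nra.
have [K1 K10 h1] : exists2 K : R, 0 < K & forall a (C : R), (forall m, `|a m| <= C * r ^+ m) ->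
  forall m, `|pseries_diffs a m| <= K * C * (r + d) ^+ m by apply: diffs_bound; lra.
have [K2 K20 h2] : exists2 K : R, 0 < K & forall a (C : R), (forall m,
    `|a m| <= C * (r + d) ^+ m) ->
  forall m, `|pseries_diffs a m| <= K * C * (r + 2 * d) ^+ m by apply: diffs_bound; lra.
have ry : (r + 2 * d) * y < 1 by rewrite /y; nra.
have y0 : 0 < y by rewrite /y; lra.
have cv b (C' r' : R) : 0 < r' <= r + 2 * d -> (forall m,
    `|b m| <= C' * r' ^+ m) -> cvgn (pseries b y).
  move=> /andP[r'0 r'r] bC; apply: (@cvg_series_geo _ C' (r' * y)); last first.
    by move=> m; rewrite -{2}(ger0_norm (ltW y0)); apply: bound_pow => //; apply: ltW.
  by apply/andP; split; [rewrite mulr_ge0 // ltW | apply: le_lt_trans ry; rewrite ler_wpM2r // ltW].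
apply: (@pseries_snd_diffs _ a y).
- by apply: (cv _ C r) => //; lra.
- by apply: (cv _ _ (r + d) _ (h1 _ _ aC)); lra.
- by apply: (cv _ _ (r + 2 * d) _ (h2 _ _ (h1 _ _ aC))); lra.
- by rewrite (ger0_norm (ltW y0)) /y; lra.
Qed.

(** A power series is determined by its sums at small positive arguments: the
    first coefficient where two series differ would dominate near 0. *)
Lemma pseries_inj a b (C r : R) : 0 < r ->
  (forall m, `|a m| <= C * r ^+ m) -> (forall m, `|b m| <= C * r ^+ m) ->
  (forall x, 0 < x < (2 * r)^-1 -> limn (pseries a x) = limn (pseries b x)) ->
  forall m, a m = b m.
Proof.
move=> r0 aC bC ab.
have cv f x : (forall m, `|f m| <= C * r ^+ m) -> 0 < x < (2 * r)^-1 -> cvgn (pseries f x).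
  move=> fC /andP[x0 xr]; apply: (@cvg_series_geo _ C (r * x)).
    rewrite mulr_ge0 ?ltW //=; apply: lt_trans (_ : r * (2 * r)^-1 < _); first by rewrite ltr_pM2l.
    by rewrite invfM mulrCA mulfV ?gt_eqF // mulr1; lra.
  by move=> m; rewrite -{2}(ger0_norm (ltW x0)); apply: bound_pow => //; apply: ltW.
pose d m := a m - b m.
have dC m : `|d m| <= 2 * C * r ^+ m.
  by apply: le_trans (ler_normB _ _) _; apply: le_trans (lerD (aC m) (bC m)) _; lra.
have C0 : 0 <= C by have := aC 0%N; rewrite expr0 mulr1; apply: le_trans.
have ds x : 0 < x < (2 * r)^-1 -> pseries d x N @[N --> \oo] --> 0.
  move=> hx; rewrite (_ : pseries d x = (fun N => pseries a x N - pseries b x N)).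
    have -> : 0 = limn (pseries a x) - limn (pseries b x) by rewrite ab // subrr.
    by apply: cvgB; apply: cv.
  apply/funext => N; rewrite /pseries /series /= -sumrB.
  by apply: eq_bigr => i _; rewrite mulrBl.
suff d0 m : d m = 0 by move=> m; apply/eqP; rewrite -subr_eq0; apply/eqP/d0.
elim/ltn_ind: m => p IH.
suff h x : 0 < x < (2 * r)^-1 -> `|d p| <= 4 * C * r ^+ p.+1 * x.
  apply/eqP; rewrite -normr_le0 leNgt; apply/negP => dp.
  pose x := Num.min ((2 * r)^-1 / 2) (`|d p| / (2 * (4 * C * r ^+ p.+1 + 1))).
  have M0 : 0 <= 4 * C * r ^+ p.+1 by rewrite !mulr_ge0 // exprn_ge0 // ltW.
  have i0 : 0 < (2 * r)^-1 by rewrite invr_gt0; lra.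
  have x0 : 0 < x by rewrite /x lt_min !divr_gt0 //; lra.
  have xr : x < (2 * r)^-1 by rewrite /x gt_min; apply/orP; left; lra.
  have xd : x * (2 * (4 * C * r ^+ p.+1 + 1)) <= `|d p|.
    by rewrite -ler_pdivlMr ?ge_min ?lexx ?orbT //; lra.
  have := h x; rewrite x0 xr => /(_ isT); nra.
move=> hx; have /andP[x0 xr] := hx.
have xp : 0 < x ^+ p by rewrite exprn_gt0.
have rx : r * x <= 1 / 2.
  have : r * x < r * (2 * r)^-1 by rewrite ltr_pM2l.
  by rewrite invfM mulrCA mulfV ?gt_eqF // mulr1; lra.
suff : `|d p| * x ^+ p <= 4 * C * r ^+ p.+1 * x * x ^+ p by rewrite ler_pM2r.
have c : `|pseries d x N| + 4 * C * r ^+ p.+1 * x * x ^+ p @[N --> \oo] --> `|0 : R| + 4 * C * r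
    ^+ p.+1 * x * x ^+ p.
  by apply: cvgD; [apply: cvg_norm; apply: ds | apply: cvg_cst].
rewrite normr0 add0r in c; apply: (cvgr_to_ge c); near=> N.
have pN : (p < N)%N by near: N; exact: nbhs_infty_gt.
have -> : pseries d x N = d p * x ^+ p + \sum_(p.+1 <= i < N) d i * x ^+ i.
  rewrite /pseries /series /= (big_cat_nat (n := p)) //= 1?ltnW //.
  rewrite big_nat_cond big1 ?add0r; last by move=> i; rewrite andbT => /andP[_ /IH ->];
      rewrite mul0r.
  by rewrite big_ltn.
set T := \sum_(_ <= i < _) _.
have Tb : `|T| <= 4 * C * r ^+ p.+1 * x * x ^+ p.
  apply: le_trans (ler_norm_sum _ _ _) _.
  have -> : 4 * C * r ^+ p.+1 * x * x ^+ p = 2 * C * (r * x) ^+ p.+1 * 2.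
    by rewrite exprMn [x ^+ p.+1]exprS; ring.
  have q0 : 0 <= r * x by rewrite mulr_ge0 // ltW.
  apply: le_trans (_ : \sum_(p.+1 <= i < N) 2 * C * (r * x) ^+ i <= _).
    by apply: ler_sum => i _; have := bound_pow x (ltW r0) dC i; rewrite (gtr0_norm x0).
  have C20 : 0 <= 2 * C by rewrite mulr_ge0.
  have rx1 : 0 <= r * x < 1 by rewrite q0 /=; lra.
  apply: le_trans (sum_geo_le C20 rx1 pN) _.
  rewrite ler_wpM2l ?mulr_ge0 ?exprn_ge0 //.
  by rewrite -[X in _ <= X]invrK lef_pV2 ?posrE; lra.
have : `|d p * x ^+ p| <= `|d p * x ^+ p + T| + `|T|.
  by rewrite -[X in `|X| <= _](addrK T) ler_normB.
rewrite normrM (gtr0_norm xp) => h; apply: le_trans h _; lra.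
Unshelve. all: by end_near. Qed.
End PowerSeries.

(** * The zeta function near -1 *)

Section Zeta.
Variable R : realType.
Local Notation B := (bernoulli R).

(** With x = s - 1, everything is expanded in powers of x. The coefficient of
    x^m in the j-th derivative of u^-x with respect to u is
    u^-j * pcoef j m (ln u). *)
Fixpoint pcoef (j m : nat) (L : R) : R :=
  if j is j'.+1 then
    - (if m is m'.+1 then pcoef j' m' L else 0) - j'%:R * pcoef j' m L
  else (- L) ^+ m / m`!%:R.

(** The product -x (-x-1) ... (-x-j+1), the factor in the j-th derivative of
    u^-x. *)
Fixpoint pochN (j : nat) (x : R) : R :=
  if j is j'.+1 then (- x - j'%:R) * pochN j' x else 1.

Fixpoint dpochN (j : nat) (x : R) : R :=
  if j is j'.+1 then - pochN j' x + (- x - j'%:R) * dpochN j' x else 0.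

Fixpoint pconst (j : nat) : R := if j is j'.+1 then (3 + j'%:R) * pconst j' else 1.

Lemma pconst_ge0 j : 0 <= pconst j.
Proof. by elim: j => //= j IH; rewrite mulr_ge0 // addr_ge0. Qed.

Lemma drv_pochN j (x : R) : is_derive x 1 (pochN j) (dpochN j x).
Proof.
elim: j => [|j IH] /=; first exact: drv_cst.
apply: (drvE (drvM (drvD (drvN (drv_id x)) (drv_cst (- j%:R) x)) IH)).
by rewrite addr0 mulN1r.
Qed.

Lemma pcoef_series j x L :
  pseries (fun m => pcoef j m L) x N @[N --> \oo] --> pochN j x * expR (- (x * L)).
Proof.
elim: j => [|j IH].
  rewrite mul1r (_ : pseries _ _ = series (exp_coeff (- (x * L)))).
    exact: is_cvg_series_exp_coeff.
  apply/funext => N; apply: eq_bigr => m _; rewrite /exp_coeff /=.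
  by rewrite mulrAC -exprMn mulNr [L * x]mulrC.
have h1 := cvg_seriesM (k := - x) (cvg_series_shift IH).
have h2 := cvg_seriesM (k := - j%:R) IH.
have -> : pochN j.+1 x * expR (- (x * L)) =
   - x * (pochN j x * expR (- (x * L))) + - j%:R * (pochN j x * expR (- (x * L))).
  by rewrite /=; ring.
rewrite (_ : pseries _ _ = (fun N => series (fun m => - x * (if m is m'.+1 then pcoef j m' L * x
    ^+ m' else 0)) N
   + series (fun m => - j%:R * (pcoef j m L * x ^+ m)) N)).
  exact: cvgD.
apply/funext => N; rewrite /pseries /series /= -big_split /=.
by apply: eq_bigr => -[|m] _ /=; rewrite ?exprS; ring.
Qed.

Lemma pcoef_series0 x L :
  series (fun m => pcoef 0 m L * x ^+ m) N @[N --> \oo] --> expR (- (x * L)).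
Proof. by have := @pcoef_series 0 x L; rewrite mul1r. Qed.

(** Cauchy's estimate on the circle of radius 3, proved term by term: it leaves
    room to evaluate at x = -2, which is s = -1. *)
Lemma pcoef_bound j m L : 0 <= L ->
  `|pcoef j m L| <= pconst j * 3^-1 ^+ m * expR (3 * L).
Proof.
move=> L0; have e1 : 1 <= expR (3 * L) by rewrite -expR0 ler_expR mulr_ge0.
elim: j m => [|j IH] m /=.
  rewrite mul1r normrM normrX normrN (ger0_norm L0) ger0_norm ?invr_ge0 //.
  have h : (3 * L) ^+ m / m`!%:R <= expR (3 * L).
    case: m => [|m]; first by rewrite expr0 fact0 divr1.
    have := @expR_ge1Dxn R (3 * L) m; rewrite mulr_ge0 // => /(_ isT); lra.
  have -> : L ^+ m / m`!%:R = 3^-1 ^+ m * ((3 * L) ^+ m / m`!%:R).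
    by rewrite mulrA -exprMn mulrA mulVf ?mul1r // pnatr_eq0.
  by rewrite ler_wpM2l // exprn_ge0 // invr_ge0.
have i3 : 0 <= 3^-1 :> R by lra.
apply: le_trans (ler_normB _ _) _; rewrite normrN normrM (ger0_norm (ler0n _ j)).
rewrite -!mulrA mulrDl; apply: lerD; last by rewrite ler_wpM2l // mulrA IH.
case: m => [|m].
  by rewrite normr0 !mulr_ge0 ?pconst_ge0 ?exprn_ge0 ?expR_ge0.
apply: le_trans (IH m) _; rewrite exprS.
have -> : 3 * (pconst j * (3^-1 * 3^-1 ^+ m * expR (3 * L))) =
   pconst j * 3^-1 ^+ m * expR (3 * L) by field.
exact: lexx.
Qed.

Lemma drv_pcoef j m (L : R) :
  is_derive L 1 (pcoef j m) (- (if m is m'.+1 then pcoef j m' L else 0)).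
Proof.
elim: j m => [|j IH] m.
  case: m => [|m] /=.
    by apply: (drv_eq _ (drvE (drv_cst (0`!%:R^-1) L) _)) => [y|]; rewrite ?oppr0 ?mul1r.
  apply: (drvE (drvM (drvX m.+1 (drvN (drv_id L))) (drv_cst (m.+1`!%:R^-1) L))).
  rewrite mulr0 addr0 factS natrM invfM /= mulrN1 !mulNr; congr (- _).
  by rewrite [m.+1%:R * _]mulrC -!mulrA mulVKf // pnatr_eq0.
have hm : is_derive L 1 (fun L => if m is m'.+1 then pcoef j m' L else 0)
   (if m is m'.+1 then - (if m' is m''.+1 then pcoef j m'' L else 0) else 0).
  by case: m => [|m]; [apply: drv_cst | apply: IH].
apply: (drvE (drvD (drvN hm) (drvN (drvM (drv_cst j%:R L) (IH m))))).
by case: m {hm} => [|m] /=; ring.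
Qed.

(** The j-th derivative of the coefficient of x^m in u^-x. *)
Definition pder (m j : nat) (u : R) : R := u ^- j * pcoef j m (ln u).

Lemma drv_pder m j (u : R) : 0 < u -> is_derive u 1 (pder m j) (pder m j.+1 u).
Proof.
move=> u0; have un : u != 0 by rewrite gt_eqF.
have h1 : is_derive u 1 (fun y : R => (y ^+ j)^-1) (- (j%:R * u ^+ j.-1) / (u ^+ j) ^+ 2).
  have unj : u ^+ j != 0 by rewrite expf_neq0.
  have h := @drvV R (fun y => y ^+ j) u _ unj (drvX j (drv_id u)).
  by apply: (drvE h); rewrite mulr1.
have h2 : is_derive u 1 (fun y : R => pcoef j m (ln y)) (- (if m is m'.+1 then pcoef j m' (ln u)
    else 0) * (1 / u)).
  exact: (@drv_comp R (pcoef j m) (fun y => ln y) u _ _ (drv_pcoef j m (ln u)) (drv_ln u0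
      (drv_id u))).
apply: (drvE (drvM h1 h2)); rewrite /pder /= div1r.
have -> : - (j%:R * u ^+ j.-1) / u ^+ j ^+ 2 = - j%:R * u ^- j.+1.
  case: j {h1 h2} => [|j]; first by rewrite !mul0r oppr0 !mul0r.
  by rewrite succnK -mulNr -mulrA; congr (_ * _); rewrite !exprS; field; rewrite ?expf_neq0 ?un.
rewrite [u ^- j.+1](_ : _ = u ^- j * u^-1); last by rewrite exprS invfM mulrC.
by ring.
Qed.

(** The coefficient of x^m in x times the Dirichlet series cut after n terms
    and corrected by Euler-Maclaurin; [zfun] is the sum of the power series. Five
    terms make the error summable up to x = -2: the fifth derivative of u^-x is
    of order u^(-x-5). *)
Definition zcoef (n m : nat) : R :=
  \sum_(k < n) k.+1%:R^-1 * (if m is m'.+1 then pcoef 0 m' (ln k.+1%:R) else 0)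
  + \sum_(j < 5) B j / j`!%:R * pder m j n.+1%:R.

Definition zfun (n : nat) (x : R) : R :=
  \sum_(k < n) k.+1%:R^-1 * (x * expR (- (x * ln k.+1%:R)))
  + \sum_(j < 5) (B j / j`!%:R * n.+1%:R ^- j) * (pochN j x * expR (- (x * ln n.+1%:R))).

Lemma zcoef_series n x : pseries (zcoef n) x N @[N --> \oo] --> zfun n x.
Proof.
have h1 := @cvg_series_sum R n (fun k m => k.+1%:R^-1 * (x * (if m is m'.+1 then pcoef 0 m'
    (ln k.+1%:R) * x ^+ m' else 0)))
  (fun k => k.+1%:R^-1 * (x * expR (- (x * ln k.+1%:R)))) _.
have h2 := @cvg_series_sum R 5 (fun j m => (B j / j`!%:R * n.+1%:R ^- j) * (pcoef j m
    (ln n.+1%:R) * x ^+ m))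
  (fun j => (B j / j`!%:R * n.+1%:R ^- j) * (pochN j x * expR (- (x * ln n.+1%:R)))) _.
have {}h1 := h1 (fun k => cvg_seriesM (cvg_seriesM (cvg_series_shift (@pcoef_series0 x
    (ln k.+1%:R))))).
have {}h2 := h2 (fun j => cvg_seriesM (@pcoef_series j x (ln n.+1%:R))).
rewrite (_ : pseries _ _ = (fun N => series (fun m => \sum_(i < n) i.+1%:R^-1 * (x *
    (if m is m'.+1 then pcoef 0 m' (ln i.+1%:R) * x ^+ m' else 0))) N
  + series (fun m => \sum_(i < 5) (B i / i`!%:R * n.+1%:R ^- i) * (pcoef i m (ln n.+1%:R)
      * x ^+ m)) N)).
  exact: cvgD h1 h2.
apply/funext => N; rewrite /pseries /series /= -big_split /=; apply: eq_bigr => m _.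
rewrite /zcoef mulrDl !mulr_suml; congr (_ + _); apply: eq_bigr => k _.
  by case: m => [|m] /=; rewrite ?mulr0 ?mul0r // exprS; ring.
by rewrite /pder; ring.
Qed.

Lemma zcoef_diff m n :
  `|zcoef n.+1 m - zcoef n m| <= em_const R 4 * pconst 5 * 3^-1 ^+ m / n.+1%:R ^+ 2.
Proof.
have u0 : 0 < n.+1%:R :> R by rewrite ltr0n.
have [|t tu] := @euler_maclaurin R (pder m) 3 n.+1%:R.
  by move=> j t _ /andP[tn _]; apply: drv_pder; apply: lt_le_trans tn.
set S := \sum_(_ < _) _ => hS.
have -> : zcoef n.+1 m - zcoef n m = S - pder m 1 n.+1%:R.
  have -> : pder m 1 n.+1%:R = - (n.+1%:R^-1 * (if m is m'.+1 then pcoef 0 m' (ln n.+1%:R) else 0)).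
    by rewrite /pder [pcoef 1 _ _]/= mul0r subr0 expr1 mulrN.
  pose F (k : nat) := k.+1%:R^-1 * (if m is m'.+1 then pcoef 0 m' (ln k.+1%:R) else 0).
  have eF : \sum_(k < n.+1) F k = \sum_(k < n) F k + F n by rewrite big_ord_recr.
  rewrite opprK /zcoef [X in X + _ - _]eF /S -/(F n).
  under [in RHS]eq_bigr => j _ do rewrite mulrBr.
  rewrite sumrB natr1 /F; ring.
apply: le_trans hS _; move: (pconst_ge0 5) (@pcoef_bound 5 m).
move: (pconst 5) => p p0 hp; rewrite -!mulrA ler_wpM2l //.
  by rewrite /em_const sumr_ge0 // => i _; rewrite divr_ge0.
have /andP[t1 t2] := tu; have t0 : 0 < t by apply: lt_le_trans t1.
have t11 : 1 <= t by apply: le_trans t1; rewrite ler1n.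
rewrite /pder normrM (ger0_norm (_ : 0 <= t ^- 5)); last by rewrite invr_ge0 exprn_ge0 // ltW.
apply: le_trans (ler_wpM2l _ (hp _ (ln_ge0 t11))) _.
  by rewrite invr_ge0 exprn_ge0 // ltW.
rewrite expRM_natl lnK ?posrE //.
have -> : t ^- 5 * (p * 3^-1 ^+ m * t ^+ 3) = p * (3^-1 ^+ m * t ^- 2).
  by field; rewrite gt_eqF.
apply: ler_wpM2l => //.
apply: ler_wpM2l; first by rewrite exprn_ge0 // invr_ge0.
rewrite lef_pV2 ?posrE ?exprn_gt0 //.
by apply: lerXn2r; rewrite ?nnegrE // ltW.
Qed.
End Zeta.

Section ZetaDerivative.
Variable R : realType.
Local Notation B := (bernoulli R).

Lemma cvg0_bound (f g : nat -> R) : (forall n, `|f n| <= g n) ->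
  g n @[n --> \oo] --> (0 : R) -> f n @[n --> \oo] --> (0 : R).
Proof.
move=> fg g0; have ng : - g n @[n --> \oo] --> (0 : R) by rewrite -oppr0; apply: cvgN.
apply: (squeeze_cvgr _ ng g0); near=> n.
by rewrite -ler_norml.
Unshelve. all: by end_near. Qed.

Lemma cvg_sumr K (f : nat -> nat -> R) (l : nat -> R) :
  (forall j, f j n @[n --> \oo] --> l j) ->
  \sum_(j < K) f j n @[n --> \oo] --> \sum_(j < K) l j.
Proof.
move=> fl; elim: K => [|K IH].
  by under eq_cvg do rewrite big_ord0; rewrite big_ord0; apply: cvg_cst.
by under eq_cvg do rewrite big_ord_recr /=; rewrite big_ord_recr /=; apply: cvgD.
Qed.

Lemma zcoef_bound : exists C : R, forall n m, `|zcoef R n m| <= C * 3^-1 ^+ m.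
Proof.
exists (\sum_(j < 5) `|B j / j`!%:R| * pconst R j + 2 * (em_const R 4 * pconst R 5)) => n m.
apply: le_trans (bound_of_diff n (zcoef_diff R m)) _.
rewrite [X in _ <= X]mulrDl; apply: lerD; last by rewrite -[X in _ <= X]mulrA.
rewrite /zcoef big_ord0 add0r mulr_suml; apply: le_trans (ler_norm_sum _ _ _) _.
apply: ler_sum => j _; rewrite normrM -mulrA ler_wpM2l //.
rewrite /pder expr1n invr1 mul1r ln1.
by have := @pcoef_bound R j m 0 (lexx _); rewrite mulr0 expR0 mulr1.
Qed.

Definition zlim (m : nat) : R := limn (fun n => zcoef R n m).

Lemma zcoef_cvg m : zcoef R n m @[n --> \oo] --> zlim m.
Proof. exact: (cvg_of_diff (zcoef_diff R m)). Qed.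

Lemma expR_Nln_cvg (x : R) : 0 < x -> expR (- (x * ln n.+1%:R)) @[n --> \oo] --> (0 : R).
Proof.
move=> x0; have h : x * ln n.+1%:R @[n --> \oo] --> +oo.
  apply/cvgryPge => A; near=> n.
  rewrite mulrC -ler_pdivrMr // -[A / x]expRK ler_ln ?posrE ?expR_gt0 ?ltr0n //.
  apply: le_trans (_ : n%:R <= _); last by rewrite ler_nat.
  by near: n; exact: nbhs_infty_ger.
exact: (cvg_comp _ _ h (@cvgr_expR R)).
Unshelve. all: by end_near. Qed.

Lemma zfun_cvg (zeta : R -> R) (x : R) : 0 < x ->
  (forall s, 1 < s -> series (fun n => n.+1%:R `^ (- s)) n @[n --> \oo] --> zeta s) ->
  zfun n x @[n --> \oo] --> x * zeta (1 + x).
Proof.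
move=> x0 hz; rewrite -[X in _ --> X]addr0.
have -> : 0 = \sum_(j < 5) (0 : R) by rewrite big1.
apply: cvgD.
  have s1 : 1 < 1 + x by lra.
  have := cvg_seriesM (k := x) (hz _ s1); apply: cvg_trans; apply: near_eq_cvg.
  near=> n; rewrite seriesEord /=; apply: eq_bigr => k _.
  rewrite [RHS]mulrCA; congr (_ * _); rewrite /powR pnatr_eq0 /=.
  rewrite -[in k.+1%:R^-1](@lnK _ k.+1%:R) ?posrE ?ltr0n // -expRN -expRD.
  by congr expR; ring.
apply: (@cvg_sumr 5 (fun j n => B j / j`!%:R * n.+1%:R ^- j *
    (pochN j x * expR (- (x * ln n.+1%:R)))) (fun=> 0)) => j /=.
have c : `|expR (- (x * ln n.+1%:R))| @[n --> \oo] --> (0 : R).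
  by have /cvg_norm := expR_Nln_cvg x0; rewrite normr0; apply.
have {}c := cvgMr (a := `|B j / j`!%:R * pochN j x|) c; rewrite mulr0 in c.
apply: (@cvg0_bound (fun n => B j / j`!%:R * n.+1%:R ^- j *
    (pochN j x * expR (- (x * ln n.+1%:R)))) _ _ (c _)) => n.
have -> : B j / j`!%:R * n.+1%:R ^- j * (pochN j x * expR (- (x * ln n.+1%:R)))
  = n.+1%:R ^- j * (B j / j`!%:R * pochN j x * expR (- (x * ln n.+1%:R))) by ring.
rewrite normrM -[X in _ <= X]normrM ler_piMl // ger0_norm ?invr_ge0 ?exprn_ge0 //.
by rewrite invf_le1 ?exprn_gt0 // exprn_ege1 // ler1n.
Unshelve. all: by end_near. Qed.

(** Its limit is the logarithm of the Glaisher-Kinkelin constant. *)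
Definition glaisher (n : nat) : R :=
  let N := n.+1%:R in
  \sum_(k < n) k.+1%:R * ln k.+1%:R - (N ^+ 2 / 2 - N / 2 + 1 / 12) * ln N + N ^+ 2 / 4.

Lemma expR_2ln k : expR (- (-2 * ln k.+1%:R)) = k.+1%:R ^+ 2 :> R.
Proof. by rewrite mulNr opprK expRM_natl lnK // posrE ltr0n. Qed.

(** At x = -2 the truncations and their derivatives are elementary; this is how
    the sum of k ln k enters. *)
Lemma drv_zfun n :
  is_derive (-2 : R) 1 (zfun n) (2 * glaisher n - 1 / 4 + B 4 / 12 * n.+1%:R ^- 2).
Proof.
pose l k : R := ln k.+1%:R.
have dt k : is_derive (-2 : R) 1 (fun x : R => expR (- (x * l k))) (- l k * k.+1%:R ^+ 2).
  have h := drv_exp (drvN (drvM (drv_id (-2 : R)) (drv_cst (l k) _))).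
  by apply: (drvE h); rewrite mul1r mulr0 addr0 /l expR_2ln.
have h1 (k : 'I_n) : true -> is_derive (-2 : R) 1 (fun x : R => k.+1%:R^-1 * (x * expR (-
    (x * l k))))
   (k.+1%:R + 2 * (k.+1%:R * l k)).
  move=> _; have h := drvM (drv_cst k.+1%:R^-1 (-2 : R)) (drvM (drv_id (-2 : R)) (dt k)).
  apply: (drvE h); rewrite mul0r add0r.
  rewrite /l expR_2ln; have N0 : k.+1%:R != 0 :> R by rewrite pnatr_eq0.
  by move: (ln _) N0; move: (k.+1%:R : R) => N L N0; field.
have h2 (j : 'I_5) : true -> is_derive (-2 : R) 1 (fun x : R => (B j / j`!%:R * n.+1%:R ^- j) *
    (pochN j x * expR (- (x * l n))))
   ((B j / j`!%:R * n.+1%:R ^- j) * (dpochN j (-2) * n.+1%:R ^+ 2 + pochN j (-2) *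
       (- l n * n.+1%:R ^+ 2))).
  move=> _; have h := drvM (drv_cst (B j / j`!%:R * n.+1%:R ^- j) (-2 : R)) (drvM (drv_pochN j
      (-2 : R)) (dt n)).
  by apply: (drvE h); rewrite mul0r add0r /l expR_2ln.
apply: (drvE (drvD (drv_sum (index_enum _) h1) (drv_sum (index_enum _) h2))).
rewrite big_split /= -mulr_sumr.
have -> : \sum_(k < n) k.+1%:R = n.+1%:R * n%:R / 2 :> R.
  elim: n {h1 h2} => [|n IH]; first by rewrite big_ord0 mulr0 mul0r.
  by rewrite big_ord_recr /= IH -!natr1; field.
rewrite !big_ord_recr big_ord0 /=.
rewrite (bernoulli_odd R (n := 3)) // (_ : B 0 = 1) // bernoulli1 bernoulli2 /glaisher -/(l n).
rewrite -[in X in X - 1 / 4](eq_bigr _ (fun k _ => erefl)) /=.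
have -> : n%:R = n.+1%:R - 1 :> R by rewrite -natr1 addrK.
have N0 : n.+1%:R != 0 :> R by rewrite pnatr_eq0.
rewrite /l; move: (\sum_(i < n) _) => S; move: (ln n.+1%:R) N0; move: (n.+1%:R : R) => N L N0.
rewrite !factS fact0 !natrM; field.
exact: N0.
Qed.

Lemma zfun_m2 n : zfun n (-2) = 1 / 6 :> R.
Proof.
rewrite /zfun; under eq_bigr => k _ do rewrite expR_2ln.
under [X in _ + X]eq_bigr => k _ do rewrite expR_2ln.
rewrite (eq_bigr (fun k : 'I_n => -2 * k.+1%:R)); last first.
  move=> k _; have N0 : k.+1%:R != 0 :> R by rewrite pnatr_eq0.
  by move: (k.+1%:R : R) N0 => N N0; field.
rewrite -mulr_sumr.
have -> : \sum_(k < n) k.+1%:R = n.+1%:R * n%:R / 2 :> R.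
  elim: n => [|n IH]; first by rewrite big_ord0 mulr0 mul0r.
  by rewrite big_ord_recr /= IH -!natr1; field.
rewrite !big_ord_recr big_ord0 /=.
rewrite (bernoulli_odd R (n := 3)) // (_ : B 0 = 1) // bernoulli1 bernoulli2.
have -> : n%:R = n.+1%:R - 1 :> R by rewrite -natr1 addrK.
have N0 : n.+1%:R != 0 :> R by rewrite pnatr_eq0.
move: (n.+1%:R : R) N0 => N N0.
by rewrite !factS fact0 !natrM; field.
Qed.

(** The coefficients of the truncations converge, with a common geometric bound
    of ratio 1/3. For 0 < x < 3/2 the truncations converge to x zeta(1 + x), so
    the limits of the coefficients are the Taylor coefficients of that function.
    By dominated convergence the truncations and their derivatives then converge
    at x = -2 too, to the value and the derivative of (s - 1) zeta(s) at s = -1.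
    These give zeta'(-1) since the value is known from [zfun_m2]. *)
Lemma lim_deriv_zeta (zeta : R -> R) : is_riemann_zeta zeta ->
  glaisher n @[n --> \oo] --> 1 / 12 - derive1 zeta (-1).
Proof.
move=> [hz [c hc]].
have [C1 C1b] := zcoef_bound.
have i3 : 0 <= 3^-1 :> R by lra.
have i30 : 0 < 3^-1 :> R by lra.
have zlimb m : `|zlim m| <= C1 * 3^-1 ^+ m.
  have h : `|zcoef R n m| @[n --> \oo] --> `|zlim m| by apply: cvg_norm; apply: zcoef_cvg.
  by apply: (cvgr_to_le h); near=> n; apply: C1b.
have lims x : `|x| <= 2 -> exists2 S : R, pseries zlim x N @[N --> \oo] --> S & zfun n x @[n -->
    \oo] --> S.
  move=> x2; have r01 : 0 <= 3^-1 * `|x| < 1.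
    by rewrite mulr_ge0 //=; lra.
  apply: (@tannery R (fun n m => zcoef R n m * x ^+ m) (fun m => zlim m * x ^+ m) _ C1 _ r01).
  - by move=> m; apply: cvgMl; apply: zcoef_cvg.
  - by move=> n m; apply: bound_pow.
  - by move=> n; apply: zcoef_series.
have [C2 C2b] : exists C : R, forall m, `|c m| <= C * 3^-1 ^+ m.
  have h4 : (4 : R) != 1 by rewrite pnatr_eq1.
  have cc := cvgP _ (hc 4 h4).
  have [K [Kreal Kf]] := cvg_series_bounded cc.
  exists (K + 1) => m; have /= := Kf (K + 1) _ m I.
  rewrite (_ : 4 - 1 = 3 :> R); last by ring.
  rewrite ltrDl ltr01 => /(_ isT) h.
  rewrite exprVn -ler_pdivrMr ?invr_gt0 ?exprn_gt0 // invrK.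
  by rewrite normrM [X in _ * X <= _]ger0_norm ?exprn_ge0 // in h.
have czl m : c m = zlim m.
  apply: (@pseries_inj R c zlim (C1 + C2) 3^-1) => //.
  - move=> {}m; apply: le_trans (C2b m) _; rewrite ler_wpM2r ?exprn_ge0 // lerDr.
    by have := C1b 0%N 0%N; rewrite expr0 mulr1; apply: le_trans.
  - move=> {}m; apply: le_trans (zlimb m) _; rewrite ler_wpM2r ?exprn_ge0 // lerDl.
    by have := C2b 0%N; rewrite expr0 mulr1; apply: le_trans.
  move=> x /andP[x0 x1]; have x2 : `|x| <= 2.
    by rewrite gtr0_norm //; apply: ltW; apply: lt_le_trans x1 _; lra.
  have [S hS1 hS2] := lims x x2.
  have s1 : 1 + x != 1 by rewrite -subr_eq0 addrAC subrr add0r gt_eqF.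
  have := hc _ s1; rewrite addrAC subrr add0r => /(cvg_lim (@Rhausdorff R)) e1.
  rewrite -[limn (pseries c x)]/(limn (series (fun n => c n * x ^+ n))) e1 (cvg_lim _ hS1) //.
  exact: (cvg_unique _ (zfun_cvg x0 hz) hS2).
have n2 : `|-2 : R| = 2 by rewrite normrN ger0_norm.
pose E (x : R) := limn (pseries c x).
have cE : c = zlim by apply/funext.
have dE : is_derive (-2 : R) 1 E (limn (pseries (pseries_diffs c) (-2))).
  by apply: (@is_derive_pseries R c C2 3^-1) => //; rewrite n2; lra.
have Em2 : E (-2) = 1 / 6.
  rewrite /E cE; have [|S hS1 hS2] := lims (-2); first by rewrite n2.
  have c6 : zfun n (-2) @[n --> \oo] --> (1 / 6 : R).
    by under eq_cvg do rewrite zfun_m2; exact: cvg_cst.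
  by rewrite (cvg_lim _ hS1) //; exact: (cvg_unique _ hS2 c6).
pose D n : R := 2 * glaisher n - 1 / 4 + B 4 / 12 * n.+1%:R ^- 2.
have hD : D n @[n --> \oo] --> limn (pseries (pseries_diffs c) (-2)).
  have rr : 0 < (3^-1 : R) < 2 / 5 by lra.
  have [K K0 dK] := diffs_bound rr.
  have r01 : 0 <= 2 / 5 * `|-2 : R| < 1 by rewrite n2; lra.
  have [|||S hS1 hS2] := @tannery R (fun n m => pseries_diffs (zcoef R n) m * (-2) ^+ m)
     (fun m => pseries_diffs c m * (-2) ^+ m) D (K * C1) _ r01.
  - move=> m; apply: cvgMl; rewrite /pseries_diffs; apply: cvgMr; rewrite cE.
    exact: zcoef_cvg.
  - by move=> n m; apply: bound_pow; [lra | apply: dK].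
  - move=> n.
    have zb := C1b n.
    have h1 : is_derive (-2 : R) 1 (zfun n) (limn (pseries (pseries_diffs (zcoef R n)) (-2))).
      have h := @is_derive_pseries R (zcoef R n) C1 3^-1 (-2) i30 zb.
      rewrite n2 in h; have {}h := h _.
      apply: (drv_eq _ (h _)); last by lra.
      by move=> y; apply/cvg_lim => //; apply: zcoef_series.
    have -> : D n = limn (pseries (pseries_diffs (zcoef R n)) (-2)).
      by case: h1 => _ <-; case: (drv_zfun n) => _ ->.
    apply: (@cvg_series_geo _ _ (K * C1) (2 / 5 * `|-2 : R|)); first by rewrite n2; lra.
    by apply: bound_pow; [lra | apply: dK].
  by rewrite (cvg_lim _ hS1).
have hz' : is_derive (-1 : R) 1 zeta
    (limn (pseries (pseries_diffs c) (-2)) / (-2) + (1 / 6) * (- 1 / 4)).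
  have d1 : is_derive (-1 : R) 1 (fun y : R => y - 1) 1.
    by apply: (drvE (drvD (drv_id _) (drv_cst _ _))); rewrite addr0.
  have e2 : -1 - 1 = -2 :> R by ring.
  have d2 : is_derive (-1 : R) 1 (fun y : R => E (y - 1)) (limn (pseries (pseries_diffs c) (-2))
      * 1).
    by apply: (@drv_comp R E (fun y => y - 1)) => //; rewrite e2.
  have d3 : is_derive (-1 : R) 1 (fun y : R => (y - 1)^-1) (- 1 / 4).
    apply: (drvE (@drvV R (fun y => y - 1) (-1) _ _ d1)); first by rewrite e2 oppr_eq0 pnatr_eq0.
    by rewrite e2; field.
  have ne : \forall y \near (-1 : R), E (y - 1) * (y - 1)^-1 = zeta y.
    near=> y.
    have y0 : y < 0 by near: y; apply: lt_nbhsl; lra.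
    have y1 : y != 1 by rewrite lt_eqF //; lra.
    have yy : y - 1 != 0 by rewrite subr_eq0.
    rewrite /E -[limn (pseries c _)]/(limn (series (fun n => c n * (y - 1) ^+ n))).
    by rewrite (cvg_lim _ (hc y y1)) // mulrC mulKf.
  apply: (near_eq_is_derive ne).
  by apply: (drvE (drvM d2 d3)); rewrite e2 Em2; field.
have -> : 1 / 12 - derive1 zeta (-1) = (limn (pseries (pseries_diffs c) (-2)) + 1 / 4) / 2.
  by rewrite derive1E; case: hz' => _ ->; field.
rewrite (_ : glaisher = (fun n => (D n - B 4 / 12 * n.+1%:R ^- 2 + 1 / 4) / 2)); last first.
  by apply/funext => n; rewrite /D; move: (glaisher n) (B 4 / 12 * _) => a b; field.
apply: cvgMl; apply: cvgD; last exact: cvg_cst.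
rewrite -[X in _ --> X]subr0; apply: cvgB => //.
have hh : n.+1%:R^-1 @[n --> \oo] --> (0 : R) by exact: cvg_harmonic.
have -> : 0 = B 4 / 12 * (0 * 0) by rewrite !mulr0.
apply: cvgMr; under eq_cvg do rewrite -exprVn expr2.
exact: cvgM.
Unshelve. all: by end_near. Qed.
End ZetaDerivative.

(** * The logarithm of the Barnes function *)

Section Barnes.
Variable R : realType.
Local Notation B := (bernoulli R).

(** The k-th derivative in z of the logarithm of the factor n + 1 of the infinite
    product. *)
Definition bterm (k n : nat) (z : R) : R :=
  let m : R := n.+1%:R in
  match k with
  | 0%N => m * ln (1 + z / m) - z + z ^+ 2 / (2 * m)
  | 1%N => m / (m + z) - 1 + z / m
  | 2%N => - m / (m + z) ^+ 2 + m^-1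
  | j.+3 => (-1) ^+ j * j.+2`!%:R * m * (m + z) ^- j.+3
  end.

Lemma drv_invX (c : R) j (z : R) : c + z != 0 ->
  is_derive z 1 (fun y => (c + y) ^- j.+1) (- j.+1%:R * (c + z) ^- j.+2).
Proof.
move=> cz; have n0 : (c + z) ^+ j.+1 != 0 by rewrite expf_neq0.
have h := @drvV R (fun y => (c + y) ^+ j.+1) z _ n0 (drvX j.+1 (drvD (drv_cst c z) (drv_id z))).
apply: (drvE h); rewrite [0 + 1]add0r mulr1 -[j.+1.-1]/j -mulNr -mulrA; congr (_ * _).
by rewrite !exprS; field; rewrite cz expf_neq0.
Qed.

Lemma drv_bterm k n (z : R) : 0 <= z -> is_derive z 1 (bterm k n) (bterm k.+1 n z).
Proof.
move=> z0; have m0 : 0 < n.+1%:R :> R by rewrite ltr0n.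
have mz : n.+1%:R + z != 0 by apply: lt0r_neq0; rewrite ltr_wpDr.
have mn : n.+1%:R != 0 :> R by rewrite gt_eqF.
case: k => [|[|[|j]]] /=.
- have p0 : 0 < 1 + z / n.+1%:R by rewrite ltr_wpDr // divr_ge0 // ltW.
  have h1 := @drv_ln R (fun y => 1 + y / n.+1%:R) z _ p0 (drvD (drv_cst 1 z) (drvM (drv_id z)
      (drv_cst n.+1%:R^-1 z))).
  have h := drvD (drvD (drvM (drv_cst n.+1%:R z) h1) (drvN (drv_id z)))
     (drvM (drvX 2 (drv_id z)) (drv_cst (2 * n.+1%:R)^-1 z)).
  apply: (drvE h); rewrite /=.
  move: (n.+1%:R : R) m0 mz mn {h1 h} p0 => m m0 mz mn p0.
  by field; rewrite ?mn ?mz.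
- have h1 := @drv_invX n.+1%:R 0 z mz.
  have h := drvD (drvD (drvM (drv_cst n.+1%:R z) h1) (drv_cst (-1) z))
    (drvM (drv_id z) (drv_cst n.+1%:R^-1 z)).
  by apply: (drvE h); rewrite mul0r add0r addr0 mul1r mulr0 addr0 mulN1r mulrN mulNr.
- have h := drvD (drvM (drv_cst (- n.+1%:R) z) (@drv_invX n.+1%:R 1 z mz)) (drv_cst n.+1%:R^-1 z).
  apply: (drvE h); rewrite mul0r add0r addr0 expr0 mul1r mulrA mulrNN.
  by rewrite [2`!]/= [_ * 2]mulrC.
- have h := drvM (drv_cst ((-1) ^+ j * j.+2`!%:R * n.+1%:R) z) (@drv_invX n.+1%:R j.+2 z mz).
  apply: (drvE h); rewrite mul0r add0r [(-1) ^+ j.+1]exprS [j.+3`!]factS natrM.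
  by ring.
Qed.

Lemma mvt0_bound (f g : R -> R) (z M : R) : 0 <= z -> f 0 = 0 ->
  (forall y, 0 <= y <= z -> is_derive y 1 f (g y)) ->
  (forall y, 0 <= y <= z -> `|g y| <= M) -> `|f z| <= M * z.
Proof.
rewrite le_eqVlt => /orP[/eqP <-|z0] f0 d b.
  by rewrite f0 normr0 mulr0.
have [c /andP[c0 cz] e] := mvt z0 d.
move: e; rewrite f0 !subr0 => ->; rewrite normrM (gtr0_norm z0) ler_wpM2r ?(ltW z0) //.
by apply: b; rewrite !ltW.
Qed.

Definition bconst (k : nat) : R := 2 * k`!%:R.

(** The exponential factors of the product remove the Taylor polynomial of order
    two at z = 0: the third derivative is O(m^-2), and integrating it three times
    from 0 bounds the lower ones. *)
Lemma bterm_bound k n (z : R) : 0 <= z ->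
  `|bterm k n z| <= bconst k * (1 + z) ^+ 3 / n.+1%:R ^+ 2.
Proof.
have m0 : 0 < n.+1%:R :> R by rewrite ltr0n.
have mn : n.+1%:R != 0 :> R by rewrite gt_eqF.
have h3 j y : 0 <= y -> `|bterm j.+3 n y| <= j.+2`!%:R / n.+1%:R ^+ 2.
  move=> y0 /=; rewrite !normrM normrX normrN1 expr1n mul1r ger0_norm // -mulrA.
  rewrite ler_wpM2l //.
  have mz0 : 0 < n.+1%:R + y by rewrite ltr_wpDr.
  have m1 : 1 <= n.+1%:R :> R by rewrite ler1n.
  rewrite (ger0_norm (ltW m0)) normfV normrX (ger0_norm (ltW mz0)).
  apply: le_trans (_ : n.+1%:R * n.+1%:R ^- 3 <= _).
    rewrite ler_wpM2l ?(ltW m0) // lef_pV2 ?posrE ?exprn_gt0 //.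
    apply: le_trans (_ : n.+1%:R ^+ j.+3 <= _); first by rewrite ler_weXn2l.
    by apply: lerXn2r; rewrite ?nnegrE ?lerDl // ltW.
  by rewrite exprS invfM mulrA mulfV // mul1r.
have i2 : 0 <= n.+1%:R ^- 2 :> R by rewrite invr_ge0 exprn_ge0.
have h2 y : 0 <= y -> `|bterm 2 n y| <= 2 / n.+1%:R ^+ 2 * y.
  move=> y0; apply: (@mvt0_bound _ (bterm 3 n)) => //.
  - by rewrite /= addr0; field.
  - by move=> x /andP[x0 _]; apply: drv_bterm.
  - by move=> x /andP[x0 _]; apply: h3.
have h1 y : 0 <= y -> `|bterm 1 n y| <= 2 / n.+1%:R ^+ 2 * y * y.
  move=> y0; apply: (@mvt0_bound _ (bterm 2 n)) => //.
  - by rewrite /= addr0 mul0r addr0 mulfV // subrr.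
  - by move=> x /andP[x0 _]; apply: drv_bterm.
  - move=> x /andP[x0 xy]; apply: le_trans (h2 x x0) _.
    by rewrite ler_wpM2l // mulr_ge0.
have h0 y : 0 <= y -> `|bterm 0 n y| <= 2 / n.+1%:R ^+ 2 * y * y * y.
  move=> y0; apply: (@mvt0_bound _ (bterm 1 n)) => //.
  - by rewrite /= mul0r addr0 ln1 mulr0 expr0n /= mul0r subrr addr0.
  - by move=> x /andP[x0 _]; apply: drv_bterm.
  - move=> x /andP[x0 xy]; apply: le_trans (h1 x x0) _.
    by rewrite -!mulrA ler_wpM2l // ler_wpM2l // ler_pM.
move=> z0; have c : forall a : R, 0 <= a -> a <= k`!%:R * (1 + z) ^+ 3 -> 2 / n.+1%:R ^+ 2 * a <=
    bconst k * (1 + z) ^+ 3 / n.+1%:R ^+ 2.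
  by move=> a a0 ha; rewrite /bconst mulrAC ler_wpM2r // -mulrA ler_wpM2l.
have e3 : (1 + z) ^+ 3 = 1 + 3 * z + 3 * z ^+ 2 + z ^+ 3 by ring.
have z2 : 0 <= z ^+ 2 by rewrite exprn_ge0.
have z3 : 0 <= z ^+ 3 by rewrite exprn_ge0.
case: k c => [|[|[|j]]] c.
- apply: le_trans (h0 z z0) _.
  rewrite (_ : _ * z * z * z = 2 / n.+1%:R ^+ 2 * (z * z * z)); last by rewrite !mulrA.
  apply: c.
    by rewrite !mulr_ge0.
  by rewrite mul1r e3 (_ : z * z * z = z ^+ 3) ?(exprSr z 2) ?expr2 //; lra.
- apply: le_trans (h1 z z0) _.
  rewrite (_ : _ * z * z = 2 / n.+1%:R ^+ 2 * (z * z)); last by rewrite !mulrA.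
  apply: c.
    by rewrite !mulr_ge0.
  by rewrite mul1r e3 -expr2; lra.
- apply: le_trans (h2 z z0) _; apply: c => //.
  by rewrite e3 (_ : 2`! = 2%N) //; lra.
- apply: le_trans (h3 j z z0) _.
  have f1 : j.+2`!%:R <= j.+3`!%:R :> R by rewrite ler_nat factS leq_pmull.
  have f0 : 0 <= j.+3`!%:R :> R by [].
  rewrite ler_wpM2r // /bconst; apply: le_trans f1 _.
  rewrite [2 * _]mulrC -mulrA ler_peMr // e3; lra.
Qed.

Definition bsum (k : nat) (z : R) : R := limn (fun N => \sum_(n < N) bterm k n z).

Lemma bsum_cvg k z : 0 <= z -> \sum_(n < N) bterm k n z @[N --> \oo] --> bsum k z.
Proof.
by move=> z0; exact: (abs_cvg_sum (fun n => bterm_bound k n z0)).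
Qed.

Lemma bpartial_bound k N (z : R) : 0 <= z ->
  `|\sum_(n < N) bterm k n z| <= 2 * (bconst k * (1 + z) ^+ 3).
Proof.
move=> z0; have := @bound_of_diff R (fun N => \sum_(n < N) bterm k n z) (bconst k * (1 + z) ^+ 3) N.
rewrite big_ord0 normr0 add0r; apply=> n.
by rewrite big_ord_recr /= addrAC subrr add0r; apply: bterm_bound.
Qed.

Lemma bsum_bound k (z : R) : 0 <= z -> `|bsum k z| <= 2 * (bconst k * (1 + z) ^+ 3).
Proof.
move=> z0; have c := cvg_norm (@bsum_cvg k z z0).
by apply: (cvgr_to_le (c _)); near=> N; apply: bpartial_bound.
Unshelve. all: by end_near. Qed.

Lemma drv_bsum k (z : R) : 0 < z -> is_derive z 1 (bsum k) (bsum k.+1 z).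
Proof.
move=> z0.
have yy (y : R) : `|y - z| < z -> 0 <= y <= 2 * z.
  by rewrite ltr_norml => /andP[? ?]; lra.
apply: (@is_derive_lim R (fun N y => \sum_(n < N) bterm k n y) (fun N y => \sum_(n < N)
    bterm k.+1 n y)
  (fun N y => \sum_(n < N) bterm k.+2 n y) (bsum k) (bsum k.+1) z (2 * (bconst k.+2 * (1 + 2 * z)
      ^+ 3)) z) => //.
- by move=> y /yy /andP[y0 _]; apply: bsum_cvg.
- by apply: bsum_cvg; apply: ltW.
- move=> N y /yy /andP[y0 _].
  exact: (drv_sum (index_enum _) (fun (n : 'I_N) (_ : true) => @drv_bterm k n y y0)).
- move=> N y /yy /andP[y0 _].
  exact: (drv_sum (index_enum _) (fun (n : 'I_N) (_ : true) => @drv_bterm k.+1 n y y0)).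
- move=> N y /yy /andP[y0 y2]; apply: le_trans (bpartial_bound _ _ y0) _.
  rewrite ler_wpM2l // ler_wpM2l ?mulr_ge0 //.
  by apply: lerXn2r; rewrite ?nnegrE; lra.
Qed.

(** The elementary factors of the Barnes function contribute a quadratic
    polynomial to its logarithm. *)
Definition bpoly : {poly R} :=
  ((ln (2 * pi) - 1) / 2)%:P * 'X - ((1 + euler_mascheroni R) / 2)%:P * 'X^2.

Lemma ln_barnesG (z : R) : 0 <= z -> ln (barnesG (z + 1)) = bpoly.[z] + bsum 0 z.
Proof.
move=> z0; rewrite /barnesG addrK.
have -> : lim (\prod_(1 <= n < m.+1) ((1 + z / n%:R) ^+ n * expR (- z + z ^+ 2 / (2 * n%:R)))
    @[m --> \oo])
  = expR (bsum 0 z).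
  apply/cvg_lim => //.
  rewrite (_ : (fun m => _) = (fun m => expR (\sum_(n < m) bterm 0 n z))).
    by apply: continuous_cvg; [exact: continuous_expR | exact: bsum_cvg].
  apply/funext => m; rewrite expR_sum big_add1 /= big_mkord; apply: eq_bigr => n _.
  by rewrite /bterm /= -[in RHS]addrA [RHS]expRD expRM_natl lnK // posrE ltr_wpDr // divr_ge0.
rewrite /powR gt_eqF ?mulr_gt0 ?pi_gt0 // -!expRD expRK; congr (_ + _).
by rewrite /bpoly hornerD hornerN !hornerCM hornerX hornerXn; field.
Qed.

(** The n-th derivative of log G(z + 1), by term-by-term differentiation. *)
Definition lnG (n : nat) (z : R) : R := (bpoly^`(n)).[z] + bsum n z.

Lemma drv_lnG n (z : R) : 0 < z -> is_derive z 1 (lnG n) (lnG n.+1 z).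
Proof.
move=> z0; have h := drvD (drv_horner (bpoly^`(n)) (drv_id z)) (drv_bsum n z0).
by apply: (drvE h); rewrite mulr1 /lnG derivnS.
Qed.

Lemma derive1n_ln_barnesG n (z : R) : 0 < z ->
  derive1n n (fun t => ln (barnesG (t + 1))) z = lnG n z.
Proof.
elim: n z => [|n IH] z z0; first by rewrite /= ln_barnesG ?ltW.
rewrite [LHS]/= -/(derive1n n _) derive1E.
rewrite (@near_eq_derive _ _ _ _ (lnG n)); first by case: (drv_lnG n z0).
by near=> y; apply: IH; near: y; apply: lt_nbhsr.
Unshelve. all: by end_near. Qed.

Lemma lnG_bound n : exists C : R, forall z, 1 <= z -> `|lnG n.+2 z| <= C * z ^+ 3.
Proof.
have [c hc] : exists c : R, bpoly^`(n.+2) = c%:P.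
  exists (bpoly^`(n.+2))`_0; apply/polyP => -[|i]; rewrite coefC; first by [].
  rewrite coef_derivn.
  suff -> : bpoly`_(n.+2 + i.+1) = 0 by rewrite mul0rn.
  by rewrite /bpoly coefB !coefCM coefX coefXn addSn addSn addnS !mulr0 subrr.
exists (`|c| + 16 * bconst n.+2) => z z1; rewrite /lnG hc hornerC.
have z0 : 0 <= z by lra.
have z3 : 1 <= z ^+ 3 by rewrite exprn_ege1.
have b0 : 0 <= bconst n.+2 by rewrite mulr_ge0.
apply: le_trans (ler_normD _ _) _; rewrite mulrDl; apply: lerD; first by rewrite ler_peMr.
apply: le_trans (bsum_bound _ z0) _.
have h : (1 + z) ^+ 3 <= 8 * z ^+ 3.
  have -> : 8 * z ^+ 3 = (2 * z) ^+ 3 by ring.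
  by apply: lerXn2r; rewrite ?nnegrE; lra.
have -> : 16 * bconst n.+2 * z ^+ 3 = 2 * (bconst n.+2 * (8 * z ^+ 3)) by ring.
by rewrite ler_wpM2l // ler_wpM2l.
Qed.
End Barnes.

(** * Asymptotics of the Barnes function *)

Section BarnesEM.
Variable R : realType.
Local Notation B := (bernoulli R).

Lemma ln1p_bound (x : R) : 0 <= x -> 0 <= ln (1 + x) <= x.
Proof.
by move=> x0; rewrite ln_ge0 ?lerDl //= le_ln1Dx //; lra.
Qed.

Lemma ln1p_taylor2 (x : R) : 0 <= x -> `|ln (1 + x) - x + x ^+ 2 / 2| <= x ^+ 3.
Proof.
move=> x0.
have -> : x ^+ 3 = x ^+ 2 * x by rewrite -exprSr.
apply: (@mvt0_bound R (fun x => ln (1 + x) - x + x ^+ 2 / 2) (fun y => y ^+ 2 / (1 + y))) => //.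
- by rewrite addr0 ln1 subr0 expr0n /= mul0r addr0.
- move=> y /andP[y0 _]; have p0 : 0 < 1 + y by lra.
  have h := drvD (drvD (@drv_ln R (fun y => 1 + y) y _ p0 (drvD (drv_cst 1 y) (drv_id y))) (drvN
      (drv_id y)))
     (drvM (drvX 2 (drv_id y)) (drv_cst 2^-1 y)).
  by apply: (drvE h) => /=; field; rewrite gt_eqF.
- move=> y /andP[y0 yx]; rewrite ger0_norm ?divr_ge0 ?exprn_ge0 //; last lra.
  rewrite ler_pdivrMr; last lra.
  apply: le_trans (_ : x ^+ 2 <= _); last by rewrite ler_peMr ?exprn_ge0 //; lra.
  by apply: lerXn2r; rewrite ?nnegrE.
Qed.

Lemma cvg_euler_mascheroni :
  \sum_(k < n) k.+1%:R^-1 - ln n.+1%:R @[n --> \oo] --> euler_mascheroni R.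
Proof.
pose u n : R := \sum_(k < n) k.+1%:R^-1 - ln n.+1%:R.
have du n : `|u n.+1 - u n| <= 2 / n.+1%:R ^+ 2.
  have n0 : 0 < n.+1%:R :> R by rewrite ltr0n.
  have x0 : 0 <= n.+1%:R^-1 :> R by rewrite invr_ge0 ltW.
  have -> : u n.+1 - u n = n.+1%:R^-1 - ln (1 + n.+1%:R^-1).
    have -> : 1 + n.+1%:R^-1 = n.+2%:R / n.+1%:R :> R.
      by rewrite -[n.+2%:R]natr1 mulrDl mul1r mulfV ?gt_eqF.
    rewrite ln_div ?posrE ?ltr0n // /u big_ord_recr /=; ring.
  have := ln1p_taylor2 x0; rewrite -exprVn.
  have x1 : n.+1%:R^-1 <= 1 :> R by rewrite invf_le1 // ler1n.
  move: (n.+1%:R^-1 : R) x0 x1 => x x0 x1.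
  have x3 : x ^+ 3 <= x ^+ 2 by rewrite exprS ler_piMl ?exprn_ge0.
  have x2 : 0 <= x ^+ 2 by rewrite exprn_ge0.
  by rewrite !ler_norml => /andP[h1 h2]; apply/andP; split; lra.
have cu := cvg_of_diff du.
have h : \sum_(1 <= k < n.+1) k%:R^-1 - ln n%:R @[n --> \oo] --> (limn u : R).
  rewrite -cvg_shiftS /=.
  rewrite (_ : (fun n : nat => _) = (fun n => u n + n.+1%:R^-1)).
    by rewrite -[limn u]addr0; apply: cvgD => //; exact: cvg_harmonic.
  by apply/funext => n; rewrite /u big_add1 /= big_mkord big_ord_recr /=; ring.
by rewrite /euler_mascheroni (cvg_lim _ h).
Qed.

(** The function (u - z) ln u, its antiderivative (index 0) and its derivatives.
    At u = z + m it is m ln (z + m), the essential part of the summands of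
    log G(z + 1). *)
Definition hder (z : R) (j : nat) (u : R) : R :=
  match j with
  | 0%N => (u ^+ 2 / 2 - z * u) * ln u - u ^+ 2 / 4 + z * u
  | 1%N => (u - z) * ln u
  | 2%N => ln u + 1 - z / u
  | i.+3 => (-1) ^+ i * (i`!%:R * u ^- i.+1 + z * (i.+1`!%:R * u ^- i.+2))
  end.

Lemma drv_hder z j (u : R) : 0 < u -> is_derive u 1 (hder z j) (hder z j.+1 u).
Proof.
move=> u0; have un : u != 0 by rewrite gt_eqF.
have dl := @drv_ln R (fun u => u) u _ u0 (drv_id u).
have di k : is_derive u 1 (fun y => y ^- k.+1) (- k.+1%:R * u ^- k.+2).
  have h := @drv_invX R 0 k u; rewrite add0r in h.
  by apply: (drv_eq _ (h un)) => y; rewrite add0r.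
case: j => [|[|[|i]]] /=.
- have dx := drv_id u.
  have h := drvD (drvD (drvM (drvD (drvM (drvX 2 dx) (drv_cst 2^-1 u)) (drvN (drvM (drv_cst z u)
      dx))) dl)
    (drvN (drvM (drvX 2 dx) (drv_cst 4^-1 u)))) (drvM (drv_cst z u) dx).
  by apply: (drvE h) => /=; field.
- have h := drvM (drvD (drv_id u) (drv_cst (- z) u)) dl.
  by apply: (drvE h) => /=; field.
- have h := drvD (drvD dl (drv_cst 1 u)) (drvN (drvM (drv_cst z u) (di 0%N))).
  by apply: (drvE h) => /=; rewrite fact0 (_ : 1`! = 1%N) //; field.
- have h := drvM (drv_cst ((-1) ^+ i) u) (drvD (drvM (drv_cst i`!%:R u) (di i))
    (drvM (drv_cst z u) (drvM (drv_cst i.+1`!%:R u) (di i.+1)))).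
  apply: (drvE h) => /=; rewrite !mul0r !add0r [(-1) ^+ i.+1]exprS.
  by rewrite [i.+2`!]factS [in RHS](factS i) !natrM; ring.
Qed.

(** The antiderivative of (u - z) ln u corrected by Bernoulli terms, so that its
    increments from u to u + 1 approximate the function at u. *)
Definition hsum (z : R) (q : nat) (u : R) : R := \sum_(j < q.+4) B j / j`!%:R * hder z j u.

Lemma hder_bound z i (u : R) : 0 <= z <= u -> 0 < u ->
  `|hder z i.+3 u| <= 2 * i.+1`!%:R * u ^- i.+1.
Proof.
move=> /andP[z0 zu] u0; rewrite /= normrM normrX normrN1 expr1n mul1r.
have un : u != 0 by rewrite gt_eqF.
have iu : 0 <= u ^- i.+1 by rewrite invr_ge0 exprn_ge0 // ltW.
have f1 : i`!%:R <= i.+1`!%:R :> R by rewrite ler_nat factS leq_pmull.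
have e : z * (i.+1`!%:R * u ^- i.+2) <= i.+1`!%:R * u ^- i.+1.
  rewrite mulrCA ler_wpM2l // [u ^+ i.+2]exprS invfM mulrA ler_piMl //.
  by rewrite ler_pdivrMr // mul1r.
have e0 : 0 <= z * (i.+1`!%:R * u ^- i.+2).
  by rewrite !mulr_ge0 // invr_ge0 exprn_ge0 // ltW.
have e1 := ler_wpM2r iu f1.
rewrite ger0_norm; last by apply: addr_ge0 => //; apply: mulr_ge0.
rewrite (_ : 2 * i.+1`!%:R * u ^- i.+1 = i.+1`!%:R * u ^- i.+1 + i.+1`!%:R * u ^- i.+1);
    last by ring.
exact: lerD.
Qed.

(** The remainders on the intervals [z + n, z + n + 1] are summed from z on, which
    makes the bound uniform in the number of terms. *)
Lemma hsum_em q : exists2 C : R, 0 <= C & forall z N, 1 <= z ->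
  `|\sum_(n < N) n%:R * ln (z + n%:R) - (hsum z q (z + N%:R) - hsum z q z)| <= C * z ^- q.+1.
Proof.
exists (2 * (em_const R q.+3 * (2 * q.+2`!%:R))).
  by rewrite !mulr_ge0 // /em_const sumr_ge0 // => i _; rewrite divr_ge0.
move=> z N z1; have z0 : 0 < z by lra.
have step n : `|hsum z q (z + n.+1%:R) - hsum z q (z + n%:R) - n%:R * ln (z + n%:R)|
    <= em_const R q.+3 * (2 * q.+2`!%:R) * (z + n%:R) ^- q.+2.
  have u0 : 0 < z + n%:R by rewrite ltr_wpDr.
  have [|t /andP[t1 t2] ht] := @euler_maclaurin R (hder z) q.+2 (z + n%:R).
    by move=> j t _ /andP[tn _]; apply: drv_hder; apply: lt_le_trans tn.
  have -> : hsum z q (z + n.+1%:R) - hsum z q (z + n%:R) - n%:R * ln (z + n%:R)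
   = \sum_(j < q.+4) B j / j`!%:R * (hder z j (z + n%:R + 1) - hder z j (z + n%:R)) - hder z 1
       (z + n%:R).
    under [in RHS]eq_bigr => j _ do rewrite mulrBr.
    have h1 : hder z 1 (z + n%:R) = n%:R * ln (z + n%:R) by rewrite /= addrAC subrr add0r.
    by rewrite sumrB h1 -[z + n%:R + 1]addrA natr1.
  have t0 : 0 < t by apply: lt_le_trans t1.
  apply: le_trans ht _; rewrite -mulrA ler_wpM2l //.
    by rewrite /em_const sumr_ge0 // => i _; rewrite divr_ge0.
  have zt : 0 <= z <= t by apply/andP; split; [lra | apply: le_trans t1; rewrite lerDl].
  apply: le_trans (hder_bound q.+1 zt t0) _; rewrite ler_wpM2l ?mulr_ge0 //.
  rewrite lef_pV2 ?posrE ?exprn_gt0 //.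
  by apply: lerXn2r; rewrite ?nnegrE // ltW.
have -> : \sum_(n < N) n%:R * ln (z + n%:R) - (hsum z q (z + N%:R) - hsum z q z)
  = - \sum_(n < N) (hsum z q (z + n.+1%:R) - hsum z q (z + n%:R) - n%:R * ln (z + n%:R)).
  rewrite sumrB -(sum_telescope (fun n => hsum z q (z + n%:R))) addr0; ring.
rewrite normrN; apply: le_trans (ler_norm_sum _ _ _) _.
apply: le_trans (_ : \sum_(n < N) em_const R q.+3 * (2 * q.+2`!%:R) * (z + n%:R) ^- q.+2 <= _).
  by apply: ler_sum => n _.
have c0 : 0 <= em_const R q.+3 * (2 * q.+2`!%:R).
  by rewrite !mulr_ge0 // /em_const sumr_ge0 // => i _; rewrite divr_ge0.
rewrite -mulr_sumr; move: (em_const R q.+3 * _) c0 => c c0.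
apply: le_trans (ler_wpM2l c0 (sum_inv_pow q N z1)) _.
by rewrite mulrA [c * 2]mulrC.
Qed.

(** The upper end of the summation, after removal of the terms that diverge with
    n. These are compensated by the factors exp(-z + z^2/(2n)), by the sum of
    m ln m and by the harmonic sum. *)
Lemma hsum_end (q : nat) (z : R) : 0 <= z ->
  hsum z q (z + n.+1%:R) - (n.+1%:R ^+ 2 / 2 - n.+1%:R / 2 + 1 / 12) * ln n.+1%:R
    + n.+1%:R ^+ 2 / 4 - n%:R * z + z ^+ 2 / 2 * ln n.+1%:R @[n --> \oo] -->
  z ^+ 2 / 2 + z / 2 + 1 / 12.
Proof.
move=> z0.
pose K := \sum_(i < q.+1) `|B i.+3 / i.+3`!%:R| * (2 * i.+1`!%:R).
pose M := z ^+ 3 + z ^+ 2 + (1 + z ^+ 2) * z + z + K.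
have hh : n.+1%:R^-1 @[n --> \oo] --> (0 : R) by exact: cvg_harmonic.
have hM : M * n.+1%:R^-1 @[n --> \oo] --> (0 : R).
  by rewrite -[0](mulr0 M); apply: cvgMr.
rewrite -subr_cvg0.
apply: cvg0_bound hM => n.
have N1 : 1 <= n.+1%:R :> R by rewrite ler1n.
have e : n%:R = n.+1%:R - 1 :> R by rewrite -natr1 addrK.
rewrite e; move: (n.+1%:R : R) N1 => N N1 {e}.
have N0 : 0 < N by lra.
have Nn : N != 0 by rewrite gt_eqF.
have t0 : 0 < z + N by lra.
have lnt : ln (z + N) = ln N + ln (1 + z / N).
  rewrite -lnM ?posrE // ?ltr_wpDr ?divr_ge0 ?(ltW N0) //.
  by congr ln; field.
have zN : 0 <= z / N by rewrite divr_ge0 // ltW.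
have /andP[l0 l1] := ln1p_bound zN.
have l2 := ln1p_taylor2 zN.
set l := ln (1 + z / N) in lnt l0 l1 l2.
pose eps := l - z / N + (z / N) ^+ 2 / 2.
pose tail := \sum_(i < q.+1) B i.+3 / i.+3`!%:R * hder z i.+3 (z + N).
have tb : `|tail| <= K / N.
  rewrite mulr_suml; apply: le_trans (ler_norm_sum _ _ _) _; apply: ler_sum => i _.
  rewrite normrM -mulrA ler_wpM2l //.
  have zz : 0 <= z <= z + N by lra.
  apply: le_trans (hder_bound i zz t0) _; rewrite ler_wpM2l ?mulr_ge0 //.
  rewrite lef_pV2 ?posrE ?exprn_gt0 //; apply: le_trans (_ : z + N <= _); first lra.
  by rewrite exprS ler_peMr ?(ltW t0) // exprn_ege1 //; lra.
have -> : hsum z q (z + N) = hder z 0 (z + N) - hder z 1 (z + N) / 2 + hder z 2 (z + N) / 12 + tail.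
  rewrite /hsum !(big_ord_recl q.+3) !(big_ord_recl q.+2) !(big_ord_recl q.+1).
  rewrite (eq_bigr (fun i : 'I_q.+1 => B i.+3 / i.+3`!%:R * hder z i.+3 (z + N))) // -/tail.
  rewrite [nat_of_ord ord0]/= [nat_of_ord (lift ord0 ord0)]/= [nat_of_ord (lift ord0
      (lift ord0 ord0))]/=.
  rewrite (_ : B 0 = 1) // bernoulli1 bernoulli2 fact0 (_ : 1`! = 1%N) // (_ : 2`! = 2%N) //.
  move: (hder z 0 _) (hder z 1 _) (hder z 2 _) => a b c; by field.
have -> : hder z 0 (z + N) - hder z 1 (z + N) / 2 + hder z 2 (z + N) / 12 + tail -
  (N ^+ 2 / 2 - N / 2 + 1 / 12) * ln N + N ^+ 2 / 4 - (N - 1) * z + z ^+ 2 / 2 * ln N -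
  (z ^+ 2 / 2 + z / 2 + 1 / 12) =
  N ^+ 2 * eps / 2 + z ^+ 2 / 4 / N - N * eps / 2 + (1 / 12 - z ^+ 2 / 2) * l - z / 12 / (z + N)
      + tail.
  rewrite /hder lnt /eps; field.
  by rewrite Nn gt_eqF.
have i0 : 0 <= N^-1 by rewrite invr_ge0 ltW.
have b1 : `|N ^+ 2 * eps / 2| <= z ^+ 3 / N * (1 / 2).
  have : `|N ^+ 2 * eps| <= N ^+ 2 * (z / N) ^+ 3.
    by rewrite normrM ger0_norm ?exprn_ge0 ?(ltW N0) // ler_wpM2l // exprn_ge0 // ltW.
  rewrite (_ : N ^+ 2 * (z / N) ^+ 3 = z ^+ 3 / N); last by field.
  have := normr_ge0 (N ^+ 2 * eps); rewrite [`|_ / 2|]normrM (ger0_norm (_ : 0 <= 2^-1 :> R)); lra.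
have b2 : `|N * eps / 2| <= z ^+ 3 / N * (1 / 2).
  have : `|N * eps| <= N * (z / N) ^+ 3.
    by rewrite normrM ger0_norm ?(ltW N0) // ler_wpM2l // ltW.
  have : N * (z / N) ^+ 3 <= z ^+ 3 / N.
    rewrite (_ : N * (z / N) ^+ 3 = z ^+ 3 / N * N^-1); last by field.
    by rewrite ler_piMr ?invf_le1 // mulr_ge0 // exprn_ge0.
  rewrite [`|_ / 2|]normrM (ger0_norm (_ : 0 <= 2^-1 :> R)); lra.
have b3 : `|z ^+ 2 / 4 / N| <= z ^+ 2 / N.
  have h : 0 <= z ^+ 2 / N by rewrite mulr_ge0 // exprn_ge0.
  by rewrite (_ : z ^+ 2 / 4 / N = z ^+ 2 / N / 4) ?ger0_norm; [lra | lra | ring].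
have b4 : `|(1 / 12 - z ^+ 2 / 2) * l| <= (1 + z ^+ 2) * z / N.
  rewrite normrM -mulrA; apply: ler_pM => //; last by rewrite ger0_norm.
  have := exprn_ge0 2 z0; rewrite ler_norml => h; apply/andP; split; lra.
have b5 : `|z / 12 / (z + N)| <= z / N.
  rewrite ger0_norm; last by rewrite !divr_ge0 // ltW.
  apply: le_trans (_ : z / (z + N) <= _).
    by rewrite ler_wpM2r ?invr_ge0 ?(ltW t0) //; lra.
  by rewrite ler_wpM2l // lef_pV2 ?posrE //; lra.
rewrite /M !mulrDl ler_norml.
move: b1 b2 b3 b4 b5 tb; rewrite !ler_norml !mulrDl => /andP[? ?] /andP[? ?] /andP[? ?] /andP[?
    ?] /andP[? ?] /andP[? ?].
by apply/andP; split; lra.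
Qed.
End BarnesEM.

(** * Differentiating asymptotic expansions *)

Section Asymptotics.
Variable R : realType.
Implicit Types (f : R -> R) (a : nat -> R).

(** Asymptotic expansions with an explicit O-remainder, which, unlike the limit in
    [asymptotic_expansion], can be used at two neighbouring points with the same
    constants. *)
Definition expansion f a := forall n : nat, exists C z0 : R, forall z, z0 <= z -> 1 <= z ->
  `|f z - \sum_(k < n.+1) a k * z ^- k| <= C * z ^- n.+1.

Lemma expansion_asymptotic f a : expansion f a -> asymptotic_expansion f a.
Proof.
move=> fa n; have [C [z0 h]] := fa n.
apply/cvgrPdist_lt => e e0; near=> z.
have z1 : 1 <= z by near: z; apply: nbhs_pinfty_ge; rewrite num_real.
have zz0 : z0 <= z by near: z; apply: nbhs_pinfty_ge; rewrite num_real.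
have zC : C / e < z by near: z; apply: nbhs_pinfty_gt; rewrite num_real.
have z_gt0 : 0 < z by lra.
rewrite sub0r normrN normrM (ger0_norm (_ : 0 <= z ^+ n)) ?exprn_ge0 ?ltW //.
have zp : 0 <= z ^+ n by rewrite exprn_ge0 // ltW.
have := ler_wpM2l zp (h z zz0 z1).
have -> : z ^+ n * (C * z ^- n.+1) = C / z.
  by rewrite exprSr; field; rewrite expf_neq0 gt_eqF.
by move=> hz; apply: le_lt_trans hz _; rewrite ltr_pdivrMr // mulrC -ltr_pdivrMr.
Unshelve. all: by end_near. Qed.

Lemma expansion_eq f g a : (forall z, 1 <= z -> f z = g z) -> expansion f a -> expansion g a.
Proof.
move=> fg fa n; have [C [z0 h]] := fa n; exists C, z0 => z zz0 z1.
by rewrite -fg //; apply: h.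
Qed.

Lemma expansionZ f a (c : R) : expansion f a -> expansion (fun z => c * f z) (fun k => c * a k).
Proof.
move=> fa n; have [C [z0 h]] := fa n; exists (`|c| * C), z0 => z zz0 z1.
under eq_bigr => k _ do rewrite -mulrA.
by rewrite -mulr_sumr -mulrBr normrM -mulrA ler_wpM2l // h.
Qed.

Lemma expansion_invX f a (c : R) : expansion f a ->
  expansion (fun z => f z + c / z) (fun k => a k + c * (k == 1%N)%:R).
Proof.
move=> fa n; have [C [z0 h]] := fa n.
case: n h => [|n] h.
  exists (C + `|c|), z0 => z zz0 z1; have := h z zz0 z1.
  rewrite !big_ord1 /= mulr0 addr0 expr1 => h'.
  rewrite addrAC mulrDl; apply: le_trans (ler_normD _ _) _; apply: lerD => //.
  by rewrite normrM normfV (ger0_norm (_ : 0 <= z)) //; lra.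
exists C, z0 => z zz0 z1; have := h z zz0 z1; congr (`|_| <= _).
under [in RHS]eq_bigr => k _ do rewrite mulrDl.
have e : \sum_(k < n.+2) c * (k == 1%N :> nat)%:R / z ^+ k = c / z.
  rewrite (bigD1 (Ordinal (isT : 1 < n.+2)%N)) //= big1 ?addr0 ?mulr1 ?expr1 // => k /eqP k1.
  rewrite (_ : (k == 1%N :> nat) = false) ?mulr0 ?mul0r //.
  by apply/eqP => e; case: k1; apply: val_inj.
by rewrite big_split /= e; ring.
Qed.

(** The coefficients of the formal derivative of sum_k a_k z^-k. *)
Definition dcoef a (k : nat) : R := if k is j.+1 then - j%:R * a j else 0.

(** Asymptotic expansions cannot be differentiated in general, but here the
    second derivative has polynomial growth. The remainder r of order L then
    satisfies |r(z+h) - r(z) - h r'(z)| <= K z^M h^2, and dividing by the small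
    step h = z^-J makes r' as small as wanted, for J and L large enough. *)
Lemma expansion_derive f (f1 f2 : R -> R) a (C : R) (M : nat) :
  (forall z : R, 0 < z -> is_derive z 1 f (f1 z)) ->
  (forall z : R, 0 < z -> is_derive z 1 f1 (f2 z)) ->
  (forall z, 1 <= z -> `|f2 z| <= C * z ^+ M) ->
  expansion f a ->
  expansion f1 (dcoef a).
Proof.
move=> d1 d2 b2 fa n; pose b := dcoef a; rewrite -/b.
(* The two errors after division by h are of order z^(M-J) and z^(J-L-1). *)
pose J := (M + n.+1)%N; pose L := (J + n)%N.
have [C0 [z0 h0]] := fa L.
pose A : R := \sum_(k < L.+1) `|a k * (k%:R * k.+1%:R)|.
pose D : R := \sum_(n.+1 <= k < L.+2) `|b k|.
exists (2 * C0 + (C + A) * 2 ^+ M + D), (`|z0| + 2) => z zz0' z1'.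
have [zz0 z2] : z0 <= z /\ 2 <= z.
  by have := ler_norm z0; have := normr_ge0 z0; split; lra.
pose r (y : R) := f y - \sum_(k < L.+1) a k * y ^- k.
pose r1 (y : R) := f1 y - \sum_(k < L.+1) a k * (- k%:R * y ^- k.+1).
pose r2 (y : R) := f2 y - \sum_(k < L.+1) a k * (- k%:R * (- k.+1%:R * y ^- k.+2)).
have dinv k (y : R) : 0 < y -> is_derive y 1 (fun y => y ^- k) (- k%:R * y ^- k.+1).
  case: k => [|k] y0.
    by apply: (drv_eq _ (drvE (drv_cst 1 y) _)) => [x|]; rewrite ?expr0 ?invr1 // oppr0 mul0r.
  have h := @drv_invX R 0 k y; rewrite add0r in h.
  by apply: (drv_eq _ (h _)) => [x|]; rewrite ?add0r // gt_eqF.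
have dr (y : R) : 0 < y -> is_derive y 1 r (r1 y).
  move=> y0; apply: (drvD (d1 y y0)); apply: drvN.
  have h (k : 'I_L.+1) : true -> is_derive y 1 (fun y => a k * y ^- k) (a k * (- k%:R * y ^- k.+1)).
    by move=> _; apply: (drvE (drvM (drv_cst (a k) y) (dinv k y y0))); rewrite mul0r add0r.
  exact: (drv_sum (index_enum _) h).
have dr1 (y : R) : 0 < y -> is_derive y 1 r1 (r2 y).
  move=> y0; apply: (drvD (d2 y y0)); apply: drvN.
  have h (k : 'I_L.+1) : true -> is_derive y 1 (fun y => a k * (- k%:R * y ^- k.+1)) (a k *
      (- k%:R * (- k.+1%:R * y ^- k.+2))).
    move=> _; apply: (drvE (drvM (drv_cst (a k) y) (drvM (drv_cst (- k%:R) y) (dinv k.+1 y y0)))).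
    by rewrite !mul0r !add0r.
  exact: (drv_sum (index_enum _) h).
have A0 : 0 <= A by rewrite sumr_ge0.
have C_0 : 0 <= C by have := b2 1 (lexx _); rewrite expr1n mulr1; apply: le_trans.
have br2 (y : R) : 1 <= y -> `|r2 y| <= (C + A) * y ^+ M.
  move=> y1; apply: le_trans (ler_normB _ _) _; rewrite mulrDl; apply: lerD; first exact: b2.
  apply: le_trans (_ : A <= _); last by rewrite ler_peMr // exprn_ege1.
  apply: le_trans (ler_norm_sum _ _ _) _; apply: ler_sum => k _.
  rewrite (_ : a k * (- k%:R * (- k.+1%:R * y ^- k.+2)) = a k * (k%:R * k.+1%:R) * y ^- k.+2);
      last by ring.
  rewrite normrM ler_piMr // ger0_norm ?invr_ge0 ?exprn_ge0 //; last by lra.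
  by rewrite invf_le1 ?exprn_gt0 ?exprn_ege1 //; lra.
have z_gt0 : 0 < z by lra.
have zn : z != 0 by rewrite gt_eqF.
pose h := z ^- J.
have J0 : (0 < J)%N by rewrite /J; lia.
have h_gt0 : 0 < h by rewrite invr_gt0 exprn_gt0.
have h1 : h <= 1 by rewrite invf_le1 ?exprn_gt0 // exprn_ege1.
have hn : `|h| = h by rewrite gtr0_norm.
have yz (y : R) : `|y - z| <= `|h| -> 1 <= y <= 2 * z.
  by rewrite hn ler_norml => /andP[? ?]; apply/andP; split; lra.
have key := @mvt2 R r r1 r2 z h ((C + A) * (2 * z) ^+ M).
have {}key : `|r (h + z) - r z - h * r1 z| <= (C + A) * (2 * z) ^+ M * h ^+ 2.
  apply: key => y /yz /andP[y1 y2].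
  - by apply: dr; lra.
  - by apply: dr1; lra.
  - apply: le_trans (br2 y y1) _; rewrite ler_wpM2l ?addr_ge0 //.
    by apply: lerXn2r; rewrite ?nnegrE; lra.
have zhL : (h + z) ^- L.+1 <= z ^- L.+1.
  rewrite lef_pV2 ?posrE ?exprn_gt0 //; last lra.
  by apply: lerXn2r; rewrite ?nnegrE; lra.
have C0L : 0 <= C0.
  have := le_trans (normr_ge0 _) (h0 z zz0 z1').
  by rewrite pmulr_lge0 // invr_gt0 exprn_gt0.
have rb : `|r z| <= C0 * z ^- L.+1 by apply: h0 => //; lra.
have rhb : `|r (h + z)| <= C0 * z ^- L.+1.
  by apply: le_trans (h0 _ _ _) _; [lra | lra | rewrite ler_wpM2l].
have rz1 : `|r1 z| <= (2 * C0 + (C + A) * 2 ^+ M) * z ^- n.+1.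
  have e1 : `|h * r1 z| <= 2 * C0 * z ^- L.+1 + (C + A) * (2 * z) ^+ M * h ^+ 2.
    have -> : h * r1 z = (r (h + z) - r z) - (r (h + z) - r z - h * r1 z) by ring.
    apply: le_trans (ler_normB _ _) _; apply: lerD => //.
    by apply: le_trans (ler_normB _ _) _; lra.
  rewrite normrM hn -ler_pdivlMl // in e1; apply: le_trans e1 _.
  rewrite le_eqVlt; apply/orP; left; apply/eqP.
  rewrite /h /L /J exprMn !exprS !exprD !exprS; field.
  by rewrite ?expf_neq0 ?zn.
have -> : f1 z - \sum_(k < n.+1) b k * z ^- k = r1 z + \sum_(n.+1 <= k < L.+2) b k * z ^- k.
  have e2 : \sum_(0 <= k < L.+2) b k * z ^- k = \sum_(k < L.+1) a k * (- k%:R * z ^- k.+1).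
    rewrite big_nat_recl // mul0r add0r big_mkord; apply: eq_bigr => k _.
    by rewrite /b /dcoef; ring.
  have nL : (n.+1 <= L.+2)%N by apply: leq_trans (leqnSn _); rewrite ltnS leq_addl.
  have e3 := @big_cat_nat R 0 +%R n.+1 0 L.+2 predT (fun k => b k * z ^- k) (leq0n _) nL.
  have e4 : \sum_(k < n.+1) b k * z ^- k = \sum_(0 <= k < n.+1) b k * z ^- k by rewrite big_mkord.
  by rewrite /r1 -e2 e3 e4 opprD addrA subrK.
rewrite mulrDl; apply: le_trans (ler_normD _ _) _; apply: lerD => //.
apply: le_trans (ler_norm_sum _ _ _) _; rewrite mulr_suml big_nat [X in _ <= X]big_nat.
apply: ler_sum => k /andP[nk _]; rewrite normrM ler_wpM2l //.
rewrite ger0_norm ?invr_ge0 ?exprn_ge0 ?(ltW z_gt0) //.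
by rewrite lef_pV2 ?posrE ?exprn_gt0 // ler_weXn2l.
Qed.
End Asymptotics.

(** * The exponent of the integrand *)

Section BarnesExpansion.
Variable R : realType.
Local Notation B := (bernoulli R).

(** A partial sum is the remainder bounded in [hsum_em], plus the quantity of
    [hsum_end], minus that of [lim_deriv_zeta], plus z^2/2 times the one defining
    Euler's constant, minus hsum z q z: the diverging terms cancel. *)
Lemma bsum_em (zeta : R -> R) q : is_riemann_zeta zeta ->
  exists C : R, forall z, 1 <= z ->
  `|bsum 0 z - (z ^+ 2 / 2 + z / 2 + 1 / 12 - hsum z q z
      - (1 / 12 - derive1 zeta (-1)) + z ^+ 2 / 2 * euler_mascheroni R)| <= C * z ^- q.+1.
Proof.
move=> hz; have [C C0 hC] := @hsum_em R q; exists C => z z1.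
have z0 : 0 <= z by lra.
pose r N : R := \sum_(n < N) n%:R * ln (z + n%:R) - (hsum z q (z + N%:R) - hsum z q z).
have hr n : \sum_(i < n) bterm 0 i z - ((hsum z q (z + n.+1%:R) - (n.+1%:R ^+ 2 / 2 - n.+1%:R / 2
    + 1 / 12) * ln n.+1%:R
    + n.+1%:R ^+ 2 / 4 - n%:R * z + z ^+ 2 / 2 * ln n.+1%:R) - hsum z q z - glaisher R n
    + z ^+ 2 / 2 * (\sum_(k < n) k.+1%:R^-1 - ln n.+1%:R)) = r n.+1.
  have e1 : \sum_(i < n) bterm 0 i z = \sum_(m < n.+1) m%:R * ln (z + m%:R)
      - \sum_(k < n) k.+1%:R * ln k.+1%:R - n%:R * z + z ^+ 2 / 2 * \sum_(k < n) k.+1%:R^-1.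
    rewrite [X in _ = X - _ - _ + _]big_ord_recl mul0r add0r.
    have -> : n%:R * z = \sum_(i < n) z by rewrite sumr_const card_ord mulr_natl.
    rewrite mulr_sumr -!sumrB -big_split; apply: eq_bigr => i _ /=.
    have i0 : 0 < i.+1%:R :> R by rewrite ltr0n.
    rewrite /bump add1n.
    have -> : ln (z + i.+1%:R) = ln i.+1%:R + ln (1 + z / i.+1%:R).
      rewrite -lnM ?posrE ?ltr_wpDr ?divr_ge0 ?(ltW i0) //.
      by congr ln; field; rewrite gt_eqF.
    by move: (ln _) (ln _) => a b; field; rewrite gt_eqF.
  rewrite e1 /r /glaisher; ring.
have c : r n.+1 @[n --> \oo] --> bsum 0 z - (z ^+ 2 / 2 + z / 2 + 1 / 12 - hsum z q z
      - (1 / 12 - derive1 zeta (-1)) + z ^+ 2 / 2 * euler_mascheroni R).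
  rewrite -(funext hr).
  apply: (cvgB (@bsum_cvg R 0 z z0)).
  apply: cvgD; last by apply: cvgMr; exact: cvg_euler_mascheroni.
  apply: cvgB; last exact: lim_deriv_zeta.
  by apply: cvgB; [exact: hsum_end | exact: cvg_cst].
have {}c := cvg_norm c; apply: (cvgr_to_le (c _)); near=> n.
exact: hC.
Unshelve. all: by end_near. Qed.

(** The only values of n for which the exponent at n + 1 is not the derivative of
    the exponent at n. They are the differences between the derivatives of the
    coefficients of S~ and the next ones, and at the same time the Euler
    characteristics of M_(1,1) and M_(0,3), whose predecessors M_(1,0) and
    M_(0,2) are not stable. *)
Definition defect (n : nat) : R :=
  match n with 0%N => - (1 / 12) | 2%N => 1 | _ => 0 end.

(** Adding a marked point multiplies the Euler characteristic by -(2g - 2 + n),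
    which is the effect of d/dz on z^-(2g-2+n). *)
Lemma chi_degS n j : chi_deg R n.+1 j = dcoef (chi_deg R n) j + defect n * (j == 1%N)%:R.
Proof.
case: j => [|i]; first by rewrite /chi_deg /= mulr0 addr0.
rewrite /chi_deg /dcoef.
have -> : [&& 0 < i.+1, n < i.+1 + 2 & ~~ odd (i.+1 + n.+1)]%N = (n <= i + 2)%N && ~~ odd (i + n).
  by lia.
case: i => [|i].
  rewrite eqxx mulr1 mulr0n oppr0 mul0r add0r /=.
  case: n => [|[|[|n]]] //=.
    rewrite /chiM /= bernoulli2 (_ : (2 * 1)`! = 2)%N // (_ : (2 * 1 + 1 - 3)`! = 1)%N //.
    by field.
  rewrite /chiM /= (_ : bernoulli R 0 = 1) // (_ : (2 * 0)`! = 1)%N //.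
  by rewrite muln0; field.
rewrite (_ : (i.+2 == 1%N) = false) // mulr0 addr0 (_ : (0 < i.+1)%N = true) // andTb.
rewrite (_ : i.+2 + 2 - n.+1 = i.+1 + 2 - n)%N; last by lia.
case: ifP => [/andP[h1 h2]|]; last by rewrite mulr0.
set g := (_ - n)./2.
have e : (2 * g + n = i.+3)%N by rewrite /g; lia.
rewrite /chiM (_ : 2 * g + n.+1 - 3 = i.+1)%N; last by lia.
rewrite (_ : 2 * g + n - 3 = i)%N; last by lia.
by rewrite factS natrM exprS; ring.
Qed.

Variable zeta : R -> R.

(** The n-th derivative in x at x = 0 of S~ + x^2 / (2 lambda^2). *)
Definition dS_tilde (n : nat) (z : R) : R :=
  match n with
  | 0%N => - (derive1 zeta (-1) + z / 2 * ln (2 * pi)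
              + (z ^+ 2 / 2 - 1 / 12) * ln z - 3 * z ^+ 2 / 4)
  | 1%N => - (1 / 2) * ln (2 * pi) - z * ln z + z
  | 2%N => - ln z
  | _ => 0
  end.

Lemma coef_S_tilde n z : (S_tilde zeta z)`_n = dS_tilde n z / n`!%:R.
Proof.
rewrite /S_tilde !coefB coefD coefN coefC !coefZ coefX coefXn.
case: n => [|[|[|n]]] /=.
- by rewrite fact0; field.
- by rewrite (_ : 1`! = 1%N) //; field.
- by rewrite (_ : 2`! = 2%N) //; field.
- by ring.
Qed.

Lemma drv_dS_tilde n (z : R) : 0 < z ->
  is_derive z 1 (dS_tilde n) (dS_tilde n.+1 z - defect n / z).
Proof.
move=> z0; have zn : z != 0 by rewrite gt_eqF.
have dx := drv_id z; have dl := @drv_ln R (fun u => u) z _ z0 dx.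
case: n => [|[|[|n]]] /=.
- have h := drvN (drvD (drvD (drvD (drv_cst (derive1 zeta (-1)) z)
    (drvM (drvM dx (drv_cst 2^-1 z)) (drv_cst (ln (2 * pi)) z)))
    (drvM (drvD (drvM (drvX 2 dx) (drv_cst 2^-1 z)) (drv_cst (- (1 / 12)) z)) dl))
    (drvN (drvM (drvM (drv_cst 3 z) (drvX 2 dx)) (drv_cst 4^-1 z)))).
  by apply: (drvE h) => /=; field.
- have h := drvD (drvD (drv_cst (- (1 / 2) * ln (2 * pi)) z) (drvN (drvM dx dl))) dx.
  by apply: (drvE h) => /=; field.
- by apply: (drvE (drvN dl)); field.
- by apply: (drvE (drv_cst 0 z)); rewrite mul0r subrr.
Qed.

Definition exponent_deriv n z := lnG n z + dS_tilde n z.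

Lemma exponent_coefE n z : 0 < z -> exponent_coef zeta n z = n`!%:R^-1 * exponent_deriv n z.
Proof.
by move=> z0; rewrite /exponent_coef derive1n_ln_barnesG // coef_S_tilde -mulrDl mulrC.
Qed.

Hypothesis zetaP : is_riemann_zeta zeta.

(** The Bernoulli terms with j <= 2, the constant and the quadratic polynomial of
    log G(z + 1) are exactly what S~ removes. The others are
    B_(2g) / (2g (2g - 2)) z^(2-2g), that is chi(M_(g,0)) z^(2-2g). *)
Lemma expansion_exponent_deriv0 : expansion (exponent_deriv 0) (chi_deg R 0).
Proof.
move=> n; have [C hC] := bsum_em n zetaP.
exists (C + `|chi_deg R 0 n.+1|), 1 => z _ z1.
have z0 : 0 < z by lra.
have zn : z != 0 by rewrite gt_eqF.
pose tail := \sum_(i < n.+1) B i.+3 / i.+3`!%:R * hder z i.+3 z.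
have e1 : hsum z n z = - z ^+ 2 / 2 * ln z + 3 * z ^+ 2 / 4 + ln z / 12 + tail.
  rewrite /hsum !(big_ord_recl n.+3) !(big_ord_recl n.+2) !(big_ord_recl n.+1).
  rewrite (eq_bigr (fun i : 'I_n.+1 => B i.+3 / i.+3`!%:R * hder z i.+3 z)) // -/tail.
  rewrite [nat_of_ord ord0]/= [nat_of_ord (lift ord0 ord0)]/= [nat_of_ord (lift ord0
      (lift ord0 ord0))]/=.
  rewrite (_ : B 0 = 1) // bernoulli1 bernoulli2 fact0 (_ : 1`! = 1%N) // (_ : 2`! = 2%N) //.
  by move: tail => t; rewrite /hder /=; field.
have e2 : tail = - \sum_(k < n.+2) chi_deg R 0 k * z ^- k.
  rewrite big_ord_recl [chi_deg R 0 _]/= mul0r add0r -sumrN; apply: eq_bigr => i _.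
  rewrite [nat_of_ord (lift _ _)]/= /bump add1n /chi_deg /= !addn0 negbK.
  case: ifP => oi.
    have [g gi] : exists g, (i.+3 = 2 * g)%N by exists (i.+3)./2; lia.
    have ig : (i : nat) = (2 * g - 3)%N by lia.
    rewrite (_ : uphalf (i + 2) = g); last by lia.
    rewrite /chiM expr0 mul1r addn0 -ig -gi.
    have f0 : i.+3`!%:R != 0 :> R by rewrite pnatr_eq0 -lt0n fact_gt0.
    rewrite -signr_odd oi expr1 [i.+1`!]factS natrM -[i.+3%:R]natr1 -[i.+2%:R]natr1 !exprS.
    move: (i.+3`!%:R : R) (i.+1%:R : R) f0 => a b a0.
    by field; rewrite ?a0 ?zn ?expf_neq0.
  rewrite mul0r oppr0; suff -> : B i.+3 = 0 by rewrite !mul0r.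
  by apply: bernoulli_odd => //=; rewrite oi.
have e3 : exponent_deriv 0 z = bsum 0 z - (z ^+ 2 / 2 + z / 2 + 1 / 12 - hsum z n z
      - (1 / 12 - derive1 zeta (-1)) + z ^+ 2 / 2 * euler_mascheroni R) - tail.
  rewrite /exponent_deriv /lnG /bpoly hornerD hornerN !hornerCM hornerX hornerXn e1 /dS_tilde.
  by field.
rewrite e3 e2 opprK big_ord_recr /=.
have h := hC z z1; move: (bsum 0 z - _) h => r h.
rewrite addrCA addrAC subrr add0r mulrDl.
rewrite addrC; apply: le_trans (ler_normD _ _) _; rewrite addrC; apply: lerD => //.
by rewrite normrM; apply: ler_pM => //; rewrite ger0_norm // invr_ge0 exprn_ge0 // ltW.
Qed.

Lemma dS_tilde_bound n z : 1 <= z -> `|dS_tilde n.+2 z| <= z.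
Proof.
move=> z1; case: n => [|n] /=; last by rewrite normr0; lra.
rewrite normrN ger0_norm ?ln_ge0 //.
have e : z = 1 + (z - 1) by ring.
by rewrite {1}e; apply: (le_trans (le_ln1Dx _)); lra.
Qed.

Lemma defect_bound n : `|defect n| <= 1.
Proof.
case: n => [|[|[|n]]] /=; rewrite ?normr0 ?normr1 // normrN ger0_norm; lra.
Qed.

(** From n = 0 by differentiation, in parallel with [chi_degS]. *)
Lemma expansion_exponent_deriv n : expansion (exponent_deriv n) (chi_deg R n).
Proof.
elim: n => [|n IH]; first exact: expansion_exponent_deriv0.
have [C hC] := @lnG_bound R n.
pose f1 z : R := exponent_deriv n.+1 z - defect n / z.
pose f2 z : R := exponent_deriv n.+2 z - defect n.+1 / z + defect n / z ^+ 2.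
have d1 (z : R) : 0 < z -> is_derive z 1 (exponent_deriv n) (f1 z).
  by move=> z0; apply: (drvE (drvD (drv_lnG n z0) (drv_dS_tilde n z0))); rewrite addrA.
have d2 (z : R) : 0 < z -> is_derive z 1 f1 (f2 z).
  move=> z0; have zn : z != 0 by rewrite gt_eqF.
  have h := drvD (drvD (drv_lnG n.+1 z0) (drv_dS_tilde n.+1 z0))
    (drvN (drvM (drv_cst (defect n) z) (drvV zn (drv_id z)))).
  by apply: (drvE h); rewrite /f2 /exponent_deriv; field.
have b2 z : 1 <= z -> `|f2 z| <= (C + 3) * z ^+ 3.
  move=> z1; have z0 : 0 < z by lra.
  have z3 : z <= z ^+ 3 by rewrite exprS ler_peMr ?exprn_ege1 // ltW.
  have t k (c : R) : `|c| <= 1 -> `|c / z ^+ k| <= 1.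
    move=> c1; rewrite normrM normfV -[1]mulr1; apply: ler_pM => //.
    rewrite invf_le1 ?normr_gt0 ?expf_neq0 ?gt_eqF //.
    by rewrite ger0_norm ?exprn_ege1 ?exprn_ge0 // ltW.
  have := hC z z1; have := dS_tilde_bound n z1.
  have := t 1%N _ (defect_bound n.+1); have := t 2%N _ (defect_bound n).
  rewrite /f2 /exponent_deriv expr1 !ler_norml mulrDl.
  by move=> /andP[? ?] /andP[? ?] /andP[? ?] /andP[? ?]; apply/andP; split; lra.
have h := expansion_invX (defect n) (expansion_derive d1 d2 b2 IH).
move=> k; have [C' [z0 hk]] := h k; exists C', z0 => z zz0 z1.
have := hk z zz0 z1; rewrite /f1 subrK.
by under eq_bigr => i _ do rewrite -chi_degS.
Qed.

Lemma asymptotic_exponent n : asymptotic_expansion (exponent_coef zeta n) (exponent R n).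
Proof.
apply: expansion_asymptotic.
have h := expansionZ n`!%:R^-1 (expansion_exponent_deriv n).
have {}h := expansion_eq (fun z (z1 : 1 <= z) => esym (exponent_coefE n (lt_le_trans ltr01 z1))) h.
move=> k; have [C [z0 hk]] := h k; exists C, z0 => z zz0 z1.
have := hk z zz0 z1; congr (`|_ - _| <= _); apply: eq_bigr => i _; congr (_ * _).
exact: mulrC.
Qed.
End BarnesExpansion.

(* [e i j] is the coefficient of x^i z^-j in the exponent of the integrand,
   apart from - x^2 / (2 lambda^2); the last equation compares the coefficients
   of lambda^(2k) z^-m. *)
Theorem corollary4p2 (R : realType) (zeta : R -> R) :
  is_riemann_zeta zeta ->
  exists e : fps2 R,
    [/\ forall n : nat, asymptotic_expansion (exponent_coef zeta n) (e n),
        e 0%N 0%N = 0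
      & forall k m : nat,
          G_series R k m = fps2_log (gauss_integral (fps2_exp e)) k m].
Proof.
move=> zetaP; exists (exponent R); split.
- by move=> n; apply: asymptotic_exponent.
- exact: val_exponent.
- by move=> k m; apply: graph_sum_log.
Qed.
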